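(* Let $X\subseteq\mathbb{R}^d$ be bounded and $1\leq k<d$ an integer. Then for all $V\in G(d,k)$ and all $\theta\in(0,1]$, \[ \underline{\dim}_\theta P_V(X)\leq\underline{\dim}_\theta^kX\quad\text{and}\quad\overline{\dim}_\theta P_V(X)\leq\overline{\dim}_\theta^kX. \] Moreover, for $\gamma_{d,k}$-almost all $V\in G(d,k)$, \[ \underline{\dim}_\theta P_V(X)=\underline{\dim}_\theta^kX\quad\text{and}\quad\overline{\dim}_\theta P_V(X)=\overline{\dim}_\theta^kX\quad\text{for all }\theta\in(0,1]. \]
   Context: Intermediate dimensions: for $Y\subseteq\mathbb{R}^m$ and $0<\theta\leq1$, $\underline{\dim}_\theta Y$ is the infimum of $s\geq0$ such that for all $\epsilon>0$ and all $r_0>0$ there exist $0<r\leq r_0$ and a cover $\{U_i\}$ of $Y$ with $r^{1/\theta}\leq|U_i|\leq r$ and $\sum_i|U_i|^s\leq\epsilon$; $\overline{\dim}_\theta Y$ is the infimum of $s\geq0$ such that for all $\epsilon>0$ there is $r_0>0$ such that for all $0<r\leq r_0$ there is a cover $\{U_i\}$ of $Y$ with $r^{1/\theta}\leq|U_i|\leq r$ and $\sum_i|U_i|^s\leq\epsilon$. Intermediate dimension profiles: for integer $1\leq k\leq d$, $0\leq s\leq k$, $0<r\leq1$, define on $\mathbb{R}^d$ the kernel $\phi_{r,\theta}^{s,k}(x)=1$ if $|x|<r$, $=(r/|x|)^s$ if $r\leq|x|<r^\theta$, and $=r^{\theta(k-s)+s}/|x|^k$ if $r^\theta\leq|x|$.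 For compact $X$, $C_{r,\theta}^{s,k}(X)=\big(\inf_\mu\iint\phi_{r,\theta}^{s,k}(x-y)\,d\mu(x)\,d\mu(y)\big)^{-1}$, infimum over Borel probability measures supported on $X$; for bounded $X$ use the closure. $\underline{\dim}_\theta^kX$ (resp. $\overline{\dim}_\theta^kX$) is the unique $s\in[0,k]$ with $\liminf_{r\to0}\frac{\log C_{r,\theta}^{s,k}(X)}{-\log r}=s$ (resp. with $\limsup$); such $s$ exists and is unique. $G(d,k)$ is the Grassmannian of $k$-dimensional subspaces of $\mathbb{R}^d$ with rotation-invariant probability measure $\gamma_{d,k}$; $P_V$ is orthogonal projection onto $V$, identified with $\mathbb{R}^k$. *)

(* Defs.v *)
From HB Require Import structures.
From mathcomp Require Import all_boot all_order all_algebra.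
From mathcomp Require Import all_classical all_reals all_analysis.
Set Implicit Arguments. Unset Strict Implicit. Unset Printing Implicit Defensive.
Import Order.TTheory GRing.Theory Num.Theory.
Import numFieldNormedType.Exports.
Local Open Scope classical_set_scope.
Local Open Scope ring_scope.

Section Defs.
Variable R : realType.

Definition enorm m (x : 'rV[R]_m) : R := Num.sqrt (\sum_(i < m) x ord0 i ^+ 2).

Definition ediam m (U : set 'rV[R]_m) : \bar R :=
  ereal_sup [set (enorm (x - y))%:E | x in U & y in U].

Definition theta_cover_ok m (Y : set 'rV[R]_m) (theta r s eps : R) : Prop :=
  exists U : seq (set 'rV[R]_m),
    Y `<=` \bigcup_(i in [set i | (i < size U)%N]) nth set0 U i /\
    (forall V, V \in U -> ((r `^ theta^-1)%:E <= ediam V)%E /\ (ediam V <= r%:E)%E) /\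
    \sum_(V <- U) (fine (ediam V)) `^ s <= eps.

Definition lower_int_dim m (theta : R) (Y : set 'rV[R]_m) : \bar R :=
  ereal_inf [set s%:E | s in [set s : R | 0 <= s /\
    forall eps, 0 < eps -> forall r0, 0 < r0 ->
      exists r, 0 < r <= r0 /\ theta_cover_ok Y theta r s eps]].

Definition upper_int_dim m (theta : R) (Y : set 'rV[R]_m) : \bar R :=
  ereal_inf [set s%:E | s in [set s : R | 0 <= s /\
    forall eps, 0 < eps -> exists r0, 0 < r0 /\
      forall r, 0 < r <= r0 -> theta_cover_ok Y theta r s eps]].

Definition borelT (T : topologicalType) := g_sigma_algebraType (@open T).

Definition kernel_phi d (k : nat) (s r theta : R) (x : 'rV[R]_d) : R :=
  let n := enorm x in
  if n < r then 1
  else if n < r `^ theta then (r / n) `^ s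
  else r `^ (theta * (k%:R - s) + s) / n ^+ k.

Definition energy d k s r theta (mu : probability (borelT 'rV[R]_d) R) : \bar R :=
  (\int[mu]_x \int[mu]_y (kernel_phi k s r theta (x - y))%:E)%E.

Definition capacity d k s r theta (X : set 'rV[R]_d) : R :=
  (fine (ereal_inf [set e | exists mu : probability (borelT 'rV[R]_d) R,
      mu (~` closure X) = 0%E /\ e = energy k s r theta mu]))^-1.

Definition liminf0 (f : R -> R) : \bar R :=
  ereal_sup [set ereal_inf [set (f r)%:E | r in `]0, delta[] | delta in `]0, +oo[].
Definition limsup0 (f : R -> R) : \bar R :=
  ereal_inf [set ereal_sup [set (f r)%:E | r in `]0, delta[] | delta in `]0, +oo[].

Definition lower_profile d (k : nat) (theta : R) (X : set 'rV[R]_d) : R :=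
  xget 0 [set s : R | 0 <= s <= k%:R /\
     liminf0 (fun r => ln (capacity k s r theta X) / - ln r) = s%:E].

Definition upper_profile d (k : nat) (theta : R) (X : set 'rV[R]_d) : R :=
  xget 0 [set s : R | 0 <= s <= k%:R /\
     limsup0 (fun r => ln (capacity k s r theta X) / - ln r) = s%:E].

(* G(d,k) represented by orthogonal projection matrices of rank k *)
Definition grassmannian d (k : nat) (P : 'M[R]_d) : Prop :=
  P^T = P /\ P *m P = P /\ \rank P = k.

(* A has orthonormal rows spanning the range of P: identification V ~ R^k *)
Definition frame_of d k (A : 'M[R]_(k, d)) (P : 'M[R]_d) : Prop :=
  A *m A^T = 1%:M /\ A^T *m A = P.

Definition proj_coords d k (A : 'M[R]_(k, d)) (X : set 'rV[R]_d) : set 'rV[R]_k :=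
  [set x *m A^T | x in X].

Definition rotation d (O : 'M[R]_d) : Prop := O^T *m O = 1%:M /\ \det O = 1.

Definition rotation_invariant d (gamma : probability (borelT 'M[R]_d) R) : Prop :=
  forall O : 'M[R]_d, rotation O ->
  forall B : set (borelT 'M[R]_d), measurable B ->
    gamma ((fun P : 'M[R]_d => O *m P *m O^T) @^-1` B) = gamma B.

End Defs.

(* Main.v *)
Require Import Defs.
From HB Require Import structures.
From mathcomp Require Import all_boot all_order all_algebra.
From mathcomp Require Import all_classical all_reals all_analysis.
From mathcomp Require Import measurable_realfun.
From mathcomp Require Import ring lra.
Import Order.TTheory GRing.Theory Num.Theory.
Import numFieldNormedType.Exports HBNNSimple.
Local Open Scope classical_set_scope.
Local Open Scope ring_scope.
Set Implicit Arguments. Unset Strict Implicit. Unset Printing Implicit Defensive.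

(* Only finitely supported weights on X matter: the kernel is stable, up to a constant
   factor, under shifts of size r, so the capacity C_r is comparable to 1/K_r, where K_r is
   the infimum of the energies of finite weighted configurations in X.  The exponent of C_r
   is nondecreasing and (1 - theta)-Lipschitz in s, so the profile exists as a fixed point,
   and it is left-continuous in theta.

   Upper bound.  Mixing an almost optimal weight with a Dirac mass shows that its potential
   is at least K_r / 2 on X, hence also on the projection, the kernel being nonincreasing
   and projections being 1-Lipschitz.  Every projected point then has a dyadic scale at which
   its ball carries a large mass; at each scale there are few disjoint such balls, and
   cutting the balls into cubes of diameter between r and r^theta gives the cover.

   Lower bound.  By rotation invariance gamma{|P x| <= rho} depends only on rho / |x|, and
   averaging over a grid of points x, of which only few can lie near the kernel of P, bounds
   it by c (rho / |x|)^k.  Hence the truncated energy of the projected weight has mean at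
   most c log(1/r) times the original energy.  Markov and Borel-Cantelli along a sequence of
   radii bound it for almost every P, and Cauchy-Schwarz over the members of a cover turns
   this into a lower bound for its cost.  Rational theta suffice, by monotonicity of the
   intermediate dimensions and left-continuity of the profiles. *)

(** * The kernel *)

(** The energy is an iterated integral, so working with general measures would call for the
    measurability of potentials and for a minimising measure. Finite configurations avoid both:
    comparing C_r with 1/K_r takes only one-sided bounds for integrals of arbitrary nonnegative
    functions, an upper one for finitely supported measures and a lower one by step functions on
    small cells. Every loss is a constant factor or a power of log(1/r), hence smaller than any
    r^(-eta). What pays for the losses is the link between kernel scale and cover scale: a kernel at
    scale r is matched with covers at scale r^theta, whose members have diameters between r and
    r^theta. Changing the exponent of a member by t - s then changes its cost by a factor r^(theta
    (t - s)) at least, and all auxiliary parameters [eta] are fixed fractions of that gain. *)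

Section Kernel.
Variable R : realType.
Implicit Types (k : nat) (s r theta q t n a x l : R).

(** Radial profile of the kernel: [kernel_phi] at [x] is convertible to [kern] at [enorm x], and the
    proofs pass silently from one to the other. *)
Definition kern k s r theta n : R :=
  if n < r then 1
  else if n < r `^ theta then (r / n) `^ s
  else r `^ (theta * (k%:R - s) + s) / n ^+ k.

(** Logarithm of the kernel as a function of x = ln n, with l = ln r: continuous and piecewise
    linear with slopes 0, -s and -K. Inequalities between kernels thus become case analyses in
    linear arithmetic. *)
Definition lkern (K : R) s l theta x : R :=
  if x < l then 0
  else if x < theta * l then s * (l - x)
  else (theta * (K - s) + s) * l - K * x.

Lemma expR_lnM (y a : R) : 0 < y -> expR (a * ln y) = y `^ a.
Proof. by move=> y0; rewrite /powR gt_eqF. Qed.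

Lemma kern_lkern k s r theta n : 0 < r -> 0 < n ->
  kern k s r theta n = expR (lkern k%:R s (ln r) theta (ln n)).
Proof.
move=> r0 n0; rewrite /kern /lkern ltr_ln// -ln_powR ltr_ln ?posrE ?powR_gt0//.
case: ifP => _; first by rewrite expR0.
case: ifP => _; first by rewrite -ln_div// expR_lnM// divr_gt0.
by rewrite expRB expR_lnM// expR_lnM// powR_mulrn// ltW.
Qed.

Lemma lkern_le0 (K : R) s l theta x : l < 0 -> 0 < theta <= 1 -> 0 <= s <= K ->
  lkern K s l theta x <= 0.
Proof.
move=> l0 /andP[t0 t1] /andP[s0 sK]; rewrite /lkern.
case: ltP => // h1; case: ltP => h2; first by nra.
have : 0 <= (K - s) * (x - theta * l) by rewrite mulr_ge0 ?subr_ge0.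
have : 0 <= s * (x - l) by rewrite mulr_ge0 ?subr_ge0.
nra.
Qed.

Lemma lkern_ninc (K : R) s l theta x y : l < 0 -> 0 < theta <= 1 -> 0 <= s <= K ->
  x <= y -> lkern K s l theta y <= lkern K s l theta x.
Proof.
move=> l0 /andP[t0 t1] /andP[s0 sK] xy.
have lt : l <= theta * l by nra.
have K0 : 0 <= K by lra.
have k1 : 0 <= K * (y - x) by rewrite mulr_ge0 ?subr_ge0.
have k2 : 0 <= s * (y - x) by rewrite mulr_ge0 ?subr_ge0.
rewrite /lkern; case: (ltP y l) => h1; case: (ltP x l) => h2; try lra.
  case: ltP => h3; first by nra.
  have : 0 <= (K - s) * (y - theta * l) by rewrite mulr_ge0 ?subr_ge0.
  have : 0 <= s * (y - l) by rewrite mulr_ge0 ?subr_ge0.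
  nra.
case: (ltP y) => h3; case: (ltP x) => h4; try nra.
Qed.

Lemma lkernD_ndec (K : R) s l theta x y : l < 0 -> 0 < theta <= 1 -> 0 <= s <= K ->
  x <= y -> lkern K s l theta x + K * x <= lkern K s l theta y + K * y.
Proof.
move=> l0 /andP[t0 t1] /andP[s0 sK] xy.
have lt : l <= theta * l by nra.
have K0 : 0 <= K by lra.
have k1 : 0 <= K * (y - x) by rewrite mulr_ge0 ?subr_ge0.
have k2 : 0 <= (K - s) * (y - x) by rewrite mulr_ge0 ?subr_ge0.
rewrite /lkern; case: (ltP y l) => h1; case: (ltP x l) => h2; try lra.
  case: ltP => h3.
    have : 0 <= s * (l - x) by rewrite mulr_ge0 ?subr_ge0// ltW.
    nra.
  have : 0 <= (K - s) * (theta * l - x) by rewrite mulr_ge0 ?subr_ge0// ltW//; lra.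
  have : 0 <= s * (l - x) by rewrite mulr_ge0 ?subr_ge0// ltW.
  nra.
case: (ltP y) => h3; case: (ltP x) => h4; try nra.
Qed.

Lemma lkern_s (K : R) s t l theta x : l < 0 -> 0 < theta <= 1 -> s <= t ->
  lkern K t l theta x <= lkern K s l theta x /\
  lkern K s l theta x <= - (1 - theta) * (t - s) * l + lkern K t l theta x.
Proof.
move=> l0 /andP[t0 t1] st; rewrite /lkern.
have lt : l <= theta * l by nra.
case: ltP => h1; first by split=> //; nra.
case: ltP => h2; split; try nra.
Qed.

Lemma lkern_theta (K : R) s l q theta x : l < 0 -> 0 < q -> q <= theta -> theta <= 1 ->
  0 <= s <= K -> lkern K s l q x <= - (theta - q) * K * l + lkern K s l theta x.
Proof.
move=> l0 q0 qt t1 /andP[s0 sK]; rewrite /lkern.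
have lt : l <= theta * l by nra.
have lq : theta * l <= q * l by nra.
have e0 : 0 <= - (theta - q) * l by nra.
have e1 : 0 <= (- (theta - q) * l) * K by rewrite mulr_ge0//; lra.
have e2 : 0 <= (- (theta - q) * l) * s by rewrite mulr_ge0//.
case: ltP => h1; first by nra.
case: ltP => h2; case: ltP => h3; try nra.
Qed.

Section Fixed.
Variables (k : nat) (s r theta : R).
Hypotheses (r01 : 0 < r < 1) (th : 0 < theta <= 1) (sk : 0 <= s <= k%:R).

Let r0 : 0 < r. Proof. by case/andP: r01. Qed.
Let lr : ln r < 0. Proof. by rewrite ln_lt0. Qed.

Lemma kern_lt n : n < r -> kern k s r theta n = 1.
Proof. by rewrite /kern => ->. Qed.

Lemma kern_gt0 n : 0 <= n -> 0 < kern k s r theta n.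
Proof.
rewrite le_eqVlt => /predU1P[<-|n0]; first by rewrite kern_lt.
by rewrite kern_lkern// expR_gt0.
Qed.

Lemma kern_le1 n : 0 <= n -> kern k s r theta n <= 1.
Proof.
rewrite le_eqVlt => /predU1P[<-|n0]; first by rewrite kern_lt.
by rewrite kern_lkern// -[leRHS]expR0 ler_expR lkern_le0.
Qed.

Lemma kern_ninc m n : 0 <= m -> m <= n -> kern k s r theta n <= kern k s r theta m.
Proof.
rewrite le_eqVlt => /predU1P[<-|m0] mn; first by rewrite (kern_lt r0) kern_le1.
have n0 : 0 < n by apply: lt_le_trans mn.
by rewrite !kern_lkern// ler_expR lkern_ninc// ler_ln.
Qed.

(** On the logarithmic scale no slope of the kernel is below -k, so multiplying by the k-th power
    makes it nondecreasing. This limits the loss under dilations, and from there under shifts. *)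
Lemma kernM_ndec m n : 0 < m -> m <= n ->
  m ^+ k * kern k s r theta m <= n ^+ k * kern k s r theta n.
Proof.
move=> m0 mn; have n0 : 0 < n by apply: lt_le_trans mn.
rewrite !kern_lkern// -!(powR_mulrn k (ltW _))// /powR !gt_eqF//.
rewrite -!expRD ler_expR [leLHS]addrC [leRHS]addrC lkernD_ndec// ler_ln//.
Qed.

Lemma kern_dilate a n : 1 <= a -> 0 <= n ->
  kern k s r theta n <= a ^+ k * kern k s r theta (a * n).
Proof.
move=> a1; rewrite le_eqVlt => /predU1P[<-|n0].
  by rewrite mulr0 kern_lt// mulr1 exprn_ege1.
have an : n <= a * n by rewrite ler_peMl// ltW.
by have := kernM_ndec n0 an; rewrite exprMn -mulrA mulrCA ler_pM2l ?exprn_gt0.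
Qed.

Lemma kern_lb (D n : R) : 0 <= n <= D -> 1 <= D -> (r / D) ^+ k <= kern k s r theta n.
Proof.
move=> /andP[n0 nD] D1; have D0 : 0 < D by apply: lt_le_trans D1.
have rD : r <= D by apply: le_trans D1; apply: ltW; case/andP: r01.
apply: le_trans (kern_ninc n0 nD).
have := @kernM_ndec r D r0 rD.
have -> : kern k s r theta r = 1.
  rewrite kern_lkern// /lkern ltxx subrr mulr0; case: ltP => h; first by rewrite expR0.
  (* Here n = r falls in the last branch, which forces [theta] to be 1, and that branch also gives
     1. *)
  have [th0 th1] := andP th.
  have t1 : theta = 1 by apply/eqP; rewrite eq_le th1/=; have := lr; nra.
  by rewrite -[RHS]expR0 t1; congr expR; ring.
by rewrite mulr1 expr_div_n ler_pdivrMr ?exprn_gt0// mulrC.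
Qed.

(* Cutting a ball of radius [rho] into sets of diameter [Num.min rho (r `^ theta)]
   costs exactly what the kernel gains. *)
Lemma kern_cut_cost (rho t dl : R) : r <= rho -> s <= t ->
  dl = Num.min rho (r `^ theta) ->
  kern k s r theta rho * (rho / dl) ^+ k * dl `^ t <= r `^ (s + theta * (t - s)).
Proof.
move=> rrho st dlE; have rho0 : 0 < rho by apply: lt_le_trans rrho.
have rt0 : 0 < r `^ theta by rewrite powR_gt0.
have dl0 : 0 < dl by rewrite dlE lt_min rho0.
have -> : ((rho / dl) ^+ k) = expR (k%:R * (ln rho - ln dl)).
  by rewrite -ln_div// expR_lnM ?divr_gt0// powR_mulrn// ltW// divr_gt0.
rewrite -(expR_lnM t dl0) -(expR_lnM _ r0) kern_lkern// -!expRD ler_expR.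
have lrho : ln r <= ln rho by rewrite ler_ln.
have lnt : ln (r `^ theta) = theta * ln r by rewrite ln_powR.
case/andP: th => th0 th1.
have lr0 := lr.
(* Below r^theta the product is r^s rho^(t-s), largest at the right end; from r^theta on, the powers
   of rho cancel and equality holds. *)
rewrite /lkern ltNge lrho/= dlE; case: (ltP rho) => h.
  have : ln rho <= theta * ln r by rewrite -lnt ler_ln// ltW.
  rewrite -lnt ltr_ln// h lnt.
  nra.
have : theta * ln r <= ln rho by rewrite -lnt ler_ln.
by rewrite -lnt ltr_ln// ltNge h/= lnt; nra.
Qed.

(** Estimate for one dyadic scale rho: (r/rho)^s is the weight of the scale, and the minimum will
    bound the probability that a vector of length n projects to length at most rho. *)
Lemma kern_transversal (c rho n : R) : 1 <= c -> r <= rho -> rho <= 2 * r `^ theta ->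
  0 < n -> (r / rho) `^ s * Num.min 1 (c * (rho / n) ^+ k) <= c * 2 ^+ k * kern k s r theta n.
Proof.
move=> c1 rrho rhot n0; have rho0 : 0 < rho by apply: lt_le_trans rrho.
have c0 : 0 < c by lra.
have lr0 := lr.
have two1 : 1 <= 2 ^+ k :> R by rewrite exprn_ege1// ler1n.
have lnt : ln (r `^ theta) = theta * ln r by rewrite ln_powR.
have rt0 : 0 < r `^ theta by rewrite powR_gt0.
have lrho : ln r <= ln rho by rewrite ler_ln.
have lrho2 : ln rho <= ln 2 + theta * ln r by rewrite -lnt -lnM ?posrE// ler_ln ?posrE ?mulr_gt0.
have l2 : 0 <= ln 2 :> R by rewrite ln_ge0// ler1n.
have rr0 : 0 < r / rho by rewrite divr_gt0.
case/andP: th => th0 th1; case/andP: sk => s0 sk'.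
have E : (r / rho) `^ s = expR (s * (ln r - ln rho)) by rewrite -ln_div// expR_lnM.
have E1 : (r / rho) `^ s <= expR 0.
  by rewrite E ler_expR; nra.
have E2 : (r / rho) `^ s * (rho / n) ^+ k = expR (s * (ln r - ln rho) + k%:R * (ln rho - ln n)).
  by rewrite expRD -E -ln_div ?posrE// (expR_lnM _ (divr_gt0 rho0 n0)) powR_mulrn// ltW// divr_gt0.
have m1 : Num.min 1 (c * (rho / n) ^+ k) <= 1 by rewrite ge_min lexx.
have m2 : Num.min 1 (c * (rho / n) ^+ k) <= c * (rho / n) ^+ k by rewrite ge_min lexx orbT.
have P0 : 0 <= (r / rho) `^ s by rewrite powR_ge0.
have -> : kern k s r theta n = expR (lkern k%:R s (ln r) theta (ln n)) by rewrite kern_lkern.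
have E0 x : 0 < expR x :> R by exact: expR_gt0.
have cc : 1 <= c * 2 ^+ k by nra.
have case1 : expR (s * (ln r - ln rho)) <= expR (lkern k%:R s (ln r) theta (ln n)) ->
  (r / rho) `^ s * Num.min 1 (c * (rho / n) ^+ k) <= c * 2 ^+ k * expR (lkern k%:R s (ln r) theta (ln n)).
  rewrite -E => h; apply: (le_trans (ler_wpM2l P0 m1)); rewrite mulr1.
  by apply: (le_trans h); rewrite ler_peMl// ltW.
have case2 : expR (s * (ln r - ln rho) + k%:R * (ln rho - ln n)) <= 2 ^+ k * expR (lkern k%:R s (ln r) theta (ln n)) ->
  (r / rho) `^ s * Num.min 1 (c * (rho / n) ^+ k) <= c * 2 ^+ k * expR (lkern k%:R s (ln r) theta (ln n)).
  rewrite -E2 => h; apply: (le_trans (ler_wpM2l P0 m2)).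
  by rewrite mulrCA -mulrA ler_pM2l.
have e2 : 2 ^+ k = expR (k%:R * ln 2) :> R by rewrite expR_lnM// powR_mulrn.
have l2k : 0 <= k%:R * ln 2 :> R by rewrite mulr_ge0.
rewrite e2 -expRD ler_expR in case2; rewrite ler_expR in case1.
(* The bound of the minimum by 1 settles n < r, and also n <= rho when n is below r^theta. Otherwise
   its second term is used; from r^theta on, rho <= 2 r^theta costs the factor 2^k. *)
move: case1 case2; rewrite -e2.
rewrite /lkern; case: ltP => h1; first by move=> + _; apply; nra.
case: ltP => h2.
  case: (lerP (ln n) (ln rho)) => h3; first by move=> + _; apply; nra.
  move=> _; apply.
  have : 0 <= (k%:R - s) * (ln n - ln rho) by rewrite mulr_ge0 ?subr_ge0// ltW.
  nra.
move=> _; apply.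
have : 0 <= (k%:R - s) * (ln 2 + theta * ln r - ln rho) by rewrite mulr_ge0 ?subr_ge0.
have : 0 <= s * ln 2 by rewrite mulr_ge0.
nra.
Qed.

End Fixed.

(** The ratio of the two kernels is 1 for small n and increases up to n = r^theta, beyond which it
    equals r^(-(1-theta)(t-s)). This is where the Lipschitz constant 1 - theta comes from. *)
Lemma kern_s_mono k s t r theta n : 0 < r < 1 -> 0 < theta <= 1 -> s <= t -> 0 <= n ->
  kern k t r theta n <= kern k s r theta n /\
  kern k s r theta n <= r `^ (- (1 - theta) * (t - s)) * kern k t r theta n.
Proof.
move=> r01 th st n0; have [r0 r1] := andP r01.
have lr : ln r < 0 by rewrite ln_lt0.
have [->|nn0] := eqVneq n 0.
  rewrite !kern_lt// mulr1; split => //.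
  rewrite -(expR_lnM _ r0) -[leLHS]expR0 ler_expR; case/andP: th => _ th1.
  by rewrite mulr_le0 ?(ltW lr)// mulNr oppr_le0 mulr_ge0 ?subr_ge0.
have {}n0 : 0 < n by rewrite lt_neqAle eq_sym nn0.
rewrite !kern_lkern// -(expR_lnM _ r0) -expRD !ler_expR.
exact: lkern_s.
Qed.

Lemma kern_theta k s q theta r n : 0 < r < 1 -> 0 < q -> q <= theta -> theta <= 1 ->
  0 <= s <= k%:R -> 0 <= n ->
  kern k s r q n <= r `^ (- (theta - q) * k%:R) * kern k s r theta n.
Proof.
move=> r01 q0 qt t1 sk n0; have [r0 r1] := andP r01.
have lr : ln r < 0 by rewrite ln_lt0.
have [->|nn0] := eqVneq n 0.
  rewrite !kern_lt// mulr1 -(expR_lnM _ r0) -[leLHS]expR0 ler_expR.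
  by rewrite mulr_le0 ?(ltW lr)// mulNr oppr_le0 mulr_ge0 ?subr_ge0.
have {}n0 : 0 < n by rewrite lt_neqAle eq_sym nn0.
rewrite !kern_lkern// -(expR_lnM _ r0) -expRD !ler_expR.
by rewrite lkern_theta.
Qed.

End Kernel.

(** * Euclidean geometry and cubes *)

Section Euclid.
Variable R : realType.

Lemma sum_sqr_ge0 m (x : 'rV[R]_m) : 0 <= \sum_(i < m) x ord0 i ^+ 2.
Proof. by apply: sumr_ge0 => i _; exact: sqr_ge0. Qed.

Lemma enorm_ge0 m (x : 'rV[R]_m) : 0 <= enorm x.
Proof. exact: sqrtr_ge0. Qed.

Lemma enorm_sqr m (x : 'rV[R]_m) : enorm x ^+ 2 = \sum_(i < m) x ord0 i ^+ 2.
Proof. by rewrite sqr_sqrtr// sum_sqr_ge0. Qed.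

Lemma enorm_sqr_mul m (x : 'rV[R]_m) : enorm x ^+ 2 = (x *m x^T) ord0 ord0.
Proof. by rewrite enorm_sqr mxE; apply: eq_bigr => i _; rewrite mxE expr2. Qed.

Lemma enorm_le_sqr m (x : 'rV[R]_m) c : 0 <= c -> (enorm x <= c) = (\sum_(i < m) x ord0 i ^+ 2 <= c ^+ 2).
Proof. by move=> c0; rewrite -enorm_sqr ler_sqr// nnegrE enorm_ge0. Qed.

Lemma enorm0 m : enorm (0 : 'rV[R]_m) = 0.
Proof. by rewrite /enorm big1 ?sqrtr0// => i _; rewrite mxE expr0n. Qed.

Lemma enormN m (x : 'rV[R]_m) : enorm (- x) = enorm x.
Proof. by rewrite /enorm; congr Num.sqrt; apply: eq_bigr => i _; rewrite mxE sqrrN. Qed.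

Lemma enormBC m (x y : 'rV[R]_m) : enorm (x - y) = enorm (y - x).
Proof. by rewrite -enormN opprB. Qed.

Lemma enormZ m (c : R) (x : 'rV[R]_m) : enorm (c *: x) = `|c| * enorm x.
Proof.
rewrite /enorm -sqrtr_sqr -sqrtrM ?sqr_ge0//; congr Num.sqrt.
by rewrite mulr_sumr; apply: eq_bigr => i _; rewrite mxE exprMn.
Qed.

Lemma coord_le_enorm m (x : 'rV[R]_m) i : `|x ord0 i| <= enorm x.
Proof.
rewrite -ler_sqr ?nnegrE ?enorm_ge0// enorm_sqr real_normK ?num_real//.
by rewrite (bigD1 i)//= lerDl sumr_ge0// => j _; exact: sqr_ge0.
Qed.

Lemma enorm_gt0 m (x : 'rV[R]_m) : x != 0 -> 0 < enorm x.
Proof.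
move=> x0; rewrite lt_neqAle enorm_ge0 andbT eq_sym; apply: contra x0 => /eqP e.
by apply/eqP/rowP => i; apply/eqP; rewrite mxE -normr_le0 -e coord_le_enorm.
Qed.

Lemma enorm_le_coord m (x : 'rV[R]_m) h : 0 <= h ->
  (forall i, `|x ord0 i| <= h) -> enorm x <= Num.sqrt m%:R * h.
Proof.
move=> h0 xh; rewrite enorm_le_sqr ?mulr_ge0 ?sqrtr_ge0//.
rewrite exprMn sqr_sqrtr ?ler0n//.
rewrite (le_trans (y := \sum_(i < m) h ^+ 2))//.
  apply: ler_sum => i _; rewrite -real_normK ?num_real//.
  by rewrite ler_sqr ?nnegrE.
by rewrite big_const_ord iter_addr_0 mulr_natl.
Qed.

(** Cauchy-Schwarz, summed from (b x_i - a y_i)^2 >= 0 where a and b are the two norms. *)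
Lemma sum_mul_le_enorm m (x y : 'rV[R]_m) :
  \sum_(i < m) x ord0 i * y ord0 i <= enorm x * enorm y.
Proof.
have [->|x0] := eqVneq x 0.
  by rewrite enorm0 mul0r big1// => i _; rewrite mxE mul0r.
have [->|y0] := eqVneq y 0.
  by rewrite enorm0 mulr0 big1// => i _; rewrite mxE mulr0.
have a0 := enorm_gt0 x0; have b0 := enorm_gt0 y0.
set a := enorm x; set b := enorm y.
have le i : x ord0 i * y ord0 i <= (b / a * x ord0 i ^+ 2 + a / b * y ord0 i ^+ 2) / 2.
  have : 0 <= (b * x ord0 i - a * y ord0 i) ^+ 2 / (a * b).
    by rewrite divr_ge0 ?sqr_ge0// mulr_ge0 ?enorm_ge0.
  have -> : (b * x ord0 i - a * y ord0 i) ^+ 2 / (a * b) =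
     b / a * x ord0 i ^+ 2 + a / b * y ord0 i ^+ 2 - 2 * (x ord0 i * y ord0 i).
    by field; rewrite !gt_eqF.
  by lra.
apply: (le_trans (ler_sum _ (fun i _ => le i))).
rewrite -mulr_suml big_split/= -!mulr_sumr -!enorm_sqr -/a -/b.
have -> : (b / a * a ^+ 2 + a / b * b ^+ 2) / 2 = a * b by field; rewrite !gt_eqF.
by [].
Qed.

Lemma enormD m (x y : 'rV[R]_m) : enorm (x + y) <= enorm x + enorm y.
Proof.
rewrite enorm_le_sqr ?addr_ge0 ?enorm_ge0//.
have -> : \sum_(i < m) (x + y) ord0 i ^+ 2 =
  enorm x ^+ 2 + enorm y ^+ 2 + 2 * \sum_(i < m) x ord0 i * y ord0 i.
  rewrite !enorm_sqr mulr_sumr -!big_split/=; apply: eq_bigr => i _.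
  by rewrite mxE; ring.
have := sum_mul_le_enorm x y.
nra.
Qed.

Lemma enormB_trans m (y x z : 'rV[R]_m) : enorm (x - z) <= enorm (x - y) + enorm (y - z).
Proof. by have := enormD (x - y) (y - z); rewrite subrKA. Qed.

Lemma frame_enormE d k (A : 'M[R]_(k, d)) (P : 'M[R]_d) (x : 'rV[R]_d) :
  frame_of A P -> enorm (x *m A^T) = enorm (x *m P).
Proof.
move=> [AA AP]; rewrite /enorm; congr Num.sqrt.
apply/eqP; rewrite -!enorm_sqr eqrXn2 ?enorm_ge0//.
apply/eqP/(@pexpIrn _ 2) => //; rewrite ?nnegrE ?enorm_ge0//.
rewrite !enorm_sqr_mul -AP !trmx_mul !trmxK !mulmxA.
by rewrite -[x *m A^T *m A *m A^T]mulmxA AA mulmx1.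
Qed.

(** Pythagoras: the difference of the squares is the squared norm of the component orthogonal to the
    range. *)
Lemma frame_enorm_le d k (A : 'M[R]_(k, d)) (x : 'rV[R]_d) :
  A *m A^T = 1%:M -> enorm (x *m A^T) <= enorm x.
Proof.
move=> AA; rewrite -ler_sqr ?nnegrE ?enorm_ge0// -subr_ge0.
suff -> : enorm x ^+ 2 - enorm (x *m A^T) ^+ 2 = enorm (x - x *m A^T *m A) ^+ 2 by exact: sqr_ge0.
have tr : (x - x *m A^T *m A)^T = x^T - A^T *m (A *m x^T).
  by rewrite linearB/= !trmx_mul trmxK.
rewrite !enorm_sqr_mul tr mulmxBl !mulmxBr !trmx_mul !trmxK !mulmxA.
rewrite -[x *m A^T *m A *m A^T]mulmxA AA mulmx1.
by rewrite subrr subr0 !mxE.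
Qed.

Lemma ediam_ge m (V : set 'rV[R]_m) x y : V x -> V y -> ((enorm (x - y))%:E <= ediam V)%E.
Proof. by move=> Vx Vy; apply: ereal_sup_ubound; exists x => //; exists y. Qed.

Lemma enorm_le_ediam m (V : set 'rV[R]_m) (c : R) x y :
  (ediam V <= c%:E)%E -> V x -> V y -> enorm (x - y) <= fine (ediam V).
Proof.
move=> Vc Vx Vy; have := ediam_ge Vx Vy.
case: (ediam V) Vc => [e| |]//= _; by rewrite lee_fin.
Qed.

Lemma bigcup_nthP m (Y : set 'rV[R]_m) (U : seq (set 'rV[R]_m)) :
  (Y `<=` \bigcup_(i in [set i | (i < size U)%N]) nth set0 U i) <->
  (forall y, Y y -> exists2 V, V \in U & V y).
Proof.
split=> [h y /h[i/= iU Vy]|h y /h[V VU Vy]].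
  by exists (nth set0 U i) => //; exact: mem_nth.
by exists (index V U); rewrite /= ?index_mem// nth_index.
Qed.

Lemma truncn_bounds (a : R) : 0 <= a -> (Num.truncn a)%:R <= a < (Num.truncn a)%:R + 1.
Proof. by move=> a0; rewrite natr1 truncn_itv. Qed.

(** The cubes have diameter exactly [dl], because admissible covers also bound diameters from below.
    The radius 2 rho is the one at which a maximal 2 rho-separated family covers. *)
Lemma cube_cover m (z : 'rV[R]_m) (rho dl : R) : (0 < m)%N -> 0 < dl -> dl <= rho ->
  exists U : seq (set 'rV[R]_m),
  [/\ forall y, enorm (y - z) <= 2 * rho -> exists2 V, V \in U & V y,
      forall V, V \in U -> ediam V = dl%:E &
      (size U)%:R <= (4 * m%:R + 1) ^+ m * (rho / dl) ^+ m].
Proof.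
move=> m0 dl0 dlrho; have rho0 : 0 < rho by apply: lt_le_trans dlrho.
have sm0 : 0 < Num.sqrt m%:R :> R by rewrite sqrtr_gt0 ltr0n.
pose h := dl / Num.sqrt m%:R.
have h0 : 0 < h by rewrite divr_gt0.
pose N := (Num.truncn (4 * rho / h)).+1.
pose lo i (f : {ffun 'I_m -> 'I_N}) := z ord0 i - 2 * rho + (f i)%:R * h.
pose cube (f : {ffun 'I_m -> 'I_N}) : set 'rV[R]_m :=
  [set y | forall i, lo i f <= y ord0 i <= lo i f + h].
exists [seq cube f | f <- enum {ffun 'I_m -> 'I_N}]; split.
- move=> y yz.
  have yi i : 0 <= y ord0 i - z ord0 i + 2 * rho <= 4 * rho.
    have := le_trans (coord_le_enorm (y - z) i) yz; rewrite !mxE ler_norml; lra.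
  have yh i : 0 <= (y ord0 i - z ord0 i + 2 * rho) / h.
    by rewrite divr_ge0 ?(ltW h0)//; have /andP[] := yi i.
  pose f := [ffun i : 'I_m => inord (Num.truncn ((y ord0 i - z ord0 i + 2 * rho) / h)) : 'I_N].
  exists (cube f); first by apply: map_f; rewrite mem_enum.
  move=> i; rewrite /lo ffunE inordK; last first.
    rewrite /N ltnS; apply: le_truncn.
    by rewrite ler_pM2r ?invr_gt0//; have /andP[] := yi i.
  have /andP[] := truncn_bounds (yh i).
  move: (Num.truncn _)%:R => t.
  by rewrite ler_pdivlMr// ltr_pdivrMr// mulrDl mul1r; lra.
- move=> V /mapP[f _ ->].
  have shE : Num.sqrt m%:R * h = dl by rewrite mulrC divfK// gt_eqF.
  (* The diameter is attained at two opposite corners of the closed cube. *)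
  apply/eqP; rewrite eq_le; apply/andP; split.
    apply: ge_ereal_sup => _ [x cx [y cy <-]]; rewrite lee_fin -shE.
    apply: enorm_le_coord; first exact: ltW.
    move=> i; rewrite !mxE ler_norml; have := cx i; have := cy i; lra.
  pose x : 'rV[R]_m := \row_i lo i f; pose y : 'rV[R]_m := \row_i (lo i f + h).
  have cx : cube f x by move=> i; rewrite mxE lexx lerDl ltW.
  have cy : cube f y by move=> i; rewrite mxE lexx andbT lerDl ltW.
  apply: le_trans (ediam_ge cy cx); rewrite lee_fin.
  have -> : y - x = h *: const_mx 1.
    by apply/rowP => i; rewrite !mxE mulr1 addrC addKr.
  rewrite enormZ gtr0_norm// -shE mulrC ler_pM2l// /enorm ler_sqrt; last exact: sum_sqr_ge0.
  rewrite (eq_bigr (fun=> 1)); last by move=> i _; rewrite mxE expr1n.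
  by rewrite big_const_ord iter_addr_0.
- rewrite size_map -cardE card_ffun !card_ord natrX -exprMn lerXn2r ?nnegrE ?ler0n//.
    by rewrite mulr_ge0 ?divr_ge0 ?(ltW rho0) ?(ltW dl0)// addr_ge0// mulr_ge0.
  (* Per axis, N is at most 4 sqrt(m) rho/dl + 1, hence at most (4m + 1) rho/dl since sqrt(m) <= m
     and rho/dl >= 1. *)
  have sm1 : Num.sqrt m%:R <= m%:R :> R.
    rewrite -[leRHS]ger0_norm ?ler0n// -sqrtr_sqr ler_sqrt ?sqr_ge0//.
    by rewrite -natrX ler_nat -[leqLHS]expn1 leq_pexp2l.
  have r1 : 1 <= rho / dl by rewrite ler_pdivlMr// mul1r.
  have : 4 * rho / h <= 4 * m%:R * (rho / dl).
    rewrite /h invf_div mulrA -!mulrA ler_pM2l// [leRHS]mulrCA.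
    by rewrite ler_pM2l// ler_pM2r ?invr_gt0.
  have /andP[+ _] : (Num.truncn (4 * rho / h))%:R <= 4 * rho / h < (Num.truncn (4 * rho / h))%:R + 1.
    by apply: truncn_bounds; rewrite divr_ge0 ?(ltW h0)// mulr_ge0// ltW.
  have -> : N%:R = (Num.truncn (4 * rho / h))%:R + 1 :> R by rewrite natr1.
  lra.
Qed.

Lemma finite_net m (X : set 'rV[R]_m) (L h : R) : (0 < m)%N -> 0 < h ->
  (forall x, X x -> enorm x <= L) ->
  exists s : seq 'rV[R]_m, (forall x, x \in s -> X x) /\
    forall x, X x -> exists2 y, y \in s & enorm (x - y) <= h.
Proof.
move=> m0 h0 XL.
have [U [Uc Ud _]] := @cube_cover m 0 (Num.max L h) h m0 h0 (ltac:(by rewrite le_max lexx orbT)).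
pose g (V : set 'rV[R]_m) : option 'rV[R]_m :=
  if pselect (exists x, X x /\ V x) is left e then Some (projT1 (cid e)) else None.
exists (pmap g U); split.
  move=> x; rewrite mem_pmap => /mapP[V VU]; rewrite /g.
  by case: pselect => // e [->]; case: cid => ? [].
move=> x Xx.
have [|V VU Vx] := Uc x.
  have := XL _ Xx; rewrite subr0 => xL; rewrite (le_trans xL)//.
  have : L <= Num.max L h by rewrite le_max lexx.
  have : 0 < Num.max L h by rewrite lt_max h0 orbT.
  lra.
have e : exists x, X x /\ V x by exists x.
exists (projT1 (cid e)).
  rewrite mem_pmap; apply/mapP; exists V => //; rewrite /g.
  by case: pselect => // e'; congr Some; congr (projT1 (cid _)); exact: Prop_irrelevance.
case: cid => y [Xy Vy] /=.
by have := ediam_ge Vx Vy; rewrite Ud// lee_fin.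
Qed.

Lemma bounded_enorm m (X : set 'rV[R]_m) : bounded_set X ->
  exists2 L, 1 <= L & forall x, closure X x -> enorm x <= L.
Proof.
move=> [M [Mreal bM]].
have XM x : X x -> `|x| <= `|M| + 1.
  by apply: bM; rewrite ltr_pwDr// real_ler_norm.
(* One unit exceeds [M] strictly, as boundedness requires; the other is the radius of the ball that
   reaches from a point of the closure into [X]. *)
pose L := Num.sqrt m%:R * (`|M| + 2).
exists (Num.max 1 L); first by rewrite le_max lexx.
move=> x /(_ _ (nbhsx_ballx x 1 ltr01))[y [/XM yM]].
rewrite -ball_normE /= => xy; rewrite le_max; apply/orP; right.
apply: enorm_le_coord; first by rewrite addr_ge0.
move=> i; apply: (@le_trans _ _ `|x|).
  rewrite [leRHS]/Num.Def.normr /= mx_normrE.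
  by apply: (le_bigmax _ (fun ij => `|x ij.1 ij.2|) (ord0, i)).
rewrite -(subrK y x); apply: (le_trans (ler_normD _ _)).
lra.
Qed.

End Euclid.

(** * Borel measurability and finitely supported measures *)

Section Measurability.
Variable R : realType.

Lemma continuous_borel_measurable (T : ptopologicalType) (f : T -> R) :
  continuous f -> measurable_fun setT (f : borelT T -> R).
Proof.
move=> cf; apply: (measurability _ (RGenOInfty.measurableE R)) => // _ [_ [x ->] <-].
rewrite setTI; apply: sub_sigma_algebra.
by have /continuousP := cf; apply; exact: itv_open_ends_open.
Qed.

Lemma measurable_coord m n i j :
  measurable_fun setT (fun x : borelT 'M[R]_(m, n) => x i j).
Proof. by apply: (@continuous_borel_measurable 'M[R]_(m, n)); exact: coord_continuous. Qed.

Lemma measurable_enorm (dd : measure_display) (T : measurableType dd) m (f : T -> 'rV[R]_m) :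
  (forall i, measurable_fun setT (fun x => f x ord0 i)) ->
  measurable_fun setT (fun x => enorm (f x)).
Proof.
move=> mf; apply: (measurableT_comp (f := @Num.sqrt R)).
  by apply: continuous_measurable_fun; exact: sqrt_continuous.
by apply: measurable_sum => i; apply: measurable_funX; exact: mf.
Qed.

Lemma measurable_fun_le_cst (dd : measure_display) (T : measurableType dd) (f : T -> R) (c : R) :
  measurable_fun setT f -> measurable [set x | f x <= c].
Proof.
move=> mf; rewrite -[X in measurable X]setTI.
have -> : [set x | f x <= c] = f @^-1` `]-oo, c].
  by apply/seteqP; split=> x /=; rewrite in_itv.
exact: mf.
Qed.

(** The integral of a nonnegative function is a supremum over the simple functions below it, so
    monotonicity holds for arbitrary [f] and [g]. Through [integral_step_ge] it serves for
    potentials that are never shown to be measurable. *)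
Lemma integral_mono (dd : measure_display) (T : measurableType dd) (mu : {measure set T -> \bar R})
  (f g : T -> \bar R) : (forall x, 0 <= f x)%E -> (forall x, f x <= g x)%E ->
  (\int[mu]_x f x <= \int[mu]_x g x)%E.
Proof.
move=> f0 fg; have g0 x : (0 <= g x)%E by apply: le_trans (fg x).
rewrite !ge0_integralE//; apply: ereal_sup_le => _ [h hf <-].
exists h => // x.
by apply: le_trans (hf x) _; rewrite !patch_setT.
Qed.

Lemma integral_step_ge (dd : measure_display) (T : measurableType dd) (mu : {measure set T -> \bar R})
  (f : T -> \bar R) N (A : nat -> set T) (a : nat -> R) :
  (forall i, measurable (A i)) -> trivIset setT A ->
  (forall i, 0 <= a i) -> (forall x, 0 <= f x)%E ->
  (forall i x, (i < N)%N -> A i x -> ((a i)%:E <= f x)%E) ->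
  (\sum_(i < N) (a i)%:E * mu (A i) <= \int[mu]_x f x)%E.
Proof.
move=> mA tA a0 f0 af.
have m1 i : measurable_fun setT (fun x => (\1_(A i) x)%:E : \bar R).
  by apply/measurable_EFinP; exact: measurable_indic.
apply: (@le_trans _ _ (\int[mu]_x \sum_(i < N) ((a i)%:E * (\1_(A i) x)%:E))%E).
  rewrite ge0_integral_sum//; last 2 first.
  - by move=> i; apply: emeasurable_funM => //; exact: measurable_cst.
  - by move=> i x _; rewrite -EFinM lee_fin mulr_ge0.
  apply: lee_sum => i _; rewrite ge0_integralZl ?lee_fin//.
  by rewrite integral_indic// setIT.
apply: integral_mono => x.
  by apply: sume_ge0 => i _; rewrite -EFinM lee_fin mulr_ge0.
have [[i iN Aix]|nA] := pselect (exists2 i, (i < N)%N & A i x).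
  rewrite (bigD1 (Ordinal iN))//= big1; last first.
    move=> j ji; rewrite indicE memNset ?mule0// => Ajx.
    move/eqP: ji; apply; apply/val_inj => /=.
    by apply: tA => //; exists x.
  by rewrite adde0 indicE mem_set// mule1 af.
rewrite big1// => i _; rewrite indicE memNset ?mule0// => Aix.
by apply: nA; exists i.
Qed.

End Measurability.

Section Discrete.
Context (dd : measure_display) (T : measurableType dd) (R : realType).
Variables (x : nat -> T) (w : nat -> {nonneg R}) (N : nat).

Definition discrete : set T -> \bar R :=
  msum (fun n => mscale (w n) (\d_(x n))) N.

HB.instance Definition _ := Measure.on discrete.

Hypothesis w1 : \sum_(i < N) (w i)%:num = 1.

Lemma discreteE (A : set T) : discrete A = (\sum_(i < N) (w i)%:num * (x i \in A)%:R)%:E.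
Proof.
rewrite /discrete /msum -sumEFin; apply: eq_bigr => i _.
by rewrite EFinM -diracE.
Qed.

Lemma discreteT : discrete setT = 1%E.
Proof.
rewrite discreteE; congr EFin; rewrite -[RHS]w1.
by apply: eq_bigr => i _; rewrite mem_set//= mulr1.
Qed.

Definition discrete_probability : probability T R :=
  HB.pack discrete (Measure_isProbability.Build _ _ _ discrete discreteT).

(** Only an inequality, because [f] is arbitrary: a simple function below [f] integrates to the
    weighted sum of its own values at the atoms. *)
Lemma integral_discrete_le (f : T -> \bar R) : (forall y, 0 <= f y)%E ->
  (\int[discrete_probability]_y f y <= \sum_(i < N) (w i)%:num%:E * f (x i))%E.
Proof.
move=> f0; rewrite ge0_integralE//; apply: ge_ereal_sup => _ [h hf <-].
rewrite -integralT_nnsfun.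
have h0 y : (0 <= (h y)%:E)%E by rewrite lee_fin.
have mh : measurable_fun setT (EFin \o h) by apply/measurable_EFinP.
rewrite [leLHS](@ge0_integral_measure_sum _ _ _ (fun n => mscale (w n) (\d_(x n))))//.
apply: lee_sum => i _; rewrite ge0_integral_mscale//.
rewrite integral_dirac// diracT mul1e.
apply: lee_wpmul2l; first by rewrite lee_fin.
by apply: le_trans (hf _) _; rewrite patch_setT.
Qed.

End Discrete.

(** * Discrete energies and capacity *)

Section DiscreteEnergy.
Variables (R : realType) (d : nat).
Implicit Types (X : set 'rV[R]_d) (k N : nat) (x : nat -> 'rV[R]_d) (w : nat -> R).

Definition config X N x w := [/\ forall i, (i < N)%N -> X (x i),
  forall i, 0 <= w i & \sum_(i < N) w i = 1].

Definition denergy k s r theta N x w : R :=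
  \sum_(i < N) \sum_(j < N) w i * w j * kern k s r theta (enorm (x i - x j)).

(** The quantity K_r of the overview. Diagonal terms are kept in the energy; the kernel equals 1
    there. *)
Definition dinf k s r theta X : R :=
  inf [set e | exists N x w, config X N x w /\ e = denergy k s r theta N x w].

Lemma weight_sum2 N w : \sum_(i < N) w i = 1 -> \sum_(i < N) \sum_(j < N) w i * w j = 1.
Proof.
move=> w1; rewrite -[RHS]w1; apply: eq_bigr => i _.
by rewrite -mulr_sumr w1 mulr1.
Qed.

Lemma config_exists X : X !=set0 -> exists N x w, config X N x w.
Proof.
move=> [a Xa]; exists 1%N, (fun=> a), (fun=> 1); split => //.
by rewrite big_ord1.
Qed.

Section Bounds.
Variables (X : set 'rV[R]_d) (k : nat) (s r theta L : R).
Hypotheses (X0 : X !=set0) (L1 : 1 <= L) (XL : forall y : 'rV[R]_d, closure X y -> enorm y <= L).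
Hypotheses (r01 : 0 < r < 1) (th : 0 < theta <= 1) (sk : 0 <= s <= k%:R).

Let kern0 (x : 'rV[R]_d) : 0 < kern k s r theta (enorm x).
Proof. by apply: kern_gt0 => //; exact: enorm_ge0. Qed.

Lemma enormB_le2L (x y : 'rV[R]_d) : X x -> X y -> enorm (x - y) <= 2 * L.
Proof.
move=> /subset_closure/XL xL /subset_closure/XL yL.
have := enormD x (- y); rewrite enormN; lra.
Qed.

Lemma denergy_ge0 N x w : config X N x w -> 0 <= denergy k s r theta N x w.
Proof.
move=> [_ w0 _]; apply: sumr_ge0 => i _; apply: sumr_ge0 => j _.
by rewrite mulr_ge0 ?mulr_ge0// ltW.
Qed.

Let has_lb : has_lbound [set e | exists N x w, config X N x w /\ e = denergy k s r theta N x w].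
Proof. by exists 0 => _ [N [x [w [c ->]]]]; exact: denergy_ge0. Qed.

Lemma dinf_le N x w : config X N x w -> dinf k s r theta X <= denergy k s r theta N x w.
Proof. by move=> c; apply: ge_inf => //; exists N, x, w. Qed.

Lemma dinf_approx e : 0 < e ->
  exists N x w, config X N x w /\ denergy k s r theta N x w < dinf k s r theta X + e.
Proof.
move=> e0; have [|_ [N [x [w [c ->]]]] lt] := inf_adherent e0 (E := [set e | exists N x w, config X N x w /\ e = denergy k s r theta N x w]).
  split=> //; have [N [x [w c]]] := config_exists X0.
  by exists (denergy k s r theta N x w), N, x, w.
by exists N, x, w.
Qed.

Lemma dinf_ge c : (forall N x w, config X N x w -> c <= denergy k s r theta N x w) ->
  c <= dinf k s r theta X.
Proof.
move=> h; apply: lb_le_inf.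
  have [N [x [w cf]]] := config_exists X0.
  by exists (denergy k s r theta N x w), N, x, w.
by move=> _ [N [x [w [cf ->]]]]; exact: h.
Qed.

Lemma dinf_le1 : dinf k s r theta X <= 1.
Proof.
have [N [x [w c]]] := config_exists X0; apply: (le_trans (dinf_le c)).
case: c => _ w0 w1; rewrite -(weight_sum2 w1).
apply: ler_sum => i _; apply: ler_sum => j _.
by rewrite ler_piMr ?mulr_ge0// kern_le1// enorm_ge0.
Qed.

Lemma dinf_lb : (r / (2 * L)) ^+ k <= dinf k s r theta X.
Proof.
apply: dinf_ge => N x w [Xx w0 w1]; rewrite -[leLHS]mulr1 -[X in _ * X <= _](weight_sum2 w1) mulr_sumr.
apply: ler_sum => i _; rewrite mulr_sumr; apply: ler_sum => j _.
rewrite mulrC ler_wpM2l ?mulr_ge0//; apply: kern_lb => //.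
  by rewrite enorm_ge0 enormB_le2L//; exact: Xx.
by apply: (le_trans L1); rewrite ler_peMl ?ler1n// (le_trans _ L1).
Qed.

Lemma dinf_gt0 : 0 < dinf k s r theta X.
Proof.
apply: lt_le_trans dinf_lb; rewrite exprn_gt0// divr_gt0//; first by case/andP: r01.
by rewrite mulr_gt0//; exact: lt_le_trans L1.
Qed.

Lemma energy_discrete_le N x w (c : config X N x w) :
  exists mu : probability (borelT 'rV[R]_d) R, mu (~` closure X) = 0%E /\
    (energy k s r theta mu <= (denergy k s r theta N x w)%:E)%E.
Proof.
case: c => Xx w0 w1.
pose W n : {nonneg R} := NngNum (w0 n).
pose mu := @discrete_probability _ (borelT 'rV[R]_d) R x W N w1.
exists mu; split.
  rewrite -[LHS]/(discrete (T := borelT 'rV[R]_d) x W N (~` closure X)) discreteE big1// => i _.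
  rewrite memNset ?mulr0//=; apply; apply: subset_closure; exact: Xx.
apply: le_trans (@integral_discrete_le _ (borelT 'rV[R]_d) R x W N w1
  (fun y => \int[mu]_z (kernel_phi k s r theta (y - z))%:E)%E _) _.
  move=> y; apply: integral_ge0 => z _; rewrite lee_fin ltW//; exact: kern0.
rewrite -sumEFin; apply: lee_sum => i _.
rewrite [leRHS](_ : _ = (w i)%:E * \sum_(j < N) ((w j)%:E * (kernel_phi k s r theta (x i - x j))%:E))%E.
  apply: lee_wpmul2l; first by rewrite lee_fin.
  apply: (@integral_discrete_le _ (borelT 'rV[R]_d) R x W N w1 (fun y => (kernel_phi k s r theta (x i - y))%:E)).
  by move=> y; rewrite lee_fin ltW//; exact: kern0.
rewrite -sumEFin ge0_sume_distrr; last first.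
  by move=> j _; rewrite -EFinM lee_fin mulr_ge0// ltW//; exact: kern0.
by apply: eq_bigr => j _; rewrite -!EFinM mulrA.
Qed.

(** Origin of 5^k: if m >= 5r, then n >= m - 4r >= m/5; otherwise the kernel at m/5 is already 1. In
    both cases the dilation by 5 concludes. *)
Lemma kern_shift (n m : R) : 0 <= n -> 0 <= m -> m <= n + 4 * r ->
  kern k s r theta n <= 5 ^+ k * kern k s r theta m.
Proof.
move=> n0 m0 mn; have m5 : 0 <= m / 5 by rewrite divr_ge0.
have e5 : 5 * (m / 5) = m by rewrite mulrC divfK.
have := @kern_dilate R k s r theta r01 th sk 5 (m / 5) (ler1n _ 5) m5.
rewrite e5; apply: le_trans.
case: (ltP (m / 5) r) => h; first by rewrite [leRHS]kern_lt// kern_le1.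
by apply: kern_ninc => //; lra.
Qed.

Lemma closure_enorm_near (x : 'rV[R]_d) e : closure X x -> 0 < e -> exists2 y, X y & enorm (x - y) <= e.
Proof.
(* Balls are taken in the sup norm, so the radius is divided by sqrt(d); adding 1 keeps the divisor
   positive. *)
move=> clx e0; have q0 : 0 < e / (Num.sqrt d%:R + 1) by rewrite divr_gt0// ltr_pwDr// sqrtr_ge0.
have [y [Xy]] := clx _ (nbhsx_ballx x _ q0).
rewrite -ball_normE/= => xy; exists y => //.
apply: le_trans (enorm_le_coord (h := e / (Num.sqrt d%:R + 1)) _ _) _.
- exact: ltW.
- move=> i; apply: le_trans (ltW xy).
  rewrite [leRHS]/Num.Def.normr /= mx_normrE.
  exact: (le_bigmax _ (fun ij => `|(x - y) ij.1 ij.2|) (ord0, i)).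
- rewrite mulrC -mulrA ler_piMr ?(ltW e0)//.
  by rewrite mulrC ler_pdivrMr ?mul1r ?lerDl// ltr_pwDr// sqrtr_ge0.
Qed.

(** Discretisation of [mu]: the mass of each cell is moved to the net point of that cell. Points
    move by at most 2r, so a distance changes by at most 4r and the kernel by a factor 5^k. *)
Lemma dinf_le_energy (mu : probability (borelT 'rV[R]_d) R) : (0 < d)%N ->
  mu (~` closure X) = 0%E -> ((dinf k s r theta X)%:E <= (5 ^+ k)%:E * energy k s r theta mu)%E.
Proof.
move=> d0 muX; have [r0 r1] := andP r01.
have [net [netX netc]] := @finite_net R d X L r d0 r0 (fun (y : 'rV[R]_d) Xy => XL (subset_closure Xy)).
pose N := size net; pose x n := nth 0 net n.
(* Radius 2r: a point of the closure is within r of [X], and a point of [X] within r of the net.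
   Indices from [N] on get the empty set, so that [seqDU] yields a disjoint sequence on all of
   [nat]. *)
pose B n : set (borelT 'rV[R]_d) := if (n < N)%N then [set y | enorm (y - x n) <= 2 * r] else set0.
have mB n : measurable (B n).
  rewrite /B; case: ifP => // _; apply: measurable_fun_le_cst.
  apply: measurable_enorm => i.
  rewrite (_ : (fun y => _) = (fun y : borelT 'rV[R]_d => y ord0 i - x n ord0 i)); last first.
    by apply/funext => y; rewrite !mxE.
  by apply: measurable_funB; [exact: measurable_coord|exact: measurable_cst].
pose A := seqDU B.
have mA n : measurable (A n).
  by apply: measurableD => //; apply: bigsetU_measurable.
have AB n y : A n y -> (n < N)%N -> enorm (y - x n) <= 2 * r.
  by move=> [+ _] nN; rewrite /B nN.
have tA : trivIset setT A by exact: trivIset_seqDU.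
have mclX : measurable (closure X : set (borelT 'rV[R]_d)).
  rewrite -[closure X]setCK; apply: measurableC; apply: sub_sigma_algebra.
  by apply: closed_openC; exact: closed_closure.
have cov : closure X `<=` \big[setU/set0]_(n < N) A n.
  move=> y /closure_enorm_near/(_ r0)[z /netc[u /(nthP 0)[n nN un] zu] yz].
  rewrite -bigsetU_seqDU -bigcup_mkord; exists n => //=.
  rewrite /B nN/= /x un; have := enormB_trans z y u; lra.
have mfin n : mu (A n) \is a fin_num by exact: fin_num_measure.
pose w n := fine (mu (A n)).
have wE n : (w n)%:E = mu (A n) by rewrite fineK.
have w0 n : 0 <= w n by rewrite fine_ge0.
(* The cells cover [closure X], which carries the whole mass of [mu]. *)
have w1 : \sum_(n < N) w n = 1.
  apply: EFin_inj; rewrite -sumEFin; under eq_bigr do rewrite wE.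
  rewrite -(@measure_bigsetU _ _ _ mu A)//; apply/eqP; rewrite eq_le probability_le1 ?bigsetU_measurable//=.
  rewrite -(@probability_setT _ _ _ mu) -(setUv (closure X)) measureU//; last 2 first.
  - exact: measurableC.
  - by rewrite setICr.
  rewrite [leLHS](_ : _ = mu (closure X)); last first.
    by rewrite -[RHS]adde0; congr (_ + _)%E; exact: muX.
  apply: le_measure => //; rewrite inE//.
    exact: bigsetU_measurable.
  exact: bigsetU_measurable.
have cf : config X N x w.
  by split => // i iN; apply: netX; exact: mem_nth.
have k0 (u : 'rV[R]_d) : (0 <= (kernel_phi k s r theta u)%:E)%E by rewrite lee_fin ltW//; exact: kern0.
have c50 : 0 < 5 ^+ k :> R by rewrite exprn_gt0.
apply: (@le_trans _ _ (denergy k s r theta N x w)%:E); first by rewrite lee_fin dinf_le.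
rewrite -lee_pdivrMl// -EFinM.
pose u n := \sum_(j < N) (5 ^- k * kern k s r theta (enorm (x n - x j))) * w j.
have u0 n : 0 <= u n.
  by apply: sumr_ge0 => j _; rewrite !mulr_ge0// ?invr_ge0 ?ltW//; exact: kern0.
have inner n y : (n < N)%N -> A n y -> ((u n)%:E <= \int[mu]_z (kernel_phi k s r theta (y - z))%:E)%E.
  move=> nN Any.
  apply: (le_trans _ (@integral_step_ge R _ (borelT 'rV[R]_d) mu (fun z => (kernel_phi k s r theta (y - z))%:E) N A
    (fun j => 5 ^- k * kern k s r theta (enorm (x n - x j))) mA tA _ _ _)) => //.
  - by rewrite /u -sumEFin; apply: lee_sum => j _; rewrite EFinM wE.
  - by move=> j; rewrite mulr_ge0 ?invr_ge0 ?ltW//; exact: kern0.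
  move=> j z jN Ajz; rewrite lee_fin ler_pdivrMl//.
  apply: kern_shift; rewrite ?enorm_ge0//.
  have := AB _ _ Any nN; have := AB _ _ Ajz jN.
  have := enormB_trans (x n) y z; have := enormB_trans (x j) (x n) z.
  by rewrite (enormBC z); lra.
have := @integral_step_ge R _ (borelT 'rV[R]_d) mu
  (fun y => \int[mu]_z (kernel_phi k s r theta (y - z))%:E)%E N A u mA tA u0.
move=> /(_ (fun y => integral_ge0 mu (fun z _ => k0 (y - z))) inner).
apply: le_trans; rewrite /denergy mulr_sumr -sumEFin; apply: lee_sum => i _.
apply: (@le_trans _ _ ((u i)%:E * (w i)%:E)%E); last by rewrite wE.
rewrite -EFinM lee_fin /u mulr_suml mulr_sumr; apply: ler_sum => j _.
by rewrite le_eqVlt; apply/orP; left; apply/eqP; ring.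
Qed.

Lemma capacity_bounds : (0 < d)%N ->
  (dinf k s r theta X)^-1 <= capacity k s r theta X <= 5 ^+ k / dinf k s r theta X.
Proof.
move=> d0; rewrite /capacity.
set I := ereal_inf _.
have K0 := dinf_gt0; have c50 : 0 < 5 ^+ k :> R by rewrite exprn_gt0.
have IK : (I <= (dinf k s r theta X)%:E)%E.
  apply/lee_addgt0Pr => e e0; have [N [x [w [c lt]]]] := dinf_approx e0.
  have [mu [muX le]] := energy_discrete_le c.
  rewrite -EFinD; apply: le_trans (le_trans le _); last by rewrite lee_fin ltW.
  by apply: ereal_inf_lbound; exists mu.
have KI : ((5 ^- k * dinf k s r theta X)%:E <= I)%E.
  apply: le_ereal_inf_tmp => _ [mu [muX ->]].
  rewrite EFinM lee_pdivrMl//; exact: dinf_le_energy.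
(* The capacity is defined through [fine], so the infimum must first be seen to be finite; the two
   bounds on it show this. *)
have [i Ii] : exists i, I = i%:E.
  by case: I IK KI => // i _ _; exists i.
move: IK KI; rewrite Ii/= !lee_fin => IK KI.
have i0 : 0 < i by apply: lt_le_trans KI; rewrite mulr_gt0// invr_gt0.
apply/andP; split; first by rewrite lef_pV2 ?posrE.
by rewrite -[leRHS]invrK invf_div lef_pV2 ?posrE ?divr_gt0// mulrC.
Qed.

End Bounds.

Lemma dinf_comparison X k s r theta (t q a : R) : X !=set0 -> 0 < r < 1 -> 0 < a ->
  (forall n, 0 <= n -> kern k s r theta n <= a * kern k t r q n) ->
  dinf k s r theta X <= a * dinf k t r q X.
Proof.
move=> X0 r01 a0 le; rewrite -ler_pdivrMl//.
apply: dinf_ge => // N x w cf; rewrite ler_pdivrMl//.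
apply: (le_trans (dinf_le k s theta r01 cf)); case: cf => _ w0 _.
rewrite /denergy mulr_sumr; apply: ler_sum => i _.
rewrite mulr_sumr; apply: ler_sum => j _.
by rewrite mulrCA ler_wpM2l ?mulr_ge0// le// enorm_ge0.
Qed.

End DiscreteEnergy.

(** * Limits at 0 and existence of the profiles *)

Section Limits.
Variable R : realType.
Implicit Types (f g u v : R -> R) (a c e : R).

Lemma in_itv0 (dl r : R) : 0 < r -> r < dl -> r \in `]0, dl[.
Proof. by move=> r0 rd; rewrite in_itv/= r0. Qed.

Lemma in_itv0P (dl r : R) : [set` `]0, dl[] r -> 0 < r /\ r < dl.
Proof. by rewrite /= in_itv/= => /andP. Qed.

Lemma in_itv0y (dl : R) : 0 < dl -> dl \in `]0, +oo[.
Proof. by move=> d0; rewrite in_itv/= d0. Qed.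

Lemma liminf0_le f g c :
  (forall e, 0 < e -> exists2 dl, 0 < dl & forall r, 0 < r -> r < dl -> f r <= g r + c + e) ->
  (liminf0 f <= liminf0 g + c%:E)%E.
Proof.
move=> H; apply: ge_ereal_sup => _ [dl dl0 <-]; move: dl0 => /=; rewrite in_itv/= andbT => dl0.
apply/lee_addgt0Pr => e e0; have [dl' dl'0 fg] := H _ e0.
pose m := Num.min dl dl'; have m0 : 0 < m by rewrite lt_min dl0.
rewrite -addeA -EFinD -leeBlDr//.
apply: (@le_trans _ _ (ereal_inf [set (g r)%:E | r in `]0, m[])).
  apply: le_ereal_inf_tmp => _ [r /in_itv0P[r0 rm] <-].
  rewrite leeBlDr// -EFinD; move: rm; rewrite lt_min => /andP[r1 r2].
  apply: (@le_trans _ _ (f r)%:E); last by rewrite lee_fin addrA fg.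
  by apply: ereal_inf_lbound; exists r => //; exact: in_itv0.
by apply: ereal_sup_ubound; exists m => //; exact: in_itv0y.
Qed.

Lemma limsup0_le f g c :
  (forall e, 0 < e -> exists2 dl, 0 < dl & forall r, 0 < r -> r < dl -> f r <= g r + c + e) ->
  (limsup0 f <= limsup0 g + c%:E)%E.
Proof.
move=> H; rewrite -leeBlDr//; apply: le_ereal_inf_tmp => _ [dl dl0 <-]; move: dl0 => /=; rewrite in_itv/= andbT => dl0.
rewrite EFinN leeBlDr//; apply/lee_addgt0Pr => e e0; have [dl' dl'0 fg] := H _ e0.
pose m := Num.min dl dl'; have m0 : 0 < m by rewrite lt_min dl0.
rewrite -addeA -EFinD.
apply: (@le_trans _ _ (ereal_sup [set (f r)%:E | r in `]0, m[])).
  by apply: ereal_inf_lbound; exists m => //; exact: in_itv0y.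
apply: ge_ereal_sup => _ [r /in_itv0P[r0 rm] <-].
move: rm; rewrite lt_min => /andP[r1 r2].
apply: (@le_trans _ _ ((g r)%:E + (c + e)%:E)%E); first by rewrite -EFinD lee_fin addrA fg.
rewrite leeD2r//.
by apply: ereal_sup_ubound; exists r => //; exact: in_itv0.
Qed.

Lemma liminf0_cst0 : liminf0 (fun=> 0 : R) = 0%E.
Proof.
apply/eqP; rewrite eq_le; apply/andP; split.
  apply: ge_ereal_sup => _ [dl dl0 <-]; move: dl0 => /=; rewrite in_itv/= andbT => dl0.
  apply: ereal_inf_lbound; exists (dl / 2) => //; apply: in_itv0; lra.
apply: (@le_trans _ _ (ereal_inf [set 0%:E | r in `](0 : R), 1[])).
  by apply: le_ereal_inf_tmp => _ [r _ <-].
by apply: ereal_sup_ubound; exists 1 => //; exact: in_itv0y.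
Qed.

Lemma limsup0_cst0 : limsup0 (fun=> 0 : R) = 0%E.
Proof.
apply/eqP; rewrite eq_le; apply/andP; split; last first.
  apply: le_ereal_inf_tmp => _ [dl dl0 <-]; move: dl0 => /=; rewrite in_itv/= andbT => dl0.
  apply: ereal_sup_ubound; exists (dl / 2) => //; apply: in_itv0; lra.
apply: (@le_trans _ _ (ereal_sup [set 0%:E | r in `](0 : R), 1[])).
  by apply: ereal_inf_lbound; exists 1 => //; exact: in_itv0y.
by apply: ge_ereal_sup => _ [r _ <-].
Qed.

Lemma liminf0_eventually_gt f (s e : R) : liminf0 f = s%:E -> 0 < e ->
  exists2 dl, 0 < dl & forall r, 0 < r -> r < dl -> s - e < f r.
Proof.
move=> fs e0; have : ((s - e)%:E < liminf0 f)%E by rewrite fs lte_fin ltrBlDr ltrDl.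
move=> /ereal_sup_gt[_ [dl /= dl0 <-]] lt; exists dl; first by move: dl0; rewrite in_itv/= andbT.
move=> r r0 rd; rewrite -lte_fin; apply: (lt_le_trans lt).
by apply: ereal_inf_lbound; exists r => //; exact: in_itv0.
Qed.

Lemma liminf0_frequently_lt f (s e dl : R) : liminf0 f = s%:E -> 0 < e -> 0 < dl ->
  exists r, [/\ 0 < r, r < dl & f r < s + e].
Proof.
move=> fs e0 dl0.
have : (ereal_inf [set (f r)%:E | r in `]0%R, dl[] < (s + e)%:E)%E.
  apply: (@le_lt_trans _ _ s%:E); last by rewrite lte_fin ltrDl.
  by rewrite -fs; apply: ereal_sup_ubound; exists dl => //; exact: in_itv0y.
move=> /ereal_inf_lt[_ [r /in_itv0P[r0 rd] <-]]; rewrite lte_fin => lt.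
by exists r.
Qed.

Lemma limsup0_eventually_lt f (s e : R) : limsup0 f = s%:E -> 0 < e ->
  exists2 dl, 0 < dl & forall r, 0 < r -> r < dl -> f r < s + e.
Proof.
move=> fs e0; have : (limsup0 f < (s + e)%:E)%E by rewrite fs lte_fin ltrDl.
move=> /ereal_inf_lt[_ [dl /= dl0 <-]] lt; exists dl; first by move: dl0; rewrite in_itv/= andbT.
move=> r r0 rd; rewrite -lte_fin; apply: le_lt_trans lt.
by apply: ereal_sup_ubound; exists r => //; exact: in_itv0.
Qed.

Lemma limsup0_frequently_gt f (s e dl : R) : limsup0 f = s%:E -> 0 < e -> 0 < dl ->
  exists r, [/\ 0 < r, r < dl & s - e < f r].
Proof.
move=> fs e0 dl0.
have : ((s - e)%:E < ereal_sup [set (f r)%:E | r in `]0%R, dl[])%E.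
  apply: (@lt_le_trans _ _ s%:E); first by rewrite lte_fin ltrBlDr ltrDl.
  by rewrite -fs; apply: ereal_inf_lbound; exists dl => //; exact: in_itv0y.
move=> /ereal_sup_gt[_ [r /in_itv0P[r0 rd] <-]]; rewrite lte_fin => lt.
by exists r.
Qed.

(** The constant [B] contributes |ln B| / -ln r, which is below [e] as soon as -ln r exceeds |ln B|
    / e; this is the choice of [dl]. *)
Lemma log_ratio_le u v (B a : R) : 0 < B ->
  (forall r, 0 < r < 1 -> [/\ 0 < u r, 0 < v r & u r <= B * r `^ (- a) * v r]) ->
  forall e, 0 < e -> exists2 dl, 0 < dl &
    forall r, 0 < r -> r < dl -> ln (u r) / - ln r <= ln (v r) / - ln r + a + e.
Proof.
move=> B0 H e e0; pose dl := expR (- (`|ln B| / e + 1)).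
exists dl; first exact: expR_gt0.
move=> r r0 rd.
have lr : ln r < - (`|ln B| / e + 1).
  have : ln r < ln dl by rewrite ltr_ln ?posrE ?expR_gt0.
  by rewrite expRK.
have be0 : 0 <= `|ln B| / e by rewrite divr_ge0// ltW.
have lr0 : 0 < - ln r by lra.
have r1 : r < 1 by rewrite -(@ltr_ln R) ?posrE// ln1; lra.
have [|u0 v0 uv] := H r; first by rewrite r0 r1.
have ra0 : 0 < r `^ (- a) by rewrite powR_gt0.
have : ln (u r) <= ln B + - a * ln r + ln (v r).
  by rewrite -ln_powR -!lnM ?posrE ?mulr_gt0// ler_ln ?posrE ?mulr_gt0.
have eB : `|ln B| < e * - ln r.
  by rewrite mulrC -ltr_pdivrMr//; lra.
have := ler_norm (ln B).
rewrite ler_pdivrMr// !mulrDl divfK ?gt_eqF//; lra.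
Qed.

End Limits.

(** * Capacity exponents and profiles, for the lower and upper limits at once through an abstract
    [L] *)

Section Profile.
Variables (R : realType) (d k : nat) (X : set 'rV[R]_d) (Lb : R).
Hypotheses (d0 : (0 < d)%N) (X0 : X !=set0) (L1 : 1 <= Lb)
  (XL : forall y : 'rV[R]_d, closure X y -> enorm y <= Lb).
Variable L : (R -> R) -> \bar R.
Hypothesis Lle : forall f g (c : R),
  (forall e, 0 < e -> exists2 dl, 0 < dl & forall r, 0 < r -> r < dl -> f r <= g r + c + e) ->
  (L f <= L g + c%:E)%E.
Hypothesis L0 : L (fun=> 0) = 0%E.

Definition log_capacity (s theta r : R) := ln (capacity k s r theta X) / - ln r.

Definition is_profile (theta s : R) :=
  0 <= s <= k%:R /\ L (log_capacity s theta) = s%:E.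

Lemma capacity_gt0 s r theta : 0 < r < 1 -> 0 < theta <= 1 -> 0 <= s <= k%:R ->
  0 < capacity k s r theta X.
Proof.
move=> r01 th sk; have /andP[+ _] := capacity_bounds X0 L1 XL r01 th sk d0.
by apply: lt_le_trans; rewrite invr_gt0 (dinf_gt0 X0 L1 XL).
Qed.

Lemma log_capacity_compare s theta t q a : 0 < theta <= 1 -> 0 <= s <= k%:R ->
  0 < q <= 1 -> 0 <= t <= k%:R ->
  (forall r n, 0 < r < 1 -> 0 <= n -> kern k t r q n <= r `^ (- a) * kern k s r theta n) ->
  (L (log_capacity s theta) <= L (log_capacity t q) + a%:E)%E.
Proof.
move=> th sk hq tk le; apply: Lle.
apply: (@log_ratio_le R (fun r => capacity k s r theta X) (fun r => capacity k t r q X) (5 ^+ k)).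
  by rewrite exprn_gt0.
move=> r r01; have [r0 r1] := andP r01.
split; [exact: capacity_gt0|exact: capacity_gt0|].
have /andP[_ ub] := capacity_bounds X0 L1 XL r01 th sk d0.
have /andP[lb _] := capacity_bounds X0 L1 XL r01 hq tk d0.
have K1 := dinf_gt0 X0 L1 XL r01 th sk; have K2 := dinf_gt0 X0 L1 XL r01 hq tk.
have ra : 0 < r `^ (- a) by rewrite powR_gt0.
apply: (le_trans ub); rewrite -mulrA ler_pM2l ?exprn_gt0//.
apply: (@le_trans _ _ (r `^ (- a) / dinf k t r q X)); last by rewrite ler_pM2l.
rewrite ler_pdivlMr// mulrC ler_pdivrMr//.
by apply: dinf_comparison => // n n0; exact: le.
Qed.

Lemma log_capacity_ndec s t theta : 0 < theta <= 1 -> 0 <= s -> s <= t -> t <= k%:R ->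
  (L (log_capacity s theta) <= L (log_capacity t theta))%E.
Proof.
move=> th s0 st tk; rewrite -[leRHS]adde0; apply: log_capacity_compare => //; try lra.
by move=> r n r01 n0; rewrite oppr0 powRr0 mul1r; have [] := @kern_s_mono R k s t r theta n r01 th st n0.
Qed.

Lemma log_capacity_contract s t theta : 0 < theta <= 1 -> 0 <= s -> s <= t -> t <= k%:R ->
  (L (log_capacity t theta) <= L (log_capacity s theta) + ((1 - theta) * (t - s))%:E)%E.
Proof.
move=> th s0 st tk; apply: log_capacity_compare => //; try lra.
by move=> r n r01 n0; rewrite -mulNr; have [] := @kern_s_mono R k s t r theta n r01 th st n0.
Qed.

Lemma log_capacity_theta s q theta : 0 < q -> q <= theta -> theta <= 1 -> 0 <= s <= k%:R ->
  (L (log_capacity s theta) <= L (log_capacity s q) + ((theta - q) * k%:R)%:E)%E.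
Proof.
move=> q0 qt t1 sk; apply: log_capacity_compare => //; try lra.
by move=> r n r01 n0; rewrite -mulNr; apply: kern_theta.
Qed.

Lemma log_capacity_ge0 s theta : 0 < theta <= 1 -> 0 <= s <= k%:R ->
  (0 <= L (log_capacity s theta))%E.
Proof.
move=> th sk; rewrite -L0 -[leRHS]adde0; apply: Lle => e e0; exists 1 => // r r0 r1.
have r01 : 0 < r < 1 by rewrite r0.
rewrite addr0 addr_ge0 ?(ltW e0)// /log_capacity divr_ge0 ?oppr_ge0 ?(ltW (ln_lt0 _))//.
apply: ln_ge0; have /andP[lb _] := capacity_bounds X0 L1 XL r01 th sk d0.
apply: le_trans lb; rewrite -invr1 lef_pV2 ?posrE//; first exact: dinf_le1.
exact: (dinf_gt0 X0 L1 XL).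
Qed.

Lemma log_capacity_lek s theta : 0 < theta <= 1 -> 0 <= s <= k%:R ->
  (L (log_capacity s theta) <= k%:R%:E)%E.
Proof.
move=> th sk; rewrite -[leRHS]add0e -L0; apply: Lle => e e0.
have Lb0 : 0 < Lb by apply: lt_le_trans L1.
have [|r r01|dl dl0 H] := @log_ratio_le R (fun r => capacity k s r theta X) (fun=> 1) (5 ^+ k * (2 * Lb) ^+ k) k%:R _ _ e e0.
- by rewrite mulr_gt0 ?exprn_gt0// mulr_gt0.
- have [r0 r1] := andP r01.
  split=> //; first exact: capacity_gt0.
  have /andP[_ ub] := capacity_bounds X0 L1 XL r01 th sk d0.
  apply: (le_trans ub); rewrite mulr1 -mulrA ler_pM2l ?exprn_gt0//.
  rewrite powRN powR_mulrn ?(ltW r0)// -expr_div_n -[leRHS]invrK lef_pV2 ?posrE ?(dinf_gt0 X0 L1 XL)//.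
    by rewrite -exprVn invf_div (dinf_lb X0 L1 XL).
  by rewrite invr_gt0 exprn_gt0// divr_gt0// mulr_gt0.
by exists dl => // r r0 rd; have := H r r0 rd; rewrite ln1 mul0r.
Qed.

(** Fixed point in the manner of Tarski: s -> [F] s is a nondecreasing map of [0, k] into itself,
    hence fixes the supremum of the s with s <= [F] s. *)
Lemma profile_exists theta : 0 < theta <= 1 -> exists s, is_profile theta s.
Proof.
move=> th.
have [F [FE F0 Fm]] : exists F : R -> R,
  [/\ forall s, 0 <= s <= k%:R -> L (log_capacity s theta) = (F s)%:E,
      forall s, 0 <= s <= k%:R -> 0 <= F s <= k%:R &
      forall s t, 0 <= s -> s <= t -> t <= k%:R -> F s <= F t].
  have [G [GE Gm Gk G0]] : exists G : R -> \bar R, [/\ forall s, L (log_capacity s theta) = G s,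
     forall s t, 0 <= s -> s <= t -> t <= k%:R -> (G s <= G t)%E,
     forall s, 0 <= s <= k%:R -> (G s <= k%:R%:E)%E &
     forall s, 0 <= s <= k%:R -> (0 <= G s)%E].
    exists (fun s => L (log_capacity s theta)); split.
    - by move=> s.
    - move=> s t; exact: log_capacity_ndec.
    - move=> s; exact: log_capacity_lek.
    - move=> s; exact: log_capacity_ge0.
  have FE s : 0 <= s <= k%:R -> G s = (fine (G s))%:E.
    by move=> sk; rewrite fineK// fin_numE; move: (G0 s sk) (Gk s sk); case: (G s).
  exists (fun s => fine (G s)); split => //.
    by move=> s sk; rewrite GE; exact: FE.
    by move=> s sk; move: (G0 s sk) (Gk s sk); rewrite (FE s sk) !lee_fin => -> ->.
  move=> s t s0 st tk; have hs : 0 <= s <= k%:R by lra.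
  have ht : 0 <= t <= k%:R by lra.
  by rewrite -lee_fin -(FE s hs) -(FE t ht) Gm.
pose S := [set s | 0 <= s <= k%:R /\ s <= F s].
have k0 : 0 <= k%:R :> R by [].
have S0 : S 0 by split; [rewrite lexx|have := F0 0; rewrite lexx k0 => /(_ isT)/andP[]].
have hS : has_sup S by split; [exists 0|exists k%:R => s [/andP[]]].
have Sub := sup_upper_bound hS.
have s0 : 0 <= sup S by exact: Sub.
have sk : sup S <= k%:R by apply: ge_sup; [exists 0|move=> s [/andP[]]].
have ssk : 0 <= sup S <= k%:R by rewrite s0.
exists (sup S); split=> //; rewrite FE//; congr EFin; apply/eqP; rewrite eq_le.
have sF : sup S <= F (sup S).
  apply: ge_sup; first by exists 0.
  move=> s Ss; case: (Ss) => /andP[s00 _] sFs; apply: (le_trans sFs).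
  by apply: Fm => //; exact: Sub.
rewrite sF andbT; apply: Sub; split; first exact: F0.
by apply: Fm => //; have /andP[] := F0 _ ssk.
Qed.

(** If s > t, write F_theta for the exponent as a function of s. Then s = F_theta(s) <= F_q(s) +
    (theta - q) k <= t + (1 - q)(s - t) + (theta - q) k, and the contraction leaves q (s - t) <=
    (theta - q) k. *)
Lemma profile_theta_le theta q s t : 0 < q -> q <= theta -> theta <= 1 ->
  is_profile theta s -> is_profile q t -> s <= t + (theta - q) * k%:R / q.
Proof.
move=> q0 qt t1 [sk Ls] [tk Lt].
have b0 : 0 <= (theta - q) * k%:R / q by rewrite divr_ge0 ?(ltW q0)// mulr_ge0 ?subr_ge0.
case: (leP s t) => st; first by lra.
have q01 : 0 < q <= 1 by lra.
have h1 := log_capacity_theta q0 qt t1 sk.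
have h2 := log_capacity_contract q01 (ltac:(lra) : 0 <= t) (ltW st) (ltac:(lra) : s <= k%:R).
have aux (a b c : \bar R) (u v : R) : a = s%:E -> b = t%:E -> (a <= c + u%:E)%E ->
    (c <= b + v%:E)%E -> s <= t + v + u.
  move=> -> -> su tv; rewrite -lee_fin; apply: (le_trans su).
  by rewrite [leRHS]EFinD leeD2r// EFinD.
have h3 := aux _ _ _ _ _ Ls Lt h1 h2.
suff : (s - t) <= (theta - q) * k%:R / q by lra.
by rewrite ler_pdivlMr//; lra.
Qed.

End Profile.

(** * Covers of projections *)

Lemma sumr_const_seq (V : nmodType) (I : Type) (s : seq I) (x : V) :
  \sum_(i <- s) x = x *+ size s.
Proof. by rewrite big_const_seq count_predT iter_addr_0. Qed.

Section Scales.
Variable R : realType.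

Lemma powR_small (B a e : R) : 0 < B -> 0 < a -> 0 < e ->
  exists2 dl, 0 < dl <= 1 & forall r, 0 < r -> r < dl -> B * r `^ a <= e.
Proof.
move=> B0 a0 e0; have eB : 0 < e / B by rewrite divr_gt0.
exists (Num.min 1 ((e / B) `^ a^-1)); first by rewrite ge_min lexx lt_min ltr01 powR_gt0.
move=> r r0; rewrite lt_min => /andP[_ /ltW rd].
rewrite mulrC -ler_pdivlMr//.
have : r `^ a <= ((e / B) `^ a^-1) `^ a.
  by rewrite ge0_ler_powR ?nnegrE ?powR_ge0// ltW.
by rewrite -powRrM mulVf ?gt_eqF// powRr1// ltW.
Qed.

(** About log(D/r) doublings lead from r to D, and -ln r <= r^(-a) / a turns this logarithm into an
    arbitrarily small negative power of r. *)
Lemma dyadic_count (D a : R) : 1 <= D -> 0 < a ->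
  exists2 c, 0 < c & forall r, 0 < r < 1 ->
    exists2 J : nat, D <= 2 ^+ J * r & J.+1%:R <= c * r `^ (- a).
Proof.
move=> D1 a0; have D0 : 0 < D by apply: lt_le_trans D1.
have l2 : 0 < ln 2 :> R by rewrite ln_gt0// ltr1n.
have lD : 0 <= ln D by rewrite ln_ge0.
pose c := (ln D + a^-1) / ln 2 + 2.
have q0 : 0 <= (ln D + a^-1) / ln 2.
  by rewrite divr_ge0 ?(ltW l2)// addr_ge0// invr_ge0 ltW.
exists c; first by rewrite /c; lra.
move=> r /andP[r0 r1].
have lr : ln r < 0 by rewrite ln_lt0// r0.
have ra1 : 1 <= r `^ (- a).
  by rewrite -(expR_lnM _ r0) -[leLHS]expR0 ler_expR; nra.
have lDr : 0 <= (ln D - ln r) / ln 2 by rewrite divr_ge0 ?(ltW l2)//; lra.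
exists (Num.truncn ((ln D - ln r) / ln 2)).+1.
  have /andP[_] := truncn_bounds lDr; rewrite ltr_pdivrMr// natr1 => /ltW h.
  rewrite -ler_ln ?posrE ?mulr_gt0 ?exprn_gt0// lnM ?posrE ?exprn_gt0// -powR_mulrn// ln_powR.
  lra.
have /andP[h _] := truncn_bounds lDr.
have h2 : - ln r <= a^-1 * r `^ (- a).
  rewrite ler_pdivlMl// mulrN -mulNr -ln_powR.
  have : 0 < r `^ (- a) by rewrite powR_gt0.
  by move=> p0; exact: ltW (ln_sublinear p0).
rewrite -[_.+2%:R]natr1 -[_.+1%:R]natr1 -addrA.
apply: (@le_trans _ _ ((ln D - ln r) / ln 2 + 2)); first by lra.
rewrite /c [leRHS]mulrDl; apply: lerD; last by lra.
rewrite mulrAC ler_pM2r ?invr_gt0// mulrDl; apply: lerD => //.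
by rewrite ler_peMr.
Qed.

(** For the first scale reaching n, half of it falls short of n unless the scale is r itself. *)
Lemma dyadic_scale (r n : R) J : 0 < r -> n <= 2 ^+ J * r ->
  exists2 j, (j <= J)%N & n <= 2 ^+ j * r /\ 2 ^+ j * r <= Num.max r (2 * n).
Proof.
move=> r0; elim: J => [|J IH] nJ.
  by exists 0%N => //; rewrite expr0 mul1r le_max lexx; split=> //; move: nJ; rewrite expr0 mul1r.
case: (leP n (2 ^+ J * r)) => h.
  by have [j jJ H] := IH h; exists j => //; exact: leqW.
by exists J.+1 => //; split=> //; rewrite le_max exprS -mulrA ler_pM2l// (ltW h) orbT.
Qed.

End Scales.

Section Separated.
Variables (R : realType) (m : nat).
Implicit Types (N : nat) (y : nat -> 'rV[R]_m) (w : nat -> R) (S : seq 'rV[R]_m).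

Definition ball_mass N (y : nat -> 'rV[R]_m) (w : nat -> R) (rho : R) (z : 'rV[R]_m) : R :=
  \sum_(i < N) w i * (enorm (z - y i) <= rho)%R%:R.

Definition separated (rho : R) := pairwise (fun u v : 'rV[R]_m => 2 * rho < enorm (u - v)).

Lemma separated_count (rho : R) S c : separated rho S ->
  (count (fun u => enorm (u - c) <= rho)%R S <= 1)%N.
Proof.
elim: S => //= u S IH /andP[uS sS].
case: (leP (enorm (u - c)) rho) => h /=; last by rewrite add0n; exact: IH.
rewrite -[leqRHS]addn0 leq_add2l leqn0 -leqn0 leqNgt -has_count; apply/hasPn => v vS.
move/allP: uS => /(_ _ vS) uv; rewrite -ltNge.
by have := enormB_trans c u v; rewrite (enormBC c v); lra.
Qed.

Lemma separated_size N y w (rho tau : R) S : (forall i, 0 <= w i) -> \sum_(i < N) w i = 1 ->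
  separated rho S -> (forall u, u \in S -> tau <= ball_mass N y w rho u) ->
  (size S)%:R * tau <= 1.
Proof.
move=> w0 w1 sS tS.
apply: (@le_trans _ _ (\sum_(u <- S) ball_mass N y w rho u)).
  rewrite mulr_natl -sumr_const_seq big_seq [leRHS]big_seq; apply: ler_sum => u uS.
  exact: tS.
rewrite /ball_mass exchange_big/= -[leRHS]w1; apply: ler_sum => i _.
rewrite -mulr_sumr ler_piMr//.
rewrite -natr_sum -[X in _ <= X]/(1%:R) ler_nat.
rewrite (eq_bigr (fun u => (enorm (u - y i) <= rho)%R : nat))// -[leqLHS]/(\sum_(u <- S) _)%N.
by rewrite -(big_mkcond (fun u => enorm (u - y i) <= rho)%R (fun=> 1%N))/= sum1_count separated_count.
Qed.

(** Greedy selection: a separated family in [Y] either covers at distance 2 rho or can be enlarged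
    by a point of [Y]. Its balls of radius rho are disjoint and have mass at least [tau] each, so it
    has at most 1/[tau] members. *)
Lemma maximal_separated (Y : set 'rV[R]_m) N y w (rho tau : R) :
  (forall i, 0 <= w i) -> \sum_(i < N) w i = 1 -> 0 < tau ->
  (forall z, Y z -> tau <= ball_mass N y w rho z) ->
  exists S : seq 'rV[R]_m, (forall z, Y z -> exists2 u, u \in S & enorm (z - u) <= 2 * rho) /\
    (size S)%:R * tau <= 1.
Proof.
move=> w0 w1 tau0 tY; pose good S := forall z, Y z -> exists2 u, u \in S & enorm (z - u) <= 2 * rho.
have H n : (exists S, [/\ good S, separated rho S & forall u, u \in S -> Y u]) \/
    (exists S, [/\ size S = n, separated rho S & forall u, u \in S -> Y u]).
  elim: n => [|n [[S [gS sS YS]]|[S [Sn sS YS]]]]; first by right; exists [::].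
    by left; exists S.
  have [gS|ngS] := pselect (good S); first by left; exists S.
  have [z [Yz hz]] : exists z, Y z /\ forall u, u \in S -> 2 * rho < enorm (z - u).
    apply: contrapT => nex; apply: ngS => z Yz; apply: contrapT => nu; apply: nex.
    by exists z; split => // u uS; rewrite ltNge; apply/negP => le; apply: nu; exists u.
  right; exists (z :: S); split; first by rewrite /= Sn.
    by apply/andP; split=> //; apply/allP => u /hz.
  by move=> u; rewrite inE => /predU1P[->//|/YS].
(* This length exceeds 1/[tau], so the second alternative is impossible. *)
have [[S [gS sS YS]]|[S [Sn sS YS]]] := H (Num.truncn tau^-1).+1.
  by exists S; split=> //; exact: (separated_size w0 w1 sS (fun u uS => tY u (YS u uS))).
exfalso; have := separated_size w0 w1 sS (fun u uS => tY u (YS u uS)).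
rewrite Sn leNgt => /negP; apply; rewrite -ltr_pdivrMr// mul1r -natr1.
have tV : 0 <= tau^-1 by rewrite invr_ge0 ltW.
by have /andP[] := truncn_bounds tV.
Qed.

End Separated.

Section UpperBound.
Variables (R : realType) (d k : nat) (X : set 'rV[R]_d) (Lb : R).
Hypotheses (d0 : (0 < d)%N) (k0 : (0 < k)%N) (X0 : X !=set0) (L1 : 1 <= Lb)
  (XL : forall y : 'rV[R]_d, closure X y -> enorm y <= Lb).

(* Mixing an almost minimal weight with a Dirac mass at [y] can only lower the energy
   slightly, which bounds the potential at [y] from below. *)
Lemma potential_lb s r theta : 0 < r < 1 -> 0 < theta <= 1 -> 0 <= s <= k%:R ->
  exists N x w, config X N x w /\ forall y, X y ->
    dinf k s r theta X / 2 <= \sum_(j < N) w j * kern k s r theta (enorm (y - x j)).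
Proof.
move=> r01 th sk; set K := dinf k s r theta X.
have K0 : 0 < K by exact: (dinf_gt0 X0 L1 XL).
have K1 : K <= 1 by exact: dinf_le1.
pose t := K / 2; have t0 : 0 < t by rewrite /t; lra.
have [N [x [w [cf lt]]]] := dinf_approx k s theta X0 r01 (mulr_gt0 t0 t0).
exists N, x, w; split => // y Xy; set U := \sum_(j < N) _.
case: (cf) => Xx w0 w1.
pose x' n := if (n == N)%N then y else x n.
pose w' n := if (n == N)%N then t else (1 - t) * w n.
have ltN (i : 'I_N) : (i == N :> nat) = false by rewrite ltn_eqF.
have cf' : config X N.+1 x' w'.
  split.
  - by move=> i; rewrite ltnS leq_eqVlt /x' => /predU1P[->|iN]; rewrite ?eqxx// ltn_eqF//; exact: Xx.
  - by move=> i; rewrite /w'; case: ifP => _; rewrite ?(ltW t0)// mulr_ge0//; rewrite /t; lra.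
  - rewrite big_ord_recr/= /w' eqxx (eq_bigr (fun i : 'I_N => (1 - t) * w i)); last first.
      by move=> i _; rewrite ltN.
    by rewrite -mulr_sumr w1; lra.
have r0 : 0 < r by case/andP: r01.
have kz : kern k s r theta 0 = 1 by exact: kern_lt.
have := dinf_le k s theta r01 cf'; rewrite -/K.
have -> : denergy k s r theta N.+1 x' w' =
    (1 - t) ^+ 2 * denergy k s r theta N x w + 2 * t * (1 - t) * U + t ^+ 2.
  rewrite /denergy big_ord_recr/= [X in _ + X]big_ord_recr/= /w' /x' eqxx subrr enorm0 kz mulr1.
  have -> : \sum_(i < N) (t * (if i == N :> nat then t else (1 - t) * w i)) *
      kern k s r theta (enorm (y - (if i == N :> nat then y else x i))) = t * (1 - t) * U.
    rewrite /U mulr_sumr; apply: eq_bigr => i _; rewrite ltN; ring.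
  under eq_bigr => i _ do rewrite big_ord_recr/= eqxx ltN.
  rewrite big_split/=.
  have -> : \sum_(i < N) (1 - t) * w i * t * kern k s r theta (enorm (x i - y)) = t * (1 - t) * U.
    by rewrite /U mulr_sumr; apply: eq_bigr => i _; rewrite enormBC; ring.
  have -> : \sum_(i < N) \sum_(j < N) (1 - t) * w i * (if j == N :> nat then t else (1 - t) * w j) *
     kern k s r theta (enorm (x i - (if j == N :> nat then y else x j))) = (1 - t) ^+ 2 * denergy k s r theta N x w.
    rewrite /denergy mulr_sumr; apply: eq_bigr => i _; rewrite mulr_sumr; apply: eq_bigr => j _.
    by rewrite ltN; ring.
  by rewrite -/(denergy k s r theta N x w); ring.
(* Here K = 2t. If U < t, the mixture has energy below (1-t)^2 2t + t^2 + 2t^2 (1-t) + t^2 = 2t,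
   contradicting the minimality of K. The slack t^2 on the almost minimal energy is exactly what
   this computation allows. *)
move=> h; rewrite leNgt; apply/negP => UK.
have h1 : 2 * t * (1 - t) * U < 2 * t * (1 - t) * (K / 2).
  by rewrite ltr_pM2l// mulr_gt0 ?mulr_gt0//; rewrite /t; lra.
have h2 : (1 - t) ^+ 2 * denergy k s r theta N x w <= (1 - t) ^+ 2 * (K + t * t).
  by rewrite ler_wpM2l ?sqr_ge0// ltW.
have h3 : (1 - t) ^+ 2 * (t * t) <= t * t.
  have t1 : t <= 1 by rewrite /t; lra.
  have sq : (1 - t) ^+ 2 <= 1 by nra.
  by rewrite ler_piMl// mulr_ge0// ltW.
have Kt : K = 2 * t by rewrite /t; lra.
by rewrite Kt in h h1 h2; nra.
Qed.

(** The power of 2 comes from the mass thresholds [tau] in [projection_cover], the other factor from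
    [cube_cover]. *)
Definition cover_const : R := 2 ^+ k.+1 * (4 * k%:R + 1) ^+ k.

Lemma projection_cover s r theta t J (A : 'M[R]_(k, d)) : 0 < r < 1 -> 0 < theta <= 1 ->
  0 <= s <= k%:R -> s <= t -> 2 * Lb <= 2 ^+ J * r -> A *m A^T = 1%:M ->
  exists U : seq (set 'rV[R]_k),
  [/\ forall z, proj_coords A X z -> exists2 V, V \in U & V z,
      forall V, V \in U -> exists2 dl, r <= dl <= r `^ theta & ediam V = dl%:E &
      \sum_(V <- U) (fine (ediam V)) `^ t <=
        cover_const * J.+1%:R ^+ 2 / dinf k s r theta X * r `^ (s + theta * (t - s))].
Proof.
move=> r01 th sk st LJ AA; have [r0 r1] := andP r01.
have [N [x [w [cf pot]]]] := potential_lb r01 th sk.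
move: pot; set K := dinf k s r theta X => pot.
have K0 : 0 < K by exact: (dinf_gt0 X0 L1 XL).
case: (cf) => Xx w0 w1.
pose kn := kern k s r theta; pose y i := x i *m A^T.
pose rho j : R := 2 ^+ j * r.
have rr j : r <= rho j by rewrite ler_peMl ?(ltW r0)// exprn_ege1// ler1n.
have rho0 j : 0 < rho j by apply: lt_le_trans (rr j).
have kn0 j : 0 < kn (rho j) by apply: kern_gt0 => //; exact: ltW.
(* Thresholds chosen so that each of the J+1 scales contributes exactly K / (2 (J+1)) when its ball
   has mass [tau j]; if all masses were smaller, the potential would be below K/2. *)
pose tau j := K / (2 ^+ k.+1 * J.+1%:R * kn (rho j)).
have den0 j : 0 < 2 ^+ k.+1 * J.+1%:R * kn (rho j) by rewrite !mulr_gt0 ?exprn_gt0.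
have tau0 j : 0 < tau j by rewrite divr_gt0.
pose dl j := Num.min (rho j) (r `^ theta).
have rt : r <= r `^ theta.
  have [th0 th1] := andP th; have lr : ln r < 0 by rewrite ln_lt0.
  by rewrite -(expR_lnM _ r0) -[leLHS]lnK ?posrE// ler_expR; nra.
have dlr j : r <= dl j <= r `^ theta by rewrite le_min rr rt ge_min lexx orbT.
have dl0 j : 0 < dl j by have /andP[+ _] := dlr j; exact: lt_le_trans.
pose Y j := [set z | proj_coords A X z /\ tau j <= ball_mass N y w (rho j) z].
have YU z : proj_coords A X z -> exists2 j, (j <= J)%N & Y j z.
  move=> Pz; apply: contrapT => nY.
  have lt (j : 'I_J.+1) : ball_mass N y w (rho j) z < tau j.
    by rewrite ltNge; apply/negP => h; apply: nY; exists j; [rewrite -ltnS|split].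
  case: (Pz) => u Xu uz.
  have := pot u Xu; apply/negP; rewrite -ltNge.
  (* Each atom is charged to a dyadic scale that reaches it; that scale is less than doubled in
     logarithmic position by at most one step, which costs 2^k in the kernel. The assumption on [J]
     makes the last scale reach every atom. *)
  apply: (@le_lt_trans _ _ (\sum_(j < J.+1) 2 ^+ k * kn (rho j) * ball_mass N y w (rho j) z)).
    rewrite /ball_mass; under [leRHS]eq_bigr do rewrite mulr_sumr.
    rewrite exchange_big/=; apply: ler_sum => i _.
    under eq_bigr do rewrite mulrCA.
    rewrite -mulr_sumr ler_wpM2l//.
    set n := enorm (z - y i).
    have nle : n <= enorm (u - x i).
      by rewrite /n -uz /y -mulmxBl frame_enorm_le.
    have n0 : 0 <= n by exact: enorm_ge0.
    have nJ : n <= 2 ^+ J * r.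
      by apply: (le_trans nle); apply: le_trans LJ; apply: (enormB_le2L XL) => //; exact: Xx.
    have [j jJ [nj jn]] := dyadic_scale r0 nJ.
    apply: (@le_trans _ _ (kn n)); first exact: kern_ninc.
    apply: (@le_trans _ _ (2 ^+ k * kn (rho j))).
      move: jn; rewrite le_max => /orP[jr|j2n].
        apply: (@le_trans _ _ 1); first exact: kern_le1.
        have -> : rho j = r by apply/eqP; rewrite eq_le jr rr.
        have := @kern_dilate R k s r theta r01 th sk 2 (r / 2) (ler1n _ 2) (divr_ge0 (ltW r0) (ler0n _ 2)).
        by rewrite kern_lt ?[2 * _]mulrC ?divfK//; lra.
      apply: (le_trans (@kern_dilate R k s r theta r01 th sk 2 n (ler1n _ 2) n0)).
      by rewrite ler_pM2l ?exprn_gt0//; apply: kern_ninc => //; exact: ltW.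
    rewrite (bigD1 (inord j : 'I_J.+1))//= inordK// nj mulr1 lerDl.
    by apply: sumr_ge0 => l _; rewrite !mulr_ge0 ?exprn_ge0// ltW.
  apply: (@lt_le_trans _ _ (\sum_(j < J.+1) 2 ^+ k * kn (rho j) * tau j)).
    apply: ltr_sum; first by apply/hasP; exists ord0 => //; rewrite mem_index_enum.
    by move=> j _; rewrite ltr_pM2l ?lt// mulr_gt0 ?exprn_gt0.
  rewrite (eq_bigr (fun=> K / 2 / J.+1%:R)); last first.
    move=> j _; rewrite /tau exprS; field.
    by rewrite !gt_eqF ?exprn_gt0 ?ltr0n ?kn0.
  by rewrite sumr_const card_ord -[leLHS]mulr_natr divfK// pnatr_eq0.
have HU j : exists U : seq (set 'rV[R]_k),
    [/\ forall z, Y j z -> exists2 V, V \in U & V z,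
        forall V, V \in U -> ediam V = (dl j)%:E &
        (size U)%:R <= (tau j)^-1 * ((4 * k%:R + 1) ^+ k * (rho j / dl j) ^+ k)].
  have [S [cS sS]] := @maximal_separated R k (Y j) N y w (rho j) (tau j) w0 w1 (tau0 j) (fun z Yz => Yz.2).
  have dlrho : dl j <= rho j by rewrite ge_min lexx.
  have /choice[W HW] : forall z : 'rV[R]_k, exists U : seq (set 'rV[R]_k),
    [/\ forall y : 'rV[R]_k, enorm (y - z) <= 2 * rho j -> exists2 V, V \in U & V y,
      forall V, V \in U -> ediam V = (dl j)%:E &
      (size U)%:R <= (4 * k%:R + 1) ^+ k * (rho j / dl j) ^+ k].
    by move=> z; exact: cube_cover.
  exists (flatten [seq W u | u <- S]); split.
  - move=> z /cS[u uS zu]; have [cW _ _] := HW u.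
    have [V VW Vz] := cW _ zu; exists V => //.
    by apply/flattenP; exists (W u) => //; exact: map_f.
  - move=> V /flattenP[_ /mapP[u uS ->] VW]; have [_ + _] := HW u; exact.
  - rewrite size_flatten /shape -map_comp sumnE big_map natr_sum.
    pose M : R := (4 * k%:R + 1) ^+ k * (rho j / dl j) ^+ k.
    have M0 : 0 <= M.
      apply: mulr_ge0; apply: exprn_ge0; first by rewrite addr_ge0// mulr_ge0.
      by apply: divr_ge0; exact: ltW.
    rewrite -/M.
    apply: (@le_trans _ _ (\sum_(u <- S) M)); first by apply: ler_sum => u _; have [] := HW u.
    by rewrite sumr_const_seq -mulr_natl ler_wpM2r// -[leRHS]mul1r ler_pdivlMr.
have /choice[W HW] := HU.
exists (flatten [seq W j | j <- iota 0 J.+1]); split.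
- move=> z /YU[j jJ Yz]; have [cW _ _] := HW j.
  have [V VW Vz] := cW _ Yz; exists V => //.
  by apply/flattenP; exists (W j) => //; apply: map_f; rewrite mem_iota.
- move=> V /flattenP[_ /mapP[j _ ->] VW]; exists (dl j); first exact: dlr.
  by have [_ + _] := HW j; exact.
- rewrite big_flatten big_map.
  rewrite (eq_bigr (fun j => (size (W j))%:R * dl j `^ t)); last first.
    move=> j _; rewrite (eq_big_seq (fun=> dl j `^ t)).
      by rewrite sumr_const_seq mulr_natl.
    by move=> V VW; have [_ + _] := HW j; move=> ->.
  (* Cost of one scale: at most 1/[tau] balls, times the cubes per ball, times dl^t. The factor J+1
     hidden in [tau] and the J+1 scales together give the square. *)
  have le j : (size (W j))%:R * dl j `^ t <= cover_const * J.+1%:R / K * r `^ (s + theta * (t - s)).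
    have [_ _ sz] := HW j.
    apply: (le_trans (ler_wpM2r (powR_ge0 _ _) sz)).
    have := @kern_cut_cost R k s r theta r01 th (rho j) t (dl j) (rr j) st erefl.
    rewrite -/kn => cut.
    have -> : (tau j)^-1 * ((4 * k%:R + 1) ^+ k * (rho j / dl j) ^+ k) * dl j `^ t =
      cover_const * J.+1%:R / K * (kn (rho j) * (rho j / dl j) ^+ k * dl j `^ t).
      rewrite /tau /cover_const invf_div; ring.
    by rewrite ler_wpM2l// divr_ge0 ?(ltW K0)// !mulr_ge0 ?exprn_ge0 ?addr_ge0 ?mulr_ge0.
  apply: (le_trans (ler_sum _ (fun j _ => le j))).
  rewrite sumr_const_seq size_iota -mulr_natl le_eqVlt; apply/orP; left; apply/eqP.
  ring.
Qed.

(** The cover scale is r^theta, because its power 1/theta is r: the admissible diameters are then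
    exactly those from r to r^theta. *)
Lemma theta_cover_small theta s t e (A : 'M[R]_(k, d)) : 0 < theta <= 1 -> 0 <= s <= k%:R ->
  s < t -> 0 < e -> A *m A^T = 1%:M ->
  exists2 dl, 0 < dl <= 1 & forall r, 0 < r -> r < dl ->
    log_capacity k X s theta r < s + theta * (t - s) / 4 ->
    theta_cover_ok (proj_coords A X) theta (r `^ theta) t e.
Proof.
move=> th sk st e0 AA; have [th0 th1] := andP th.
(* The gain is r^(4 eta). The number of scales squared costs r^(-eta), the capacity costs another
   r^(-eta) beyond r^(-s), and r^(2 eta) remains to beat the constants and [e]. *)
pose eta := theta * (t - s) / 4.
have eta0 : 0 < eta by rewrite divr_gt0// mulr_gt0// subr_gt0.
have [c c0 Hc] := @dyadic_count R (2 * Lb) (eta / 2) (ltac:(move: L1; lra)) (ltac:(lra)).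
have cc0 : 0 < cover_const * c ^+ 2.
  by rewrite !mulr_gt0 ?exprn_gt0// ltr_pwDr// mulr_ge0.
have [dl dl01 small] := @powR_small R (cover_const * c ^+ 2) (2 * eta) e cc0 (ltac:(lra)) e0.
exists dl => // r r0 rd flt.
have [dl0 dl1] := andP dl01; have r1 : r < 1 by lra.
have r01 : 0 < r < 1 by rewrite r0.
have [J LJ cJ] := Hc r r01.
have [U [cU dU sU]] := projection_cover r01 th sk (ltW st) LJ AA.
exists U; split; first by apply/bigcup_nthP.
split.
  move=> V /dU[x /andP[rx xr] ->]; rewrite !lee_fin xr; split=> //.
  by rewrite -powRrM mulfV ?gt_eqF// powRr1// ltW.
apply: (le_trans sU); apply: le_trans (small r r0 rd).
have lr : ln r < 0 by rewrite ln_lt0.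
have C0 := capacity_gt0 d0 X0 L1 XL r01 th sk.
have CK : (dinf k s r theta X)^-1 <= r `^ (- (s + eta)).
  have /andP[+ _] := capacity_bounds X0 L1 XL r01 th sk d0; move/le_trans; apply.
  rewrite -[leLHS]lnK ?posrE// -(expR_lnM _ r0) ler_expR.
  by move: flt; rewrite /log_capacity ltr_pdivrMr -/eta; lra.
have JJ : J.+1%:R ^+ 2 <= c ^+ 2 * r `^ (- eta).
  have -> : r `^ (- eta) = (r `^ (- (eta / 2))) ^+ 2.
    by rewrite -powR_mulrn ?powR_ge0// -powRrM; congr (_ `^ _); lra.
  by rewrite -exprMn lerXn2r// nnegrE ?mulr_ge0 ?powR_ge0// ltW.
have K0 := dinf_gt0 X0 L1 XL r01 th sk.
have cv0 : 0 <= cover_const.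
  by rewrite /cover_const mulr_ge0 ?exprn_ge0// addr_ge0// mulr_ge0.
rewrite -[leRHS]mulrA.
set p := r `^ (s + _); set K' := dinf k s r theta X.
rewrite (_ : _ / K' * p = cover_const * (J.+1%:R ^+ 2 * (K'^-1 * p))); last by ring.
rewrite ler_wpM2l// /p /K'.
apply: (@le_trans _ _ ((c ^+ 2 * r `^ (- eta)) * (r `^ (- (s + eta)) * r `^ (s + theta * (t - s))))).
  apply: ler_pM => //.
  - by rewrite mulr_ge0 ?powR_ge0// invr_ge0 ltW.
  - by rewrite ler_wpM2r ?powR_ge0.
rewrite -mulrA ler_wpM2l ?exprn_ge0 ?(ltW c0)// -!powRD ?(gt_eqF r0) ?implybT//.
have -> : - eta + (- (s + eta) + (s + theta * (t - s))) = 2 * eta by rewrite /eta; lra.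
by [].
Qed.

Lemma lower_int_dim_le theta s (A : 'M[R]_(k, d)) : 0 < theta <= 1 -> A *m A^T = 1%:M ->
  is_profile k X (@liminf0 R) theta s -> (lower_int_dim theta (proj_coords A X) <= s%:E)%E.
Proof.
move=> th AA [sk Ls]; have [th0 th1] := andP th; have [s0 _] := andP sk.
apply/lee_addgt0Pr => e e0; rewrite -EFinD.
apply: ereal_inf_lbound; exists (s + e) => //; split; first by lra.
move=> e' e'0 r0 r00.
have st : s < s + e by lra.
have [dl /andP[dl0 dl1] H] := theta_cover_small th sk st e'0 AA.
have eta0 : 0 < theta * (s + e - s) / 4 by rewrite divr_gt0// mulr_gt0// subr_gt0.
have m0 : 0 < Num.min dl (r0 `^ theta^-1) by rewrite lt_min dl0 powR_gt0.
have [r [rr0 rm fr]] := liminf0_frequently_lt Ls eta0 m0.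
move: rm; rewrite lt_min => /andP[r1 r2].
exists (r `^ theta); split; last exact: H.
rewrite powR_gt0//=.
have : r `^ theta <= (r0 `^ theta^-1) `^ theta.
  by rewrite ge0_ler_powR ?nnegrE ?powR_ge0// ltW.
by rewrite -powRrM mulVf ?gt_eqF// powRr1// ltW.
Qed.

Lemma upper_int_dim_le theta s (A : 'M[R]_(k, d)) : 0 < theta <= 1 -> A *m A^T = 1%:M ->
  is_profile k X (@limsup0 R) theta s -> (upper_int_dim theta (proj_coords A X) <= s%:E)%E.
Proof.
move=> th AA [sk Ls]; have [th0 th1] := andP th; have [s0 _] := andP sk.
apply/lee_addgt0Pr => e e0; rewrite -EFinD.
apply: ereal_inf_lbound; exists (s + e) => //; split; first by lra.
move=> e' e'0.
have st : s < s + e by lra.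
have [dl /andP[dl0 dl1] H] := theta_cover_small th sk st e'0 AA.
have eta0 : 0 < theta * (s + e - s) / 4 by rewrite divr_gt0// mulr_gt0// subr_gt0.
have [dl' dl'0 H'] := limsup0_eventually_lt Ls eta0.
pose m := Num.min dl dl' / 2; have m0 : 0 < m by rewrite divr_gt0// lt_min dl0.
exists (m `^ theta); split; first exact: powR_gt0.
move=> r /andP[r0 rm].
have rE : r = (r `^ theta^-1) `^ theta by rewrite -powRrM mulVf ?gt_eqF// powRr1// ltW.
have rt0 : 0 < r `^ theta^-1 by rewrite powR_gt0.
have : r `^ theta^-1 <= (m `^ theta) `^ theta^-1.
  by rewrite ge0_ler_powR ?nnegrE ?powR_ge0 ?invr_ge0// ltW.
rewrite -powRrM mulfV ?gt_eqF// powRr1 ?(ltW m0)// => rtm.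
have [] : m < dl /\ m < dl'.
  have : Num.min dl dl' <= dl by rewrite ge_min lexx.
  have : Num.min dl dl' <= dl' by rewrite ge_min lexx orbT.
  by rewrite /m; lra.
move=> m1 m2; rewrite rE; apply: H => //; first exact: le_lt_trans m1.
by apply: H' => //; exact: le_lt_trans m2.
Qed.

End UpperBound.

(** * Frames, reflections and rotations *)

Section Frames.
Variables (R : realType) (d : nat).
Implicit Types (P : 'M[R]_d) (x y u v : 'rV[R]_d).

Lemma mx11_eq (A B : 'M[R]_1) : A ord0 ord0 = B ord0 ord0 -> A = B.
Proof. by move=> e; apply/matrixP => i j; rewrite !ord1. Qed.

Lemma unit_self u : enorm u = 1 -> u *m u^T = 1%:M.
Proof. by move=> e; apply: mx11_eq; rewrite -enorm_sqr_mul e expr1n mxE. Qed.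

Lemma enorm_normalize u : u != 0 -> enorm ((enorm u)^-1 *: u) = 1.
Proof.
move=> u0; have h := enorm_gt0 u0.
by rewrite enormZ ger0_norm ?invr_ge0 ?enorm_ge0// mulVf// gt_eqF.
Qed.

(** Induction on the rank: a nonzero row of [P], normalised to [v], lies in the range, and P - v^T v
    is again an orthogonal projection, of smaller rank, whose frame is orthogonal to [v]. *)
Lemma frame_exists P : P^T = P -> P *m P = P ->
  exists m (A : 'M[R]_(m, d)), A *m A^T = 1%:M /\ A^T *m A = P.
Proof.
move: {2}(\rank P).+1 (ltnSn (\rank P)) => n; elim: n P => // n IH P; rewrite ltnS => rn PT PP.
have [->|P0] := eqVneq P 0.
  exists 0%N, (0 : 'M[R]_(0, d)); split; last by rewrite mulmx0.
  by apply/matrixP => -[].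
have [i ui] : exists i, row i P != 0.
  apply/existsP; apply: contraR P0; rewrite negb_exists => /forallP h.
  by apply/eqP/row_matrixP => i; rewrite row0; apply/eqP; have := h i; rewrite negbK.
pose v := (enorm (row i P))^-1 *: row i P.
have vv : v *m v^T = 1%:M by apply: unit_self; exact: enorm_normalize.
have vP : v *m P = v by rewrite -scalemxAl -row_mul PP.
have Pv : P *m v^T = v^T by rewrite -{1}PT -trmx_mul vP.
pose P' := P - v^T *m v.
have P'T : P'^T = P' by rewrite /P' linearB/= PT trmx_mul trmxK.
have vP' : v *m P' = 0 by rewrite mulmxBr vP mulmxA vv mul1mx subrr.
have P'P' : P' *m P' = P'.
  by rewrite {1}/P' mulmxBl -mulmxA vP' mulmx0 subr0 /P' mulmxBr PP mulmxA Pv.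
have P'P : P' *m P = P' by rewrite /P' mulmxBl PP -mulmxA vP.
have lt : (P' < P)%MS.
  rewrite ltmxE -{1}P'P submxMl/=; apply/negP => PP'.
  have /submxP[w wE] : (v <= P')%MS by apply: submx_trans PP'; rewrite -vP submxMl.
  have v0 : v = 0 by rewrite -vP' {2}wE -mulmxA P'P' -wE.
  have := vv; rewrite v0 mul0mx => /matrixP/(_ ord0 ord0); rewrite !mxE => /eqP.
  by rewrite eq_sym oner_eq0.
have [|m [A' [AA AP]]] := IH P' _ P'T P'P'; first exact: leq_trans (rank_ltmx lt) rn.
have Av : A' *m v^T = 0.
  have A'P' : A' = A' *m P' by rewrite -AP mulmxA AA mul1mx.
  by rewrite A'P' -mulmxA -P'T -trmx_mul vP' trmx0 mulmx0.
exists (1 + m)%N, (col_mx v A'); split.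
  rewrite tr_col_mx mul_col_row vv AA Av -[v *m A'^T]trmxK trmx_mul trmxK Av trmx0.
  by rewrite -scalar_mx_block.
by rewrite tr_col_mx mul_row_col AP /P' addrC subrK.
Qed.

Lemma frame_rank m (A : 'M[R]_(m, d)) P : frame_of A P -> \rank P = m.
Proof.
move=> [AA AP].
have fA : row_free A by apply/row_freeP; exists A^T.
apply/eqP; rewrite eqn_leq; apply/andP; split.
  by rewrite -AP; apply: leq_trans (mxrankM_maxr _ _) _; exact: rank_leq_row.
rewrite -(eqP fA); apply: mxrankS; apply/submxP; exists A.
by rewrite -AP mulmxA AA mul1mx.
Qed.

Lemma frame_trace m (A : 'M[R]_(m, d)) P : frame_of A P -> \tr P = m%:R.
Proof. by move=> [AA <-]; rewrite mxtrace_mulC AA mxtrace1. Qed.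

(** The trace replaces the rank because it is a polynomial in the entries, which makes the
    Grassmannian a Borel set. *)
Lemma grassmannianP k P : grassmannian k P <-> [/\ P^T = P, P *m P = P & \tr P = k%:R].
Proof.
split=> [[PT [PP rk]]|[PT PP trk]]; have [m [A fA]] := frame_exists PT PP.
  by split=> //; rewrite (frame_trace fA) -(frame_rank fA) rk.
split=> //; split=> //; rewrite (frame_rank fA).
by apply/eqP; rewrite -(eqr_nat R) -trk (frame_trace fA).
Qed.

(** A frame of 1 - P complements that of [P]; the Pythagorean splitting separates k directions along
    V from the d - k others. *)
Lemma frame_complement k P : grassmannian k P ->
  exists (A : 'M[R]_(k, d)) m (B : 'M[R]_(m, d)),
  [/\ (k + m)%N = d, frame_of A P, B *m B^T = 1%:M &
   forall x, enorm x ^+ 2 = enorm (x *m A^T) ^+ 2 + enorm (x *m B^T) ^+ 2].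
Proof.
move=> [PT [PP rk]]; have [k' [A fA]] := frame_exists PT PP.
have E := frame_rank fA; rewrite rk in E; subst k'.
have QT : (1%:M - P)^T = 1%:M - P by rewrite linearB/= trmx1 PT.
have QQ : (1%:M - P) *m (1%:M - P) = 1%:M - P.
  by rewrite mulmxBl mul1mx mulmxBr mulmx1 PP subrr subr0.
have [m [B fB]] := frame_exists QT QQ.
exists A, m, B; split=> //.
- apply/eqP; rewrite -(eqr_nat R) natrD -(frame_trace fA) -(frame_trace fB).
  by rewrite linearB/= mxtrace1 addrC subrK.
- by case: fB.
- move=> x; rewrite !enorm_sqr_mul !trmx_mul !trmxK.
  rewrite -[X in _ = X + _]/(_ ord0 ord0) !mulmxA -[x *m A^T *m A]mulmxA -[x *m B^T *m B]mulmxA.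
  case: fA fB => _ -> [_ ->]; rewrite mulmxBr mulmxBl mulmx1.
  by rewrite [X in _ = _ + X]mxE [X in _ = _ + (_ + X)]mxE addrC subrK.
Qed.

(** For a unit vector [u], the Householder reflection in the hyperplane orthogonal to [u]. *)
Definition reflection u : 'M[R]_d := 1%:M - 2 *: (u^T *m u).

Lemma reflection_sym u : (reflection u)^T = reflection u.
Proof. by rewrite /reflection linearB/= linearZ/= trmx1 trmx_mul trmxK. Qed.

Lemma mul_reflection x u : x *m reflection u = x - 2 * (x *m u^T) ord0 ord0 *: u.
Proof.
rewrite mulmxBr mulmx1 -scalemxAr mulmxA; congr (_ - _).
by rewrite [x *m u^T]mx11_scalar mul_scalar_mx scalerA !mxE eqxx mulr1n.
Qed.

Lemma reflectionK u : enorm u = 1 -> reflection u *m reflection u = 1%:M.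
Proof.
move=> u1; apply/row_matrixP => i; rewrite row_mul row1.
have -> : row i (reflection u) = delta_mx 0 i *m reflection u by rewrite -rowE.
move: (delta_mx 0 i) => x; rewrite !mul_reflection.
set c := (x *m u^T) ord0 ord0.
have -> : ((x - 2 * c *: u) *m u^T) ord0 ord0 = - c.
  rewrite mulmxBl -scalemxAl (unit_self u1) mxE [X in _ + X]mxE [X in _ - X]mxE [X in _ * X]mxE eqxx -/c.
  by rewrite mulr1n; ring.
by rewrite mulrN scaleNr opprK subrK.
Qed.

(** The mirror is orthogonal to x - y; equal norms give |x - y|^2 = 2 <x, x - y>, so the reflection
    subtracts precisely x - y. *)
Lemma reflection_swap x y : enorm x = enorm y -> x != y ->
  exists2 u, enorm u = 1 & x *m reflection u = y.
Proof.
move=> xy nxy; have z0 : x - y != 0 by rewrite subr_eq0.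
pose u := (enorm (x - y))^-1 *: (x - y); exists u; first exact: enorm_normalize.
have n0 := enorm_gt0 z0.
rewrite mul_reflection.
have -> : 2 * (x *m u^T) ord0 ord0 *: u = x - y; last by rewrite opprB addrC subrK.
have uT : u^T = (enorm (x - y))^-1 *: (x - y)^T by rewrite /u linearZ.
rewrite uT -scalemxAr mxE /u scalerA.
rewrite (_ : _ * _ = 1) ?scale1r//.
have e : enorm (x - y) ^+ 2 = 2 * (x *m (x - y)^T) ord0 ord0.
  have s2 : (x *m y^T) ord0 ord0 = (y *m x^T) ord0 ord0.
    by rewrite -[x *m y^T]trmxK trmx_mul trmxK mxE.
  have subE (A B : 'M[R]_1) : (A - B) ord0 ord0 = A ord0 ord0 - B ord0 ord0 by rewrite !mxE.
  have := congr1 (fun t => t ^+ 2) xy; rewrite !enorm_sqr_mul => e2.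
  have tB : (x - y)^T = x^T - y^T by rewrite linearB.
  rewrite tB mulmxBl !mulmxBr !subE -e2 s2; ring.
by rewrite mulrCA -e expr2; field; rewrite gt_eqF.
Qed.

(** For the first basis vector the matrix is diagonal with a single -1; a reflection taking that
    vector to [u] conjugates the two cases. *)
Lemma det_reflection u : (0 < d)%N -> enorm u = 1 -> \det (reflection u) = -1.
Proof.
move=> d0 u1; pose i0 := Ordinal d0; pose e0 : 'rV[R]_d := delta_mx 0 i0.
have ee : e0^T *m e0 = delta_mx i0 i0 by rewrite trmx_delta mul_delta_mx.
have e1 : enorm e0 = 1.
  rewrite /enorm (bigD1 i0)//= big1 => [|j ji]; first by rewrite !mxE !eqxx expr1n addr0 sqrtr1.
  by rewrite !mxE (negPf ji) andbF expr0n.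
have det0 : \det (reflection e0) = -1.
  have -> : reflection e0 = diag_mx (\row_j (if j == i0 then -1 else 1)).
    apply/matrixP => i j; rewrite /reflection ee !mxE.
    have [<-|ij] := eqVneq i j; first by rewrite !mulr1n andbb; case: eqVneq => _ /=; ring.
    have -> : (i == i0) && (j == i0) = false.
      by apply/negbTE; apply: contra ij => /andP[/eqP-> /eqP->].
    by rewrite !mulr0n mulr0 subr0.
  rewrite det_diag (bigD1 i0)//= big1 => [|j ji]; first by rewrite mxE eqxx mulr1.
  by rewrite mxE (negPf ji).
have [<-//|ne] := eqVneq e0 u.
have [w w1 ew] := reflection_swap (etrans e1 (esym u1)) ne.
have := reflectionK w1; have := reflection_sym w; move: ew.
move: (reflection w) => W ew WT Q2.
have -> : reflection u = W *m reflection e0 *m W.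
  rewrite -ew /reflection trmx_mul WT mulmxBr mulmx1 mulmxBl Q2.
  by rewrite -scalemxAr -scalemxAl !mulmxA.
rewrite !det_mulmx det0 mulrAC -det_mulmx Q2 det1 mul1r//.
Qed.

(** A single reflection has determinant -1, so two are composed, x to -x and then -x to y. The
    second one needs y different from -x. *)
Lemma rotation_transitive x y : (0 < d)%N -> enorm x = enorm y -> x != 0 -> y != - x ->
  exists2 O, rotation O & x *m O = y.
Proof.
move=> d0 xy x0 yx.
have [|u u1 xu] := @reflection_swap x (- x) (esym (enormN x)).
  by rewrite -subr_eq0 opprK -mulr2n -scaler_nat scaler_eq0 negb_or x0 pnatr_eq0.
have [||v v1 yv] := @reflection_swap (- x) y; [by rewrite enormN|by rewrite eq_sym|].
exists (reflection u *m reflection v); last by rewrite mulmxA xu.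
split.
  rewrite trmx_mul !reflection_sym mulmxA -[reflection v *m _ *m _]mulmxA (reflectionK u1).
  by rewrite mulmx1 reflectionK.
by rewrite det_mulmx !det_reflection// mulrN1 opprK.
Qed.

Lemma rotation_enorm (O : 'M[R]_d) x : rotation O -> enorm (x *m O^T) = enorm x.
Proof.
move=> [OO _]; apply/eqP; rewrite -(@eqrXn2 _ 2) ?enorm_ge0//; apply/eqP.
by rewrite !enorm_sqr_mul trmx_mul trmxK mulmxA -[x *m O^T *m O]mulmxA OO mulmx1.
Qed.

End Frames.

(** * Transversality *)

Section GridCount.
Variables (R : realType) (d : nat).

(** The grid lies in the cube [1, 2)^d, away from the origin, so that its points can be rescaled to
    any prescribed norm. *)
Definition grid_point M (v : {ffun 'I_d -> 'I_M}) : 'rV[R]_d :=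
  \row_i (1 + (v i)%:R / M%:R).

Lemma grid_enorm_le M (v : {ffun 'I_d -> 'I_M}) : (0 < M)%N -> enorm (grid_point v) <= 2 * d%:R.
Proof.
move=> M0; rewrite (le_trans (enorm_le_coord (h := 2) _ _))//.
  move=> i; rewrite mxE ger0_norm ?addr_ge0 ?divr_ge0//.
  have : (v i)%:R / M%:R <= 1 :> R by rewrite ler_pdivrMr ?ltr0n// mul1r ler_nat ltnW.
  lra.
rewrite mulrC ler_pM2l// -[leRHS]ger0_norm ?ler0n// -sqrtr_sqr ler_sqrt ?sqr_ge0//.
by rewrite -natrX ler_nat; case: (d) => // n; rewrite -[leqLHS]expn1 leq_pexp2l.
Qed.

Lemma grid_enorm_gt0 M (v : {ffun 'I_d -> 'I_M}) : (0 < d)%N -> 0 < enorm (grid_point v).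
Proof.
move=> d0; apply: lt_le_trans (coord_le_enorm _ (Ordinal d0)); rewrite mxE.
by rewrite ger0_norm ?addr_ge0 ?divr_ge0// ltr_pwDl ?divr_ge0.
Qed.

Lemma truncn_eq_dist (a b : R) : 0 <= a -> 0 <= b -> Num.truncn a = Num.truncn b -> `|a - b| < 1.
Proof.
move=> a0 b0 e; have := truncn_bounds a0; have := truncn_bounds b0; rewrite e.
by rewrite ltr_norml; lra.
Qed.

Lemma natr_dist_lt1 (a b : nat) : `|a%:R - b%:R| < 1 :> R -> a = b.
Proof.
rewrite ltr_norml => /andP[h1 h2]; apply/eqP; rewrite eqn_leq -ltnS -(ltnS b).
rewrite -!(ltr_nat R) -!natr1; apply/andP; split; lra.
Qed.

Lemma cell_lt (t D h : R) (c : nat) : 0 <= D -> 0 < h -> `|t| <= D -> 2 * D * h = c%:R ->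
  0 <= (t + D) * h /\ (Num.truncn ((t + D) * h) < c.+1)%N.
Proof.
move=> D0 h0; rewrite ler_norml => /andP[t1 t2] E.
have p0 : 0 <= (t + D) * h by rewrite mulr_ge0 ?(ltW h0)//; lra.
split=> //; rewrite ltnS -(ler_nat R); have /andP[le _] := truncn_bounds p0.
by apply: (le_trans le); rewrite -E ler_pM2r//; lra.
Qed.

(** In coordinates adapted to [P], the k coordinates along V range over an interval of length 4d/M
    and the d - k others over one of length 4d. Cutting into cells of side 1/h gives a bounded
    number of choices for the former and a multiple of M for the latter; a cell holds at most one
    grid point. *)
Lemma grid_count k P M : grassmannian k P -> (0 < M)%N ->
  (#|[set v : {ffun 'I_d -> 'I_M} | (enorm (grid_point v *m P) <= 2 * d%:R / M%:R)%R]%SET|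
     <= (4 * d * d.+1).+1 ^ d * M ^ (d - k))%N.
Proof.
move=> gP M0; have [A [m [B [kmd fA BB split_norm]]]] := frame_complement gP.
have AA : A *m A^T = 1%:M by case: fA.
have M0R : 0 < M%:R :> R by rewrite ltr0n.
set a := (4 * d * d.+1)%N.
(* Two points of one cell are at distance at most sqrt(d) / (M (d+1)), below the grid spacing
   1/M. *)
pose h : R := M%:R * d.+1%:R; have h0 : 0 < h by rewrite mulr_gt0.
pose DA : R := 2 * d%:R / M%:R; pose DB : R := 2 * d%:R.
have DA0 : 0 <= DA by rewrite divr_ge0 ?mulr_ge0.
have DB0 : 0 <= DB by rewrite mulr_ge0.
have EA : 2 * DA * h = a%:R.
  by rewrite /DA /h /a !natrM; field; rewrite gt_eqF.
have EB : 2 * DB * h = (a * M)%:R.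
  by rewrite /DB /h /a !natrM; ring.
pose S : {set {ffun 'I_d -> 'I_M}} := [set v : {ffun 'I_d -> 'I_M} | (enorm (grid_point v *m P) <= 2 * d%:R / M%:R)%R]%SET.
have cA (v : {ffun 'I_d -> 'I_M}) i : v \in S -> `|(grid_point v *m A^T) ord0 i| <= DA.
  by rewrite inE -(frame_enormE _ fA) => vS; apply: le_trans vS; exact: coord_le_enorm.
have cB (v : {ffun 'I_d -> 'I_M}) i : `|(grid_point v *m B^T) ord0 i| <= DB.
  apply: (@le_trans _ _ (enorm (grid_point v))); last exact: grid_enorm_le.
  by apply: le_trans (frame_enorm_le (grid_point v) BB); exact: coord_le_enorm.
pose f (v : {ffun 'I_d -> 'I_M}) := [ffun i : 'I_k => inord (Num.truncn (((grid_point v *m A^T) ord0 i + DA) * h)) : 'I_a.+1].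
pose g (v : {ffun 'I_d -> 'I_M}) := [ffun i : 'I_m => inord (Num.truncn (((grid_point v *m B^T) ord0 i + DB) * h)) : 'I_(a * M).+1].
have inj : {in S &, injective (fun v => (f v, g v))}.
  move=> v v' vS v'S [fE gE].
  pose z := grid_point v - grid_point v'.
  have hV0 : 0 <= h^-1 by rewrite invr_ge0 ltW.
  have subE n (F G : 'rV[R]_n) i : (F - G) ord0 i = F ord0 i - G ord0 i by rewrite !mxE.
  have zA i : `|(z *m A^T) ord0 i| <= h^-1.
    have /ffunP/(_ i) := fE; rewrite !ffunE => /(congr1 val)/=.
    have [p0 p1] := cell_lt DA0 h0 (cA v i vS) EA.
    have [q0 q1] := cell_lt DA0 h0 (cA v' i v'S) EA.
    rewrite !inordK// => /(truncn_eq_dist p0 q0); rewrite -mulrBl normrM (gtr0_norm h0).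
    rewrite opprD addrACA subrr addr0 -ltr_pdivlMr// div1r => /ltW; apply: le_trans; rewrite mulmxBl.
    by rewrite subE.
  have zB i : `|(z *m B^T) ord0 i| <= h^-1.
    have /ffunP/(_ i) := gE; rewrite !ffunE => /(congr1 val)/=.
    have [p0 p1] := cell_lt DB0 h0 (cB v i) EB.
    have [q0 q1] := cell_lt DB0 h0 (cB v' i) EB.
    rewrite !inordK// => /(truncn_eq_dist p0 q0); rewrite -mulrBl normrM (gtr0_norm h0).
    rewrite opprD addrACA subrr addr0 -ltr_pdivlMr// div1r => /ltW; apply: le_trans; rewrite mulmxBl.
    by rewrite subE.
  have nA : enorm (z *m A^T) ^+ 2 <= k%:R * h^-1 ^+ 2.
    rewrite -[k%:R]sqr_sqrtr// -exprMn ler_sqr ?nnegrE ?enorm_ge0 ?mulr_ge0 ?sqrtr_ge0//.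
    exact: enorm_le_coord.
  have nB : enorm (z *m B^T) ^+ 2 <= m%:R * h^-1 ^+ 2.
    rewrite -[m%:R]sqr_sqrtr// -exprMn ler_sqr ?nnegrE ?enorm_ge0 ?mulr_ge0 ?sqrtr_ge0//.
    exact: enorm_le_coord.
  have nz : enorm z < M%:R^-1.
    rewrite -ltr_sqr ?nnegrE ?enorm_ge0 ?invr_ge0// split_norm.
    apply: (le_lt_trans (lerD nA nB)); rewrite -mulrDl -natrD kmd /h invfM exprMn mulrCA.
    rewrite -[ltRHS]mulr1 ltr_pM2l ?exprn_gt0 ?invr_gt0// exprVn ltr_pdivrMr ?exprn_gt0// mul1r.
    by rewrite -natrX ltr_nat (leq_trans (ltnSn d))// -[leqLHS]expn1 leq_pexp2l.
  apply/ffunP => i; apply/val_inj/natr_dist_lt1.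
  have := le_lt_trans (coord_le_enorm z i) nz; rewrite !mxE opprD addrACA subrr add0r -mulrBl normrM.
  by rewrite [`|M%:R^-1|]ger0_norm ?invr_ge0// -[ltRHS]mul1r ltr_pM2r ?invr_gt0.
rewrite -/S -(card_in_imset inj).
apply: leq_trans (max_card _) _; rewrite card_prod !card_ffun !card_ord.
have -> : (d - k)%N = m by rewrite -kmd addKn.
have -> : (a.+1 ^ d = a.+1 ^ k * a.+1 ^ m)%N by rewrite -expnD kmd.
rewrite -mulnA leq_mul2l -expnMn; apply/orP; right.
have bM : ((a * M).+1 <= a.+1 * M)%N by rewrite mulSn -addn1 addnC leq_add2r.
by elim: (m) => // n IH; rewrite !expnS leq_mul.
Qed.

End GridCount.

Section Transversality.
Variable R : realType.

(** Double counting: the sum of the indicators is at most C on [G], and at most the number of sets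
    off [G], where there is no mass. *)
Lemma measure_sum_le_card (dd : measure_display) (T : measurableType dd)
  (mu : probability T R) (I : finType) (E : I -> set T) (G : set T) (C : nat) :
  (forall i, measurable (E i)) -> measurable G -> mu (~` G) = 0%E ->
  (forall x, G x -> (#|[set i | x \in E i]%SET| <= C)%N) ->
  (\sum_(i : I) mu (E i) <= C%:R%:E)%E.
Proof.
move=> mE mG muG cnt.
have m1 (A : set T) : measurable A -> measurable_fun setT (fun x => (\1_A x)%:E : \bar R).
  by move=> mA; apply/measurable_EFinP; exact: measurable_indic.
have -> : (\sum_(i : I) mu (E i) = \int[mu]_x \sum_(i : I) (\1_(E i) x)%:E)%E.
  rewrite ge0_integral_sum; [|by []|by move=> i; exact: m1|by move=> i x _; rewrite lee_fin].
  by apply: eq_bigr => i _; rewrite integral_indic// setIT.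
have mGC : measurable (~` G) by exact: measurableC.
apply: (@le_trans _ _ (\int[mu]_x ((C%:R)%:E + (#|I|%:R)%:E * (\1_(~` G) x)%:E))%E).
  apply: integral_mono => x; first by apply: sume_ge0 => i _; rewrite lee_fin.
  rewrite sumEFin -EFinM -EFinD lee_fin.
  have -> : \sum_(i : I) \1_(E i) x = #|[set i | x \in E i]%SET|%:R :> R.
    rewrite -sum1dep_card natr_sum [RHS]big_mkcond/=; apply: eq_bigr => i _.
    by rewrite indicE; case: (x \in E i).
  have [Gx|nGx] := pselect (G x).
    rewrite (le_trans (y := C%:R))// ?ler_nat ?cnt// lerDl mulr_ge0//.
  rewrite indicE mem_set// mulr1 (le_trans (y := #|I|%:R))// ?ler_nat ?max_card// lerDr//.
have mI := m1 _ mGC.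
have mM : measurable_fun setT (fun x => (#|I|%:R)%:E * (\1_(~` G) x)%:E : \bar R)%E.
  by apply: emeasurable_funM; [exact: measurable_cst|].
have i0 x : (0 <= (\1_(~` G) x)%:E :> \bar R)%E by rewrite lee_fin.
have M0 x : (0 <= (#|I|%:R)%:E * (\1_(~` G) x)%:E :> \bar R)%E by rewrite mule_ge0// lee_fin.
rewrite ge0_integralD ?lee_fin//.
have cC : (\int[mu]_x (C%:R)%:E = (C%:R)%:E)%E.
  rewrite integral_cst// -[RHS]mule1; congr (_ * _)%E; exact: probability_setT.
have cG : (\int[mu]_x (\1_(~` G) x)%:E = 0)%E.
  by rewrite integral_indic// setIT; exact: muG.
by rewrite cC ge0_integralZl ?lee_fin// cG mule0 adde0.
Qed.

Variables (d k : nat).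
Hypotheses (d0 : (0 < d)%N) (kd : (k <= d)%N).
Variable gamma : probability (borelT 'M[R]_d) R.
Hypotheses (rot : rotation_invariant gamma) (gG : gamma (~` [set P | grassmannian k P]) = 0%E).

Lemma measurable_mulmx_enorm (x : 'rV[R]_d) :
  measurable_fun setT (fun P : borelT 'M[R]_d => enorm (x *m (P : 'M[R]_d))).
Proof.
apply: measurable_enorm => i.
rewrite (_ : (fun P => _) = (fun P : borelT 'M[R]_d => \sum_(j < d) x ord0 j * P j i)); last first.
  by apply/funext => P; rewrite mxE.
apply: measurable_sum => j; apply: measurable_funM; first exact: measurable_cst.
exact: measurable_coord.
Qed.

Definition thin_set (x : 'rV[R]_d) (rho : R) : set (borelT 'M[R]_d) :=
  [set P | enorm (x *m (P : 'M[R]_d)) <= rho].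

Lemma measurable_thin_set x rho : measurable (thin_set x rho).
Proof. by apply: measurable_fun_le_cst; exact: measurable_mulmx_enorm. Qed.

(** By [grassmannianP] membership is a system of polynomial equations, and [D] collects their
    squares into a single condition. *)
Lemma measurable_grassmannian : measurable ([set P | grassmannian k P] : set (borelT 'M[R]_d)).
Proof.
pose D (P : borelT 'M[R]_d) : R := \sum_(i < d) \sum_(j < d) (P j i - P i j) ^+ 2 +
  \sum_(i < d) \sum_(j < d) (\sum_(l < d) P i l * P l j - P i j) ^+ 2 +
  (\sum_(i < d) P i i - k%:R) ^+ 2.
have -> : [set P | grassmannian k P] = [set P | D P <= 0].
  have s0 (F : 'I_d -> 'I_d -> R) : 0 <= \sum_(i < d) \sum_(j < d) F i j ^+ 2.
    by apply: sumr_ge0 => i _; apply: sumr_ge0 => j _; exact: sqr_ge0.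
  have z0 (F : 'I_d -> 'I_d -> R) : \sum_(i < d) \sum_(j < d) F i j ^+ 2 = 0 -> forall i j, F i j = 0.
    move=> /eqP; rewrite psumr_eq0 => [/allP h i j|i _]; last by apply: sumr_ge0 => j _; exact: sqr_ge0.
    have := h i; rewrite mem_index_enum => /(_ isT); rewrite psumr_eq0 => [|j' _]; last exact: sqr_ge0.
    by move=> /allP/(_ j); rewrite mem_index_enum => /(_ isT); rewrite sqrf_eq0 => /eqP.
  apply/seteqP; split => P /=.
    move=> /grassmannianP[PT PP tP]; rewrite le_eqVlt; apply/orP; left; apply/eqP.
    rewrite /D -[X in (X - _) ^+ 2]/(\tr (P : 'M[R]_d)) tP subrr expr0n addr0.
    rewrite !big1 ?addr0// => i _; rewrite big1// => j _.
      by move/matrixP: PP => /(_ i j); rewrite mxE => ->; rewrite subrr expr0n.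
    by move/matrixP: PT => /(_ i j); rewrite mxE => ->; rewrite subrr expr0n.
  move=> DP.
  have h1 := s0 (fun i j => P j i - P i j).
  have h2 := s0 (fun i j => \sum_(l < d) P i l * P l j - P i j).
  have h3 := sqr_ge0 (\sum_(i < d) P i i - k%:R).
  rewrite /D in DP; apply/grassmannianP; split.
  - apply/matrixP => i j; rewrite mxE; apply/eqP; rewrite -subr_eq0; apply/eqP.
    by apply: (z0 (fun i j => P j i - P i j)); lra.
  - apply/matrixP => i j; rewrite mxE; apply/eqP; rewrite -subr_eq0; apply/eqP.
    by apply: (z0 (fun i j => \sum_(l < d) P i l * P l j - P i j)); lra.
  - apply/eqP; rewrite -subr_eq0 -sqrf_eq0 eq_le h3 andbT.
    by rewrite /mxtrace; lra.
have mc i j : measurable_fun setT (fun P : borelT 'M[R]_d => P i j) by exact: measurable_coord.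
apply: measurable_fun_le_cst.
apply: measurable_funD; first apply: measurable_funD.
- by do 2 (apply: measurable_sum => ?); apply: measurable_funX; exact: measurable_funB.
- do 2 (apply: measurable_sum => ?); apply: measurable_funX; apply: measurable_funB => //.
  by apply: measurable_sum => l; exact: measurable_funM.
- apply: measurable_funX; apply: measurable_funB; last exact: measurable_cst.
  exact: measurable_sum.
Qed.

Lemma thin_set_rotate x y rho : enorm x = enorm y -> x != 0 ->
  gamma (thin_set x rho) = gamma (thin_set y rho).
Proof.
move=> xy x0.
(* The antipodal case left out by [rotation_transitive] is settled by the evenness of the norm. *)
have [->|yx] := eqVneq y (- x).
  by congr (gamma _); apply/seteqP; split => P /=; rewrite /thin_set/= mulNmx enormN.
have [Q rQ xQ] := rotation_transitive d0 xy x0 yx.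
rewrite -(rot rQ (measurable_thin_set x rho)); congr (gamma _).
apply/seteqP; split => P /=; rewrite /thin_set/= !mulmxA xQ (rotation_enorm _ rQ)//.
Qed.

Lemma transversality : exists2 c : R, 1 <= c & forall x rho, x != 0 -> 0 < rho ->
  (gamma (thin_set x rho) <= (Num.min 1 (c * (rho / enorm x) ^+ k))%:E)%E.
Proof.
pose a := (4 * d * d.+1).+1; pose c : R := a%:R ^+ d * 2 ^+ k.
have c1 : 1 <= c.
  by rewrite /c; apply: (@le_trans _ _ (1 * 1)); [rewrite mulr1|apply: ler_pM => //; rewrite exprn_ege1// ler1n].
exists c => // x rho x0 rho0; have nx0 := enorm_gt0 x0.
have c0 : 0 < c by apply: lt_le_trans c1.
pose sg := rho / enorm x; have sg0 : 0 < sg by rewrite divr_gt0.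
have p1 : (gamma (thin_set x rho) <= 1%:E)%E.
  by apply: probability_le1; exact: measurable_thin_set.
rewrite EFin_min le_min p1/= -/sg.
case: (leP 1 sg) => sg1.
  apply: (le_trans p1); rewrite lee_fin; apply: (le_trans c1).
  by rewrite ler_peMr ?(ltW c0)// exprn_ege1.
(* Then sg <= 1/M <= 2 sg: the first inequality places each rescaled thin set inside that of a grid
   point, the second turns the resulting M^(-k) into (2 sg)^k. *)
pose M := Num.truncn sg^-1.
have sV0 : 0 <= sg^-1 by rewrite invr_ge0 ltW.
have /andP[M1 M2] := truncn_bounds sV0; rewrite -/M in M1 M2.
have M0 : (0 < M)%N.
  rewrite lt0n; apply/eqP => M00; move: M2; rewrite M00 add0r invf_lt1//; lra.
have M0R : 0 < M%:R :> R by rewrite ltr0n.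
have sgM : sg <= M%:R^-1 by rewrite -[leLHS]invrK lef_pV2 ?posrE ?invr_gt0.
have Msg : M%:R^-1 <= 2 * sg.
  rewrite -[leLHS]mul1r ler_pdivrMr//.
  have M3 : 1 < (M%:R + 1) * sg by rewrite -ltr_pdivrMr// div1r.
  have M4 : 1 <= M%:R :> R by rewrite ler1n.
  have : 0 <= (M%:R - 1) * sg by rewrite mulr_ge0 ?subr_ge0// ltW.
  lra.
pose E (v : {ffun 'I_d -> 'I_M}) := thin_set (grid_point R v) (2 * d%:R / M%:R).
have thin_le v : (gamma (thin_set x rho) <= gamma (E v))%E.
  have g0 := @grid_enorm_gt0 R d M v d0.
  pose y := (enorm x / enorm (grid_point R v)) *: grid_point R v.
  have yx : enorm x = enorm y.
    by rewrite enormZ ger0_norm ?divr_ge0 ?enorm_ge0// divfK// gt_eqF.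
  rewrite (thin_set_rotate rho yx x0).
  apply: le_measure; rewrite ?inE; try exact: measurable_thin_set.
  move=> P; rewrite /E /thin_set/= -scalemxAl enormZ ger0_norm ?divr_ge0 ?enorm_ge0//.
  rewrite mulrAC ler_pdivrMr// mulrC -ler_pdivlMr// => h.
  apply: (le_trans h); rewrite mulrAC -/sg mulrC.
  by apply: ler_pM => //; [exact: enorm_ge0|exact: ltW|exact: grid_enorm_le].
have sum_le : (\sum_(v : {ffun 'I_d -> 'I_M}) gamma (E v) <= ((a ^ d * M ^ (d - k))%N)%:R%:E)%E.
  apply: (measure_sum_le_card _ measurable_grassmannian gG).
    by move=> v; exact: measurable_thin_set.
  move=> P gP; apply: leq_trans (grid_count gP M0).
  apply: eq_leq; apply: eq_card => v; rewrite !inE.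
  by apply/idP/idP => [/set_mem|h] //; apply/mem_set.
have fin : gamma (thin_set x rho) \is a fin_num by apply: fin_num_measure; exact: measurable_thin_set.
have : (\sum_(v : {ffun 'I_d -> 'I_M}) gamma (thin_set x rho) <= ((a ^ d * M ^ (d - k))%N)%:R%:E)%E.
  by apply: le_trans sum_le; apply: lee_sum => v _; exact: thin_le.
rewrite -(fineK fin) sumEFin !lee_fin sumr_const card_ffun !card_ord.
rewrite -[_ *+ (M ^ d)]mulr_natl natrX natrM !natrX.
have -> : M%:R ^+ d = M%:R ^+ (d - k) * M%:R ^+ k :> R by rewrite -exprD subnK.
have Mk0 : 0 < M%:R ^+ (d - k) :> R by rewrite exprn_gt0.
rewrite [X in _ <= X -> _]mulrC -mulrA ler_pM2l// -ler_pdivlMl ?exprn_gt0// => h.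
apply: (le_trans h); rewrite mulrC -exprVn /c -mulrA ler_pM2l ?exprn_gt0 ?ltr0n//.
rewrite -exprMn; apply: lerXn2r => //; rewrite nnegrE ?invr_ge0 ?ler0n//.
by rewrite mulr_ge0 ?(ltW sg0).
Qed.

End Transversality.

(** * Projected energies *)

Section ProjectedEnergy.
Variables (R : realType) (d k : nat).

(** The cutoff suits the covers: their members have diameter u <= r^theta, and the dyadic scale
    attached to such a u is at most 2u. *)
Definition scale_weight (s r theta : R) j : R :=
  if 2 ^+ j * r <= 2 * r `^ theta then (r / (2 ^+ j * r)) `^ s else 0.

(** Energy of the projected weight for a dyadic majorant, up to constants, of the truncated kernel
    (r/n)^s. Being a finite combination of indicators of thin sets, it is measurable in [P] and its
    mean is read off from their probabilities. *)
Definition proj_energy (s r theta : R) J N (x : nat -> 'rV[R]_d) (w : nat -> R)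
    (P : borelT 'M[R]_d) : R :=
  \sum_(i < N) \sum_(j < N) \sum_(l < J.+1)
    w i * w j * scale_weight s r theta l * \1_(thin_set (x i - x j) (2 ^+ l * r)) P.

Lemma scale_weight_ge0 s r theta j : 0 <= scale_weight s r theta j.
Proof. by rewrite /scale_weight; case: ifP => // _; exact: powR_ge0. Qed.

Lemma integral_coef_indic_le (dd : measure_display) (T : measurableType dd) (mu : {measure set T -> \bar R})
  (A : set T) (c p : R) : measurable A -> 0 <= c -> (mu A <= p%:E)%E ->
  (\int[mu]_y (c * \1_A y)%:E <= (c * p)%:E)%E.
Proof.
move=> mA c0 mp; under eq_integral do rewrite EFinM.
have mI : measurable_fun setT (fun y => (\1_A y)%:E : \bar R).
  by apply/measurable_EFinP; exact: measurable_indic.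
rewrite ge0_integralZl ?lee_fin//.
rewrite integral_indic// setIT EFinM; by apply: lee_wpmul2l; rewrite ?lee_fin.
Qed.

Lemma integral_sum_le (dd : measure_display) (T : measurableType dd) (mu : {measure set T -> \bar R})
  n (f : 'I_n -> T -> R) (b : 'I_n -> R) :
  (forall i, measurable_fun setT (f i)) -> (forall i y, 0 <= f i y) ->
  (forall i, (\int[mu]_y (f i y)%:E <= (b i)%:E)%E) ->
  (\int[mu]_y (\sum_(i < n) f i y)%:E <= (\sum_(i < n) b i)%:E)%E.
Proof.
move=> mf f0 fb; under eq_integral do rewrite -sumEFin.
rewrite ge0_integral_sum; [|by []|by move=> i; apply/measurable_EFinP; exact: mf|by move=> i y _; rewrite lee_fin].
by rewrite -sumEFin; apply: lee_sum => i _; exact: fb.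
Qed.

Lemma markov_le (dd : measure_display) (T : measurableType dd) (mu : {measure set T -> \bar R})
  (f : T -> R) (lam b : R) : measurable_fun setT f -> (forall y, 0 <= f y) -> 0 < lam ->
  (\int[mu]_y (f y)%:E <= b%:E)%E -> (mu (~` [set y | (f y <= lam)%R]) <= (b / lam)%:E)%E.
Proof.
move=> mf f0 lam0 fb; have mE : measurable (~` [set y | f y <= lam]).
  by apply: measurableC; exact: measurable_fun_le_cst.
have := @integral_step_ge R _ T mu (fun y => (f y)%:E) 1
  (fun i => if i == 0%N then ~` [set y | f y <= lam] else set0) (fun=> lam).
rewrite big_ord1/= => h.
rewrite mulrC EFinM lee_pdivlMl//; apply: le_trans fb; apply: h.
- by move=> i; case: ifP.
- move=> i j _ _ [y []]; case: eqP => [->|_]; case: eqP => [->|_] //.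
- by move=> _; exact: ltW.
- by move=> y; rewrite lee_fin.
- by move=> [|//] y _ /= /negP; rewrite -ltNge lee_fin => /ltW.
Qed.

Lemma measurable_proj_energy s r theta J N x w :
  measurable_fun setT (proj_energy s r theta J N x w).
Proof.
do 3 (apply: measurable_sum => ?).
apply: measurable_funM; first exact: measurable_cst.
by apply: measurable_indic; exact: measurable_thin_set.
Qed.

Lemma proj_energy_ge0 s r theta J N x w P : (forall i, 0 <= w i) ->
  0 <= proj_energy s r theta J N x w P.
Proof.
move=> w0; do 3 (apply: sumr_ge0 => ? _).
by rewrite !mulr_ge0// scale_weight_ge0.
Qed.

Lemma integral_proj_energy_le (gamma : probability (borelT 'M[R]_d) R) c s r theta J N x w :
  1 <= c -> (forall y rho, y != 0 -> 0 < rho ->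
    (gamma (thin_set y rho) <= (Num.min 1 (c * (rho / enorm y) ^+ k))%:E)%E) ->
  0 < r < 1 -> 0 < theta <= 1 -> 0 <= s <= k%:R -> (forall i, 0 <= w i) ->
  (\int[gamma]_P (proj_energy s r theta J N x w P)%:E <=
    (c * 2 ^+ k * J.+1%:R * denergy k s r theta N x w)%:E)%E.
Proof.
move=> c1 tr r01 th sk w0; have [r0 r1] := andP r01.
have c0 : 0 < c by apply: lt_le_trans c1.
have c2 : 1 <= c * 2 ^+ k by rewrite -[leLHS]mulr1 ler_pM// exprn_ege1// ler1n.
rewrite /denergy mulr_sumr; apply: integral_sum_le.
- move=> i; do 2 (apply: measurable_sum => ?).
  apply: measurable_funM; first exact: measurable_cst.
  by apply: measurable_indic; exact: measurable_thin_set.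
- by move=> i P; do 2 (apply: sumr_ge0 => ? _); rewrite !mulr_ge0// scale_weight_ge0.
move=> i; rewrite mulr_sumr; apply: integral_sum_le.
- move=> j; apply: measurable_sum => ?.
  apply: measurable_funM; first exact: measurable_cst.
  by apply: measurable_indic; exact: measurable_thin_set.
- by move=> j P; apply: sumr_ge0 => ? _; rewrite !mulr_ge0// scale_weight_ge0.
move=> j; set kn := kern k s r theta (enorm (x i - x j)).
have kn0 : 0 < kn by apply: kern_gt0 => //; exact: enorm_ge0.
have -> : c * 2 ^+ k * J.+1%:R * (w i * w j * kn) = \sum_(l < J.+1) w i * w j * (c * 2 ^+ k * kn).
  by rewrite sumr_const card_ord -[RHS]mulr_natl; ring.
apply: integral_sum_le.
- move=> l; apply: measurable_funM; first exact: measurable_cst.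
  by apply: measurable_indic; exact: measurable_thin_set.
- by move=> l P; rewrite !mulr_ge0// scale_weight_ge0.
move=> l; set rho := 2 ^+ l * r.
have rrho : r <= rho by rewrite ler_peMl ?(ltW r0)// exprn_ege1// ler1n.
have rho0 : 0 < rho by apply: lt_le_trans rrho.
have [p [mp lep]] : exists p, (gamma (thin_set (x i - x j) rho) <= p%:E)%E /\
    scale_weight s r theta l * p <= c * 2 ^+ k * kn.
  (* Coinciding points are outside the scope of transversality; there the kernel is 1 and the
     trivial probability bound suffices. *)
  have [z0|z0] := eqVneq (x i - x j) 0.
    exists 1; split; first by apply: probability_le1; exact: measurable_thin_set.
    have -> : kn = 1 by rewrite /kn z0 enorm0 kern_lt.
    rewrite !mulr1; apply: le_trans c2; rewrite /scale_weight; case: ifP => // _.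
    rewrite -/rho -(expR_lnM s (divr_gt0 r0 rho0)) -[leRHS]expR0 ler_expR.
    by rewrite mulr_ge0_le0//; [case/andP: sk|rewrite ln_le0// ler_pdivrMr// mul1r].
  exists (Num.min 1 (c * (rho / enorm (x i - x j)) ^+ k)); split; first exact: tr.
  rewrite /scale_weight -/rho; case: ifP => [rt|_]; last by rewrite mul0r mulr_ge0 ?(ltW kn0)// (le_trans _ c2).
  by apply: kern_transversal => //; exact: enorm_gt0.
apply: le_trans (integral_coef_indic_le _ _ mp) _.
- exact: measurable_thin_set.
- by rewrite !mulr_ge0// scale_weight_ge0.
- by rewrite lee_fin -mulrA ler_wpM2l// mulr_ge0.
Qed.

(* Cauchy-Schwarz in the form [1 <= T * \sum_v (m v)^2 / b v] with [T = \sum_v b v]. *)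
Lemma cauchy_weights n (m b : 'I_n -> R) : (forall v, 0 < b v) -> \sum_v m v = 1 ->
  1 <= (\sum_v b v) * (\sum_v m v ^+ 2 / b v).
Proof.
move=> b0 m1; set T := \sum_v b v.
have T0 : 0 < T.
  have [v _] : exists v : 'I_n, true.
    case: n m b b0 m1 @T => [|n] m b b0 m1 T; last by exists ord0.
    by move: m1; rewrite big_ord0 => /eqP; rewrite eq_sym oner_eq0.
  by rewrite /T (bigD1 v)//= ltr_pwDl// sumr_ge0// => u _; exact: ltW.
have le v : m v <= (T * (m v ^+ 2 / b v) + b v / T) / 2.
  have h : 0 <= (T * m v - b v) ^+ 2 / (T * b v) by rewrite divr_ge0 ?sqr_ge0// mulr_ge0 ?ltW.
  have E : (T * m v - b v) ^+ 2 / (T * b v) = T * (m v ^+ 2 / b v) + b v / T - 2 * m v.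
    by field; rewrite !gt_eqF.
  by rewrite E in h; lra.
have : \sum_v m v <= \sum_v (T * (m v ^+ 2 / b v) + b v / T) / 2 by apply: ler_sum => v _; exact: le.
rewrite m1 -mulr_suml big_split/= -mulr_sumr -mulr_suml -/T divff ?gt_eqF//; lra.
Qed.

(** Two points charged to the same member of diameter u project within distance u, so some scale of
    size at most 2u contributes at least (r/2u)^s. Hence the energy dominates the sum of m(V)^2 /
    b(V), m being the charged mass and b(V) = (2u/r)^s, and [cauchy_weights] applies. *)
Lemma proj_energy_cover (X : set 'rV[R]_d) s r theta J N x w (A : 'M[R]_(k, d)) P U lam :
  config X N x w -> 0 < r < 1 -> 0 < theta <= 1 -> 0 <= s -> 1 <= 2 ^+ J * r ->
  frame_of A P -> proj_energy s r theta J N x w P <= lam ->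
  (forall z, proj_coords A X z -> exists2 V, V \in U & V z) ->
  (forall V : set 'rV[R]_k, V \in U ->
    ((r / 2)%:E <= ediam V)%E /\ (ediam V <= (r `^ theta)%:E)%E) ->
  1 <= (\sum_(V <- U) (2 * fine (ediam V) / r) `^ s) * lam.
Proof.
move=> [Xx w0 w1] r01 th s0 rJ fA Glam cU dU; have [r0 r1] := andP r01.
pose y i := x i *m A^T.
(* Members may overlap; charging each point to the first one that contains it makes the masses add
   up to 1. *)
pose idx i := find (fun V : set 'rV[R]_k => `[< V (y i) >]) U.
have idxP i : (i < N)%N -> (idx i < size U)%N /\ nth set0 U (idx i) (y i).
  move=> iN; have : has (fun V : set 'rV[R]_k => `[< V (y i) >]) U.
    by have [|V VU Vy] := cU (y i); [exists (x i) => //; exact: Xx|apply/hasP; exists V => //; apply/asboolP].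
  by move=> h; split; [rewrite -has_find|apply/asboolP; exact: nth_find h].
pose u v := fine (ediam (nth set0 U v)).
have uP v : (v < size U)%N -> r / 2 <= u v <= r `^ theta.
  move=> vU; have [h1 h2] := dU _ (mem_nth set0 vU); rewrite /u.
  by move: h1 h2; case: (ediam _) => [e| |]//=; rewrite !lee_fin => -> ->.
have u0 v : (v < size U)%N -> 0 < u v by move=> /uP/andP[h _]; apply: lt_le_trans h; rewrite divr_gt0.
pose m (v : 'I_(size U)) := \sum_(i < N) w i * (idx i == v)%:R.
pose b (v : 'I_(size U)) := (2 * u v / r) `^ s.
have b0 v : 0 < b v by rewrite powR_gt0// divr_gt0// mulr_gt0// u0.
have m1 : \sum_v m v = 1.
  rewrite -w1 exchange_big/=; apply: eq_bigr => i _.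
  have [iU _] := idxP i (ltn_ord i).
  rewrite (bigD1 (Ordinal iU))//= eqxx mulr1 big1 ?addr0// => v vi.
  case: eqP => [e|_]; last by rewrite mulr0.
  by move: vi; rewrite -(inj_eq val_inj)/= -e eqxx.
have -> : \sum_(V <- U) (2 * fine (ediam V) / r) `^ s = \sum_v b v.
  by rewrite (big_nth set0) big_mkord.
apply: (le_trans (cauchy_weights b0 m1)); apply: ler_wpM2l.
  by apply: sumr_ge0 => v _; exact: ltW.
apply: le_trans Glam.
have r1' : r `^ theta <= 1.
  have [th0 th1] := andP th; have lr : ln r < 0 by rewrite ln_lt0.
  by rewrite -(expR_lnM _ r0) -[leRHS]expR0 ler_expR; nra.
have pair_lb (i j : 'I_N) v : (v < size U)%N -> idx i = v -> idx j = v ->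
    ((2 * u v / r) `^ s)^-1 <= \sum_(l < J.+1) scale_weight s r theta l * \1_(thin_set (x i - x j) (2 ^+ l * r)) P.
  move=> vU iv jv; have [_ Vi] := idxP i (ltn_ord i); have [_ Vj] := idxP j (ltn_ord j).
  rewrite iv in Vi; rewrite jv in Vj.
  have [_ h2] := dU _ (mem_nth set0 vU).
  have zu : enorm ((x i - x j) *m P) <= u v.
    by rewrite -(frame_enormE _ fA) mulmxBl; exact: enorm_le_ediam h2 Vi Vj.
  have /andP[u1 u2] := uP v vU; have uu0 := u0 v vU.
  have [|l lJ [l1 l2]] := @dyadic_scale R r (u v) J r0; first by apply: (le_trans u2); apply: le_trans rJ.
  (* If the scale is r itself, the lower bound r/2 on diameters is what is used. *)
  have l3 : 2 ^+ l * r <= 2 * u v.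
    by move: l2; rewrite le_max => /orP[h|//]; apply: (le_trans h); lra.
  rewrite (bigD1 (inord l : 'I_J.+1))//= inordK//.
  have -> : \1_(thin_set (x i - x j) (2 ^+ l * r)) P = 1 :> R.
    by rewrite indicE mem_set//; exact: le_trans zu l1.
  rewrite mulr1 /scale_weight ifT; last by apply: (le_trans l3); rewrite ler_pM2l.
  rewrite ler_wpDr//; first by apply: sumr_ge0 => l' _; rewrite mulr_ge0// scale_weight_ge0.
  have u20 : 0 < 2 * u v by rewrite mulr_gt0.
  have l0 : 0 < 2 ^+ l * r by rewrite mulr_gt0// exprn_gt0.
  rewrite -(expR_lnM s (divr_gt0 u20 r0)) -expRN -(expR_lnM s (divr_gt0 r0 l0)) ler_expR.
  by rewrite -mulrN !ln_div ?posrE// opprB ler_wpM2l// lerB// ler_ln.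
rewrite /proj_energy.
apply: (@le_trans _ _ (\sum_v \sum_(i < N) \sum_(j < N) (w i * w j / b v) * ((idx i == v)%:R * (idx j == v)%:R))).
  apply: ler_sum => v _; rewrite le_eqVlt; apply/orP; left; apply/eqP.
  rewrite expr2 {1}/m mulr_suml mulr_suml; apply: eq_bigr => i _.
  rewrite /m mulr_sumr mulr_suml; apply: eq_bigr => j _; ring.
rewrite exchange_big/=; apply: ler_sum => i _; rewrite exchange_big/=; apply: ler_sum => j _.
have [iU _] := idxP i (ltn_ord i).
rewrite (bigD1 (Ordinal iU))//= eqxx mul1r big1 ?addr0; last first.
  move=> v vi; case: eqP => [e|_]; last by rewrite mul0r mulr0.
  by move: vi; rewrite -(inj_eq val_inj)/= -e eqxx.
under eq_bigr do rewrite -mulrA.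
rewrite -mulr_sumr -mulrA ler_wpM2l ?mulr_ge0//.
case: eqP => [ji|_]; last by rewrite mulr0 sumr_ge0// => l _; rewrite mulr_ge0// scale_weight_ge0.
by rewrite mulr1; exact: pair_lb.
Qed.

End ProjectedEnergy.

(** * Almost every projection *)

Lemma geometric_nneseries_lty (R : realType) (a : nat -> \bar R) (C q : R) :
  0 <= C -> 0 < q < 1 -> (forall n, 0 <= a n)%E -> (forall n, (a n <= (C * q ^+ n)%:E)%E) ->
  (\sum_(0 <= n <oo) a n < +oo)%E.
Proof.
move=> C0 /andP[q0 q1] a0 aC.
have tel n : \sum_(0 <= i < n) C * q ^+ i + C / (1 - q) * q ^+ n = C / (1 - q).
  elim: n => [|n IH]; first by rewrite big_nil expr0 mulr1 add0r.
  rewrite big_nat_recr//= -{2}IH exprS; field.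
  by rewrite gt_eqF// subr_gt0.
apply: (@le_lt_trans _ _ (C / (1 - q))%:E); last exact: ltry.
apply: lime_le; first by apply: is_cvg_nneseries => n _ _; exact: a0.
apply: nearW => n; apply: (@le_trans _ _ (\sum_(0 <= i < n) (C * q ^+ i)%:E)%E).
  by apply: lee_sum => i _; exact: aC.
rewrite sumEFin lee_fin -(tel n) lerDl mulr_ge0// ?exprn_ge0 ?(ltW q0)//.
by rewrite divr_ge0// subr_ge0 ltW.
Qed.

Lemma half_pow_small (R : realType) (e : R) : 0 < e -> exists J : nat, (2^-1) ^+ J <= e.
Proof.
move=> e0; pose e' := Num.min e 2^-1.
have e'01 : 0 < e' < 1 by rewrite lt_min e0 invr_gt0 ltr0n/= gt_min invf_lt1 ?ltr1n ?orbT.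
have [c _ /(_ e' e'01)[J h _]] := @dyadic_count R 1 1 (lexx 1) ltr01.
exists J; apply: (@le_trans _ _ e'); last by rewrite ge_min lexx.
by rewrite exprVn -[leLHS]mulr1 ler_pdivrMl ?exprn_gt0.
Qed.

Lemma theta_cover_ok_mono (R : realType) m (Y : set 'rV[R]_m) (q theta r s e : R) :
  0 < q -> q <= theta -> 0 < r <= 1 -> theta_cover_ok Y theta r s e -> theta_cover_ok Y q r s e.
Proof.
move=> q0 qt /andP[r0 r1] [U [cU [dU sU]]]; exists U; split=> //; split=> // V /dU[h1 h2].
split=> //; apply: le_trans h1; rewrite lee_fin -!(expR_lnM _ r0) ler_expR.
by rewrite ler_wnM2r ?ln_le0// lef_pV2 ?posrE// (lt_le_trans q0).
Qed.

Section AlmostSure.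
Variables (R : realType) (d k : nat) (X : set 'rV[R]_d) (Lb : R).
Hypotheses (d0 : (0 < d)%N) (kd : (k <= d)%N) (X0 : X !=set0) (L1 : 1 <= Lb)
  (XL : forall y : 'rV[R]_d, closure X y -> enorm y <= Lb).
Variable gamma : probability (borelT 'M[R]_d) R.
Hypotheses (rot : rotation_invariant gamma) (gG : gamma (~` [set P | grassmannian k P]) = 0%E).

Lemma config_of_capacity s r theta e : 0 < r < 1 -> 0 < theta <= 1 -> 0 <= s <= k%:R ->
  s - e < log_capacity k X s theta r ->
  exists N x w, config X N x w /\ denergy k s r theta N x w <= 2 * 5 ^+ k * r `^ (s - e).
Proof.
move=> r01 th sk lt; have [r0 r1] := andP r01.
have K0 := dinf_gt0 X0 L1 XL r01 th sk; have C0 := capacity_gt0 d0 X0 L1 XL r01 th sk.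
have /andP[_ ub] := capacity_bounds X0 L1 XL r01 th sk d0.
have lr : ln r < 0 by rewrite ln_lt0.
(* The infimum itself serves as slack, whence the factor 2; 5^k comes from [capacity_bounds]. *)
have [N [x [w [cf le]]]] := dinf_approx k s theta X0 r01 K0.
exists N, x, w; split=> //; apply: (le_trans (ltW le)).
move: K0 C0 ub lt {le}; rewrite /log_capacity.
move: (dinf k s r theta X) (capacity k s r theta X) => K C K0 C0 ub lt.
have Clb : r `^ (- (s - e)) <= C.
  rewrite -(expR_lnM _ r0) -[leRHS]lnK ?posrE// ler_expR.
  by move: lt; rewrite ltr_pdivlMr; lra.
have p0 : 0 < r `^ (s - e) by rewrite powR_gt0.
have : r `^ (- (s - e)) <= 5 ^+ k / K by apply: le_trans ub.
rewrite powRN ler_pdivlMr// ler_pdivrMl//; lra.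
Qed.

(** Probability enters only through the projected energies along [r_]. Once these are small from
    some index on, the argument is deterministic, so a single null set serves all frames, all
    exponents [sg] and all radii within a factor 2 below some [r_ n]. *)
Lemma ae_no_cover q s eta (r_ : nat -> R) : 0 < q <= 1 -> 0 <= s <= k%:R -> 0 < eta ->
  (forall n, 0 < r_ n <= (2^-1) ^+ n.+1) -> (forall n, s - eta < log_capacity k X s q (r_ n)) ->
  gamma.-negligible (~` [set P | forall A : 'M[R]_(k, d), frame_of A (P : 'M[R]_d) ->
    exists n0, forall n, (n0 <= n)%N -> forall r, r_ n / 2 <= r <= r_ n ->
    forall sg, 0 <= sg -> 2 * eta <= q * (s - sg) ->
    ~ theta_cover_ok (proj_coords A X) q (r `^ q) sg (2 ^- k.+1)]).
Proof.
move=> hq sk eta0 hr hcap; have [q0 q1] := andP hq; have [s0 sk'] := andP sk.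
have r01 n : 0 < r_ n < 1.
  have /andP[h1 h2] := hr n; rewrite h1; apply: (le_lt_trans h2).
  by rewrite exprn_ilt1// ?invr_ge0 ?invf_lt1 ?ltr1n.
have r0 n : 0 < r_ n by case/andP: (r01 n).
have lr n : ln (r_ n) < 0 by rewrite ln_lt0.
have /choice[cfg Hcfg] : forall n, exists f : nat * (nat -> 'rV[R]_d) * (nat -> R),
  config X f.1.1 f.1.2 f.2 /\ denergy k s (r_ n) q f.1.1 f.1.2 f.2 <= 2 * 5 ^+ k * r_ n `^ (s - eta).
  move=> n; have [N [x [w h]]] := config_of_capacity (r01 n) hq sk (hcap n).
  by exists (N, x, w).
have D1 : 1 <= 2 * Lb by move: L1; lra.
have [c' c'0 Hc'] := @dyadic_count R (2 * Lb) (eta / 2) D1 (ltac:(lra)).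
have /choice[J HJ] : forall n, exists J : nat, 2 * Lb <= 2 ^+ J * r_ n /\ J.+1%:R <= c' * r_ n `^ (- (eta / 2)).
  by move=> n; have [J h1 h2] := Hc' (r_ n) (r01 n); exists J.
have [c c1 Hc] := transversality d0 kd rot gG.
have c0 : 0 < c by apply: lt_le_trans c1.
(* The mean energy is of order r_n^(s - eta - eta/2), the last eta/2 being spent on the number of
   scales. Markov at this threshold leaves r_n^(eta/2), at most rho^n, which is summable. *)
pose lam n := r_ n `^ (s - 2 * eta).
have lam0 n : 0 < lam n by rewrite powR_gt0.
pose PE n := proj_energy s (r_ n) q (J n) (cfg n).1.1 (cfg n).1.2 (cfg n).2.
pose Bad n : set (borelT 'M[R]_d) := ~` [set P | PE n P <= lam n].
have mBad n : measurable (Bad n).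
  by apply: measurableC; apply: measurable_fun_le_cst; exact: measurable_proj_energy.
pose C := c * 2 ^+ k * c' * (2 * 5 ^+ k).
have C0 : 0 <= C by rewrite /C !mulr_ge0 ?exprn_ge0 ?(ltW c0) ?(ltW c'0).
pose rho : R := 2^-1 `^ (eta / 2).
have h0 : 0 < 2^-1 :> R by rewrite invr_gt0.
have l2 : 0 < ln 2 :> R by rewrite ln_gt0// ltr1n.
have rho01 : 0 < rho < 1.
  rewrite /rho powR_gt0//= -(expR_lnM _ h0) -[ltRHS]expR0 ltr_expR lnV ?posrE//; nra.
have [rho0 rho1] := andP rho01.
have Bad_le n : (gamma (Bad n) <= (C * rho ^+ n)%:E)%E.
  have [[_ w0 _] den] := Hcfg n; have [_ Jn] := HJ n.
  have int := @integral_proj_energy_le R d k gamma c s (r_ n) q (J n) (cfg n).1.1 (cfg n).1.2 (cfg n).2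
    c1 Hc (r01 n) hq sk w0.
  apply: le_trans (markov_le _ _ (lam0 n) int) _.
  - exact: measurable_proj_energy.
  - by move=> P; exact: proj_energy_ge0.
  rewrite lee_fin ler_pdivrMr//.
  apply: (@le_trans _ _ (c * 2 ^+ k * (c' * r_ n `^ (- (eta / 2))) * (2 * 5 ^+ k * r_ n `^ (s - eta)))).
    have cc0 : 0 <= c * 2 ^+ k by rewrite mulr_ge0 ?exprn_ge0// ltW.
    apply: ler_pM => //; last by rewrite ler_wpM2l.
      by rewrite mulr_ge0.
    by do 2 (apply: sumr_ge0 => ? _); rewrite !mulr_ge0// ltW// kern_gt0// enorm_ge0.
  have -> : c * 2 ^+ k * (c' * r_ n `^ (- (eta / 2))) * (2 * 5 ^+ k * r_ n `^ (s - eta)) =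
    C * (r_ n `^ (- (eta / 2)) * r_ n `^ (s - eta)) by rewrite /C; ring.
  rewrite -[leRHS]mulrA ler_wpM2l//.
  have -> : rho ^+ n = expR (n%:R * (eta / 2 * - ln 2)).
    by rewrite expRM_natl /rho -(expR_lnM _ h0) lnV ?posrE.
  rewrite /lam -!(expR_lnM _ (r0 n)) -!expRD ler_expR.
  have : ln (r_ n) <= n.+1%:R * - ln 2.
    have /andP[_ h] := hr n; rewrite -lnV ?posrE// -ln_powR powR_mulrn ?(ltW h0)//.
    by rewrite ler_ln ?posrE ?exprn_gt0.
  rewrite -natr1; have : 0 <= n%:R :> R by [].
  nra.
have negl : gamma (lim_sup_set Bad) = 0%E.
  apply: lim_sup_set_cvg0 => //.
  by apply: (@geometric_nneseries_lty R _ C rho) => //.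
exists (lim_sup_set Bad); split => //.
  by apply: bigcap_measurable => // n _; apply: bigcup_measurable => j _.
move=> P /= nP; apply: contrapT => nlim; apply: nP => A fA.
have [n0 Hn0] : exists n0, forall n, (n0 <= n)%N -> PE n P <= lam n.
  apply: contrapT => nex; apply: nlim => n _; apply: contrapT => nb; apply: nex.
  exists n => j nj; apply: contrapT => h; apply: nb; exists j => //.
exists n0 => n nn r /andP[rr1 rr2] sg sg0 heta [U [/bigcup_nthP cU [dU sU]]].
have rn0 := r0 n; have rr0 : 0 < r by apply: lt_le_trans rr1; rewrite divr_gt0.
have [LJ _] := HJ n; have [cf _] := Hcfg n.
have rq : r `^ q <= r_ n `^ q by rewrite ge0_ler_powR ?nnegrE// ltW.
have dV V : V \in U -> r <= fine (ediam V) <= r `^ q /\ ediam V = (fine (ediam V))%:E.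
  move=> /dU; rewrite -powRrM mulfV ?gt_eqF// powRr1 ?(ltW rr0)//.
  by case: (ediam V) => [e| |]; rewrite ?lee_fin//= => -[] // -> ->.
have := @proj_energy_cover R d k X s (r_ n) q (J n) _ _ _ A P U (lam n) cf (r01 n) hq s0
  (le_trans D1 LJ) fA (Hn0 n nn) cU.
have dV' V : V \in U -> ((r_ n / 2)%:E <= ediam V)%E /\ (ediam V <= (r_ n `^ q)%:E)%E.
  by move=> /dV[/andP[h1 h2] ->]; rewrite !lee_fin; split; lra.
move=> /(_ dV'); apply/negP; rewrite -ltNge.
(* As the diameter u is at most r_n^q, u^s <= u^sg r_n^(q (s - sg)) <= u^sg r_n^(2 eta). The powers
   of r_n then cancel against [lam], so every such cover costs at least 2^(-k), twice the value
   excluded in the statement. *)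
have key V : V \in U -> (2 * fine (ediam V) / r_ n) `^ s <=
    2 ^+ k * (r_ n `^ (- s + 2 * eta)) * (fine (ediam V) `^ sg).
  move=> /dV[/andP[h1 h2] _]; move: (fine _) h1 h2 => u h1 h2.
  have u0 : 0 < u by apply: lt_le_trans h1.
  have u20 : 0 < 2 * u by rewrite mulr_gt0.
  rewrite -(powR_mulrn k (ler0n _ 2)) -(expR_lnM s (divr_gt0 u20 rn0)) -!expR_lnM// -!expRD ler_expR.
  rewrite ln_div ?posrE// lnM ?posrE//.
  have lu : ln u <= q * ln (r_ n).
    by rewrite -ln_powR ler_ln ?posrE ?powR_gt0//; apply: le_trans rq.
  have ssg : 0 <= s - sg.
    by rewrite -(pmulr_rge0 _ q0); apply: le_trans heta; rewrite mulr_ge0// ltW.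
  have e1 : (s - sg) * ln u <= (s - sg) * (q * ln (r_ n)) by rewrite ler_wpM2l.
  have e2 : q * (s - sg) * ln (r_ n) <= 2 * eta * ln (r_ n) by rewrite ler_wnM2r// ltW.
  have e3 : s * ln 2 <= k%:R * ln 2 by rewrite ler_wpM2r// ltW.
  lra.
apply: (@le_lt_trans _ _ (\sum_(V <- U) 2 ^+ k * (r_ n `^ (- s + 2 * eta)) * (fine (ediam V) `^ sg) * lam n)).
  rewrite mulr_suml big_seq [leRHS]big_seq; apply: ler_sum => V VU.
  by rewrite ler_wpM2r ?(ltW (lam0 n))// key.
have E : r_ n `^ (- s + 2 * eta) * lam n = 1.
  rewrite /lam -powRD ?(gt_eqF rn0) ?implybT//.
  have -> : - s + 2 * eta + (s - 2 * eta) = 0 by ring.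
  exact: powRr0.
rewrite (eq_bigr (fun V => 2 ^+ k * (fine (ediam V)) `^ sg)); last first.
  by move=> V _; rewrite mulrAC -[2 ^+ k * _ * _]mulrA E mulr1.
rewrite -mulr_sumr; apply: (@le_lt_trans _ _ (2 ^+ k * 2 ^- k.+1)).
  by rewrite ler_pM2l ?exprn_gt0.
by rewrite exprS invfM mulrCA divff ?mulr1 ?invf_lt1 ?ltr1n// gt_eqF// exprn_gt0.
Qed.

Definition lower_admissible m (theta : R) (Y : set 'rV[R]_m) (s : R) :=
  forall eps, 0 < eps -> forall r0, 0 < r0 ->
    exists r, 0 < r <= r0 /\ theta_cover_ok Y theta r s eps.

Definition upper_admissible m (theta : R) (Y : set 'rV[R]_m) (s : R) :=
  forall eps, 0 < eps -> exists r0, 0 < r0 /\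
    forall r, 0 < r <= r0 -> theta_cover_ok Y theta r s eps.

(** A lower limit bounds the capacity at every small radius, so the radii can be powers of 1/2.
    Admissibility yields a cover at some uncontrolled small radius, which lies within a factor 2 of
    one of them. *)
Lemma ae_lower_admissible q s eta : 0 < q <= 1 -> 0 < eta ->
  is_profile k X (@liminf0 R) q s ->
  gamma.-negligible (~` [set P | forall A : 'M[R]_(k, d), frame_of A (P : 'M[R]_d) ->
    forall sg, 0 <= sg -> 2 * eta <= q * (s - sg) -> ~ lower_admissible q (proj_coords A X) sg]).
Proof.
move=> hq eta0 [sk Ls]; have [q0 q1] := andP hq.
have [dl dl0 Hdl] := liminf0_eventually_gt Ls eta0.
have [J HJ] := half_pow_small dl0.
have h0 : 0 < 2^-1 :> R by rewrite invr_gt0.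
have h1 : 2^-1 < 1 :> R by rewrite invf_lt1 ?ltr1n.
pose r_ n : R := (2^-1) ^+ (n.+1 + J).
have r0 n : 0 < r_ n by rewrite exprn_gt0.
have hr n : 0 < r_ n <= (2^-1) ^+ n.+1.
  by rewrite r0 /r_ exprD ler_piMr ?exprn_ge0 ?(ltW h0)// exprn_ile1 ?(ltW h0) ?(ltW h1).
have hcap n : s - eta < log_capacity k X s q (r_ n).
  apply: Hdl => //; apply: lt_le_trans HJ; rewrite /r_ exprD gtr_pMl ?exprn_gt0//.
  by rewrite exprn_ilt1// ltW.
apply: negligibleS (ae_no_cover hq sk eta0 hr hcap).
apply: subsetC => P H A fA sg sg0 hsg adm.
have [n0 Hn0] := H A fA.
pose c := r_ n0 / 2; have c0 : 0 < c by rewrite divr_gt0.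
have e0 : 0 < 2 ^- k.+1 :> R by rewrite invr_gt0 exprn_gt0.
have [r [/andP[rr0 rc] ok]] := adm _ e0 _ (powR_gt0 q c0).
pose t := r `^ q^-1; have t0 : 0 < t by rewrite powR_gt0.
have tE : t `^ q = r by rewrite -powRrM mulVf ?gt_eqF// powRr1// ltW.
have tc : t <= c.
  have : t <= (c `^ q) `^ q^-1 by rewrite ge0_ler_powR ?nnegrE ?powR_ge0 ?invr_ge0// ltW.
  by rewrite -powRrM mulfV ?gt_eqF// powRr1// ltW.
have c1 : c <= 1.
  have /andP[_ h] := hr n0; rewrite /c ler_pdivrMr// mul1r; apply: (le_trans h).
  by apply: (@le_trans _ _ 1); [rewrite exprn_ile1 ?(ltW h0) ?(ltW h1)|rewrite ler1n].
have [J' HJ'] := half_pow_small t0.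
have cJ : c <= 2 ^+ J' * t.
  by apply: (le_trans c1); move: HJ'; rewrite exprVn -[leLHS]mulr1 ler_pdivrMl ?exprn_gt0.
(* With c half of [r_ n0], the bounds c <= 2^j t <= 2c say that t lies between half of [r_ (n0 + j)]
   and [r_ (n0 + j)]. *)
have [j _ [j1 j2]] := dyadic_scale t0 cJ.
have {}j2 : 2 ^+ j * t <= 2 * c by move: j2; rewrite le_max => /orP[h|//]; apply: (le_trans h); lra.
apply: (Hn0 (n0 + j)%N (leq_addr _ _) t _ sg sg0 hsg); last by rewrite tE.
have rE : r_ (n0 + j)%N = r_ n0 / 2 ^+ j.
  have -> : r_ (n0 + j)%N = (2^-1) ^+ ((n0.+1 + J) + j) by rewrite /r_ addnAC addSn.
  by rewrite exprD; congr (_ * _); rewrite exprVn.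
have p2 : 0 < 2 ^+ j :> R by rewrite exprn_gt0.
rewrite rE; apply/andP; split.
  by rewrite mulrAC ler_pdivrMr// -/c mulrC.
by rewrite ler_pdivlMr// mulrC; apply: (le_trans j2); rewrite /c; lra.
Qed.

(** The roles are exchanged: the capacity is controlled only along a sequence of radii, chosen
    sparse enough for summability, while admissibility gives covers at all small radii, in
    particular at these. *)
Lemma ae_upper_admissible q s eta : 0 < q <= 1 -> 0 < eta ->
  is_profile k X (@limsup0 R) q s ->
  gamma.-negligible (~` [set P | forall A : 'M[R]_(k, d), frame_of A (P : 'M[R]_d) ->
    forall sg, 0 <= sg -> 2 * eta <= q * (s - sg) -> ~ upper_admissible q (proj_coords A X) sg]).
Proof.
move=> hq eta0 [sk Ls]; have [q0 q1] := andP hq.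
have h0 : 0 < 2^-1 :> R by rewrite invr_gt0.
have h1 : 2^-1 < 1 :> R by rewrite invf_lt1 ?ltr1n.
have /choice[r_ Hr] : forall n, exists r, [/\ 0 < r, r < (2^-1) ^+ n.+1 & s - eta < log_capacity k X s q r].
  by move=> n; apply: (limsup0_frequently_gt Ls eta0); rewrite exprn_gt0.
have hr n : 0 < r_ n <= (2^-1) ^+ n.+1 by have [-> /ltW -> _] := Hr n.
have hcap n : s - eta < log_capacity k X s q (r_ n) by have [] := Hr n.
apply: negligibleS (ae_no_cover hq sk eta0 hr hcap).
apply: subsetC => P H A fA sg sg0 hsg adm.
have [n0 Hn0] := H A fA.
have e0 : 0 < 2 ^- k.+1 :> R by rewrite invr_gt0 exprn_gt0.
have [r0 [r00 Hr0]] := adm _ e0.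
have [J HJ] := half_pow_small (powR_gt0 q^-1 r00).
pose n := maxn n0 J; have /andP[rn0 rn1] := hr n.
apply: (Hn0 n (leq_maxl _ _) (r_ n) _ sg sg0 hsg); first by apply/andP; split; lra.
apply: Hr0; rewrite powR_gt0//=.
have : r_ n `^ q <= (r0 `^ q^-1) `^ q.
  rewrite ge0_ler_powR ?nnegrE ?powR_ge0 ?(ltW q0) ?(ltW rn0)//.
  apply: le_trans HJ; apply: (le_trans rn1).
  by apply: ler_wiXn2l; rewrite ?(ltW h0) ?(ltW h1)// leqW// leq_maxr.
by rewrite -powRrM mulVf ?gt_eqF// powRr1// ltW.
Qed.

(** * One null set for all theta, for the lower and upper dimensions at once *)

Section AllTheta.
Variables (L : (R -> R) -> \bar R) (prof : R -> R).
Variable adm : R -> set 'rV[R]_k -> R -> Prop.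
Hypothesis Lle : forall f g (c : R),
  (forall e, 0 < e -> exists2 dl, 0 < dl & forall r, 0 < r -> r < dl -> f r <= g r + c + e) ->
  (L f <= L g + c%:E)%E.
Hypothesis Hprof : forall theta, 0 < theta <= 1 -> is_profile k X L theta (prof theta).
Hypothesis adm_mono : forall q theta Y s, 0 < q -> q <= theta -> adm theta Y s -> adm q Y s.
Hypothesis ae_adm : forall q s eta, 0 < q <= 1 -> 0 < eta -> is_profile k X L q s ->
  gamma.-negligible (~` [set P | forall A : 'M[R]_(k, d), frame_of A (P : 'M[R]_d) ->
    forall sg, 0 <= sg -> 2 * eta <= q * (s - sg) -> ~ adm q (proj_coords A X) sg]).

(** The null set is a countable union over rational q = a/(b+1) and eta = 1/(m+1). An exponent
    admissible at theta is admissible at every smaller q, and a q close enough below theta has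
    almost as large a profile. *)
Lemma ae_profile_le :
  gamma.-negligible (~` [set P | forall A : 'M[R]_(k, d), frame_of A (P : 'M[R]_d) ->
    forall theta sg, 0 < theta <= 1 -> 0 <= sg -> adm theta (proj_coords A X) sg ->
    prof theta <= sg]).
Proof.
pose Q (a b : nat) : R := a%:R / b.+1%:R.
pose good a b m (P : borelT 'M[R]_d) := 0 < Q a b <= 1 ->
  forall A : 'M[R]_(k, d), frame_of A (P : 'M[R]_d) ->
    forall sg, 0 <= sg -> 2 * m.+1%:R^-1 <= Q a b * (prof (Q a b) - sg) -> ~ adm (Q a b) (proj_coords A X) sg.
have ng a b m : gamma.-negligible (~` [set P | good a b m P]).
  have [hQ|nQ] := pselect (0 < Q a b <= 1).
    have e0 : 0 < m.+1%:R^-1 :> R by rewrite invr_gt0.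
    apply: negligibleS (ae_adm hQ e0 (Hprof hQ)).
    by apply: subsetC => P H _.
  rewrite (_ : ~` _ = set0); first exact: negligible_set0.
  by apply/seteqP; split => // P; apply => /nQ.
have nall : gamma.-negligible (\bigcup_a \bigcup_b \bigcup_m ~` [set P | good a b m P]).
  by do 3 (apply: negligible_bigcup => ?); exact: ng.
apply: negligibleS nall => P nP; apply: contrapT => nU; apply: nP => A fA theta sg th sg0 ad.
have G a b m : good a b m P.
  by apply: contrapT => ng'; apply: nU; exists a => //; exists b => //; exists m.
rewrite leNgt; apply/negP => lt; have [th0 th1] := andP th.
pose g := prof theta - sg; have g0 : 0 < g by rewrite subr_gt0.
(* The first term keeps q above theta/2. With the second, (theta - q) k <= g theta/4 <= g q/2, so
   passing from theta to q loses at most half of the gap g. *)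
pose e := Num.min (theta / 2) (g * theta / (4 * k.+1%:R)).
have e0 : 0 < e by rewrite lt_min !divr_gt0 ?mulr_gt0.
pose b := Num.truncn e^-1.
have b1 : (b.+1%:R)^-1 < e :> R.
  have eV : 0 <= e^-1 by rewrite invr_ge0 ltW.
  have /andP[_ h] := truncn_bounds eV.
  by rewrite -[ltRHS]invrK ltf_pV2 ?posrE ?invr_gt0// -natr1.
pose a := Num.truncn (theta * b.+1%:R).
have tb0 : 0 <= theta * b.+1%:R by rewrite mulr_ge0// ltW.
have /andP[a1 a2] := truncn_bounds tb0; rewrite -/a in a1 a2.
have bp : 0 < b.+1%:R :> R by [].
have qle : Q a b <= theta by rewrite /Q ler_pdivrMr.
have qge : theta - e < Q a b.
  apply: (@lt_le_trans _ _ (theta - b.+1%:R^-1)); first by rewrite ltrD2l ltrN2.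
  by rewrite /Q ler_pdivlMr// mulrBl mulVf ?gt_eqF//; lra.
have e1 : e <= theta / 2 by rewrite ge_min lexx.
have e2 : e <= g * theta / (4 * k.+1%:R) by rewrite ge_min lexx orbT.
have Q0 : 0 < Q a b by lra.
have hQ : 0 < Q a b <= 1 by rewrite Q0; lra.
have := profile_theta_le d0 X0 L1 XL Lle Q0 qle th1 (Hprof th) (Hprof hQ) => ple.
have sm : (theta - Q a b) * k%:R / Q a b <= g / 2.
  rewrite ler_pdivrMr//.
  have k1 : 0 < k.+1%:R :> R by [].
  have : e * k.+1%:R <= g * theta / 4.
    by move: e2; rewrite ler_pdivlMr ?mulr_gt0//; lra.
  have : (theta - Q a b) * k%:R <= e * k.+1%:R.
    apply: ler_pM => //; [by rewrite subr_ge0|lra|by rewrite ler_nat].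
  have : g * (theta / 2) <= g * Q a b by rewrite ler_pM2l//; lra.
  lra.
have gap : g / 2 <= prof (Q a b) - sg by move: ple; rewrite /g in sm *; lra.
(* Makes 2/(m+1) smaller than q g/2, hence than q times the gap that remains at q. *)
pose m := Num.truncn (Q a b * (g / 2) / 2)^-1.
apply: (G a b m hQ A fA sg sg0); last exact: adm_mono ad.
have z0 : 0 < Q a b * (g / 2) / 2 by apply: divr_gt0 => //; apply: mulr_gt0 => //; exact: divr_gt0.
have zV : 0 <= (Q a b * (g / 2) / 2)^-1 by rewrite invr_ge0 ltW.
have /andP[_ h] := truncn_bounds zV; rewrite -/m natr1 in h.
have h' : m.+1%:R^-1 < Q a b * (g / 2) / 2 by rewrite -[ltRHS]invrK ltf_pV2 ?posrE ?invr_gt0.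
have h'' : Q a b * (g / 2) <= Q a b * (prof (Q a b) - sg) by rewrite ler_pM2l.
apply: le_trans h''; move: (m.+1%:R^-1) (Q a b * (g / 2)) h' => u v; lra.
Qed.

End AllTheta.

End AlmostSure.

(** * Passage from admissible exponents to dimensions, and the empty set *)

Section Endgame.
Variables (R : realType) (d k : nat).

Lemma lower_profileP (X : set 'rV[R]_d) Lb theta : (0 < d)%N -> X !=set0 -> 1 <= Lb ->
  (forall y : 'rV[R]_d, closure X y -> enorm y <= Lb) -> 0 < theta <= 1 ->
  is_profile k X (@liminf0 R) theta (lower_profile k theta X).
Proof.
move=> d0 X0 L1 XL th.
have ex := @profile_exists R d k X Lb d0 X0 L1 XL (@liminf0 R) (@liminf0_le R) (liminf0_cst0 R) theta th.
exact: (xgetPex 0 ex).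
Qed.

Lemma upper_profileP (X : set 'rV[R]_d) Lb theta : (0 < d)%N -> X !=set0 -> 1 <= Lb ->
  (forall y : 'rV[R]_d, closure X y -> enorm y <= Lb) -> 0 < theta <= 1 ->
  is_profile k X (@limsup0 R) theta (upper_profile k theta X).
Proof.
move=> d0 X0 L1 XL th.
have ex := @profile_exists R d k X Lb d0 X0 L1 XL (@limsup0 R) (@limsup0_le R) (limsup0_cst0 R) theta th.
exact: (xgetPex 0 ex).
Qed.

Lemma lower_admissible_mono m q theta (Y : set 'rV[R]_m) s : 0 < q -> q <= theta ->
  lower_admissible theta Y s -> lower_admissible q Y s.
Proof.
move=> q0 qt H e e0 r0 r00; have m0 : 0 < Num.min r0 1 by rewrite lt_min r00 ltr01.
have [r [/andP[rr rm] ok]] := H e e0 _ m0; exists r.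
move: rm; rewrite le_min => /andP[rm1 rm2]; rewrite rr rm1; split=> //.
by apply: theta_cover_ok_mono ok => //; rewrite rr.
Qed.

Lemma upper_admissible_mono m q theta (Y : set 'rV[R]_m) s : 0 < q -> q <= theta ->
  upper_admissible theta Y s -> upper_admissible q Y s.
Proof.
move=> q0 qt H e e0; have [r0 [r00 ok]] := H e e0.
exists (Num.min r0 1); split; first by rewrite lt_min r00 ltr01.
move=> r /andP[rr]; rewrite le_min => /andP[rm1 rm2].
by apply: theta_cover_ok_mono (ok r _) => //; rewrite rr.
Qed.

Lemma lower_int_dim_ge m theta (Y : set 'rV[R]_m) (a : R) :
  (forall s, 0 <= s -> lower_admissible theta Y s -> a <= s) -> (a%:E <= lower_int_dim theta Y)%E.
Proof. by move=> H; apply: le_ereal_inf_tmp => _ [s [s0 ad] <-]; rewrite lee_fin H. Qed.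

Lemma upper_int_dim_ge m theta (Y : set 'rV[R]_m) (a : R) :
  (forall s, 0 <= s -> upper_admissible theta Y s -> a <= s) -> (a%:E <= upper_int_dim theta Y)%E.
Proof. by move=> H; apply: le_ereal_inf_tmp => _ [s [s0 ad] <-]; rewrite lee_fin H. Qed.

Lemma theta_cover_ok_set0 m (theta r s e : R) : 0 < e -> theta_cover_ok (set0 : set 'rV[R]_m) theta r s e.
Proof. by move=> e0; exists [::]; split => //; split => //; rewrite big_nil ltW. Qed.

Lemma lower_int_dim_set0 m theta : lower_int_dim theta (set0 : set 'rV[R]_m) = 0%E.
Proof.
apply/eqP; rewrite eq_le; apply/andP; split; last exact: lower_int_dim_ge.
apply: ereal_inf_lbound; exists 0 => //; split => // e e0 r0 r00.
by exists r0; rewrite r00 lexx; split => //; exact: theta_cover_ok_set0.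
Qed.

Lemma upper_int_dim_set0 m theta : upper_int_dim theta (set0 : set 'rV[R]_m) = 0%E.
Proof.
apply/eqP; rewrite eq_le; apply/andP; split; last exact: upper_int_dim_ge.
apply: ereal_inf_lbound; exists 0 => //; split => // e e0; exists 1; split => // r _.
exact: theta_cover_ok_set0.
Qed.

(* No probability is carried by the empty set, so the infimum is [+oo], the capacity
   is the junk value [0], and so is its logarithm. *)
Lemma capacity_set0 s r theta : capacity k s r theta (set0 : set 'rV[R]_d) = 0.
Proof.
rewrite /capacity (_ : [set e | _] = set0); first by rewrite ereal_inf0/= invr0.
apply/seteqP; split => // e [mu [+ _]]; rewrite closure0 setC0 => mu0.
by have := @probability_setT _ _ _ mu; rewrite mu0 => /eqP; rewrite eq_sym onee_eq0.
Qed.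

Lemma lower_profile_set0 theta : lower_profile k theta (set0 : set 'rV[R]_d) = 0.
Proof.
rewrite /lower_profile; case: xgetP => [s _ [_]|//].
rewrite (_ : (fun r => _) = (fun=> 0)) ?liminf0_cst0; first by move=> [].
by apply/funext => r; rewrite capacity_set0 ln0// mul0r.
Qed.

Lemma upper_profile_set0 theta : upper_profile k theta (set0 : set 'rV[R]_d) = 0.
Proof.
rewrite /upper_profile; case: xgetP => [s _ [_]|//].
rewrite (_ : (fun r => _) = (fun=> 0)) ?limsup0_cst0; first by move=> [].
by apply/funext => r; rewrite capacity_set0 ln0// mul0r.
Qed.

End Endgame.

Theorem theorem5p3 (R : realType) (d k : nat) (X : set 'rV[R]_d) :
  bounded_set X -> (1 <= k)%N -> (k < d)%N ->
  (forall P : 'M[R]_d, grassmannian k P ->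
   forall A : 'M[R]_(k, d), frame_of A P ->
   forall theta : R, 0 < theta <= 1 ->
     (lower_int_dim theta (proj_coords A X) <= (lower_profile k theta X)%:E)%E /\
     (upper_int_dim theta (proj_coords A X) <= (upper_profile k theta X)%:E)%E) /\
  (forall gamma : probability (borelT 'M[R]_d) R,
     rotation_invariant gamma ->
     gamma (~` [set P | grassmannian k P]) = 0%E ->
     {ae gamma, forall P : borelT 'M[R]_d, grassmannian k P ->
        forall A : 'M[R]_(k, d), frame_of A P ->
        forall theta : R, 0 < theta <= 1 ->
          lower_int_dim theta (proj_coords A X) = (lower_profile k theta X)%:E /\
          upper_int_dim theta (proj_coords A X) = (upper_profile k theta X)%:E}).
Proof.
move=> bX k0 kd; have d0 : (0 < d)%N by exact: leq_trans kd.
(* The empty set has no configurations and is treated apart: the empty cover gives dimension 0, and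
   the default values of the definitions give profile 0. *)
have [X0|X0] := eqVneq X set0.
  have p0 (A : 'M[R]_(k, d)) : proj_coords A X = set0.
    by rewrite X0; apply/seteqP; split => // y [].
  have E (A : 'M[R]_(k, d)) theta :
      lower_int_dim theta (proj_coords A X) = (lower_profile k theta X)%:E /\
      upper_int_dim theta (proj_coords A X) = (upper_profile k theta X)%:E.
    by rewrite p0 lower_int_dim_set0 upper_int_dim_set0 X0 lower_profile_set0 upper_profile_set0.
  split=> [P _ A _ theta _|gamma _ _]; first by have [-> ->] := E A theta.
  by apply: aeW => P _ A _ theta _; exact: E.
move/set0P: X0 => X0; have [Lb L1 XL] := bounded_enorm bX.
have lP theta th := @lower_profileP R d k X Lb theta d0 X0 L1 XL th.
have uP theta th := @upper_profileP R d k X Lb theta d0 X0 L1 XL th.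
have upper P (A : 'M[R]_(k, d)) theta : frame_of A P -> 0 < theta <= 1 ->
    (lower_int_dim theta (proj_coords A X) <= (lower_profile k theta X)%:E)%E /\
    (upper_int_dim theta (proj_coords A X) <= (upper_profile k theta X)%:E)%E.
  move=> [AA _] th; split.
    by apply: (lower_int_dim_le d0 k0 X0 L1 XL th AA); exact: lP.
  by apply: (upper_int_dim_le d0 k0 X0 L1 XL th AA); exact: uP.
split=> [P _ A fA theta th|gamma rot gG]; first exact: upper fA th.
have nl := ae_profile_le d0 X0 L1 XL (@liminf0_le R) lP (@lower_admissible_mono R k)
  (ae_lower_admissible d0 (ltnW kd) X0 L1 XL rot gG).
have nu := ae_profile_le d0 X0 L1 XL (@limsup0_le R) uP (@upper_admissible_mono R k)
  (ae_upper_admissible d0 (ltnW kd) X0 L1 XL rot gG).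
apply: negligibleS (negligibleU nl nu) => P nP.
apply: contrapT => /not_orP[/contrapT hl /contrapT hu]; apply: nP => _ A fA theta th.
have [ul uu] := upper P A theta fA th.
split; apply/eqP; rewrite eq_le ?ul ?uu /=.
  by apply: lower_int_dim_ge => s s0 ad; exact: hl ad.
by apply: upper_int_dim_ge => s s0 ad; exact: hu ad.
Qed.
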